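(* Let $T>0$, let $Z$ be a Lévy process with characteristic triplet $(a,0,\pi)$, $\pi$ symmetric, $g(t,s)$ a deterministic measurable kernel and $Y_t=\int_0^tg(t,s)\,dZ_s$, $t\in[0,T]$. Assume that for some $p\ge2$ we have $\int_{\mathbb R}|x|^p\pi(dx)<\infty$, and that for some $\alpha\in\mathbb R$, $\beta>-\frac1p$, $\gamma>-\frac1p$ with $\alpha+\beta+\gamma>-\frac1p$ and some $\delta>0$: (B1) there is a constant $C$ with $|g(t,u)|\le Ct^\alpha u^\beta(t-u)^\gamma$ for all $0<u<t\le T$; (B2) there is a function $h(t,s,u)$ such that $|g(t,u)-g(s,u)|\le|t-s|^\delta h(t,s,u)$ for all $0<u<s<t\le T$, and $\sup_{0<s<t\le T}\int_0^s|h(t,s,u)|^p\,du<\infty$. Let $\kappa=\alpha+\beta+\gamma$ if $\alpha+\beta<0$ and $\kappa=\gamma$ if $\alpha+\beta\ge0$. Then there is a constant $C$ such that for all $0\le s<t\le T$ $$\mathbf E|Y_t-Y_s|^p\le C(t-s)^{\min\{\kappa p+1,\,\delta p\}}.$$ If $\kappa>0$ and $\delta>\frac1p$, then the trajectories of $Y$ are (up to modification) a.s. Hölder continuous up to order $\min\{\kappa,\delta-\frac1p\}$.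
   Context: $Z$ satisfies $\mathbf E e^{i\mu Z_t}=e^{t\Psi(\mu)}$ with $\Psi(\mu)=-\frac{a\mu^2}2+\int_{\mathbb R}(e^{i\mu x}-1-i\mu\tau(x))\pi(dx)$, where $\tau(x)=x$ for $|x|\le1$, $\tau(x)=x/|x|$ for $|x|>1$, $a\ge0$, and $\pi$ is a symmetric Lévy measure ($\pi(\{0\})=0$, $\int(x^2\wedge1)\pi(dx)<\infty$); the drift is zero. The integral with respect to $Z$ is understood (Rajput–Rosiński) as the limit in probability of integrals of elementary functions. ''Hölder continuous up to order $\rho$'' means Hölder continuous of every order in $(0,\rho)$. *)

(* Defs.v *)
(* MathComp world, with MathComp-Analysis and, for R[i], mathcomp-real-closed. *)
From HB Require Import structures.
From mathcomp Require Import all_boot all_order all_algebra.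
From mathcomp Require Import complex.
From mathcomp Require Import all_classical all_reals all_analysis.

Set Implicit Arguments.
Unset Strict Implicit.
Unset Printing Implicit Defensive.

Import Order.TTheory GRing.Theory Num.Theory.
Import numFieldNormedType.Exports HBSimple.

Local Open Scope classical_set_scope.
Local Open Scope ring_scope.

Section complex_valued.
Context {R : realType}.

Definition expi (x : R) : R[i] := (cos x +i* sin x)%C.

Definition expC (z : R[i]) : R[i] :=
  ((expR (complex.Re z))%:C)%C * expi (complex.Im z).

Definition Cintegral d (T : measurableType d)
    (mu : {measure set T -> \bar R}) (f : T -> R[i]) : R[i] :=
  (Rintegral mu setT (fun x => complex.Re (f x)) +i*
   Rintegral mu setT (fun x => complex.Im (f x)))%C.

End complex_valued.

Section levy_triplet.
Context {R : realType}.

Definition levy_measure (nu : {measure set (measurableTypeR R) -> \bar R}) :=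
  nu [set 0] = 0%E /\
  (\int[nu]_(x in setT) (Num.min (x ^+ 2) 1)%:E < +oo)%E.

Definition symmetric_measure
    (nu : {measure set (measurableTypeR R) -> \bar R}) :=
  forall A : set (measurableTypeR R), measurable A -> nu (-%R @^-1` A) = nu A.

(* the truncation function fixing the meaning of the drift b below *)
Definition trunc (x : R) : R := if `|x| <= 1 then x else x / `|x|.

Definition levy_exponent (a b : R)
    (nu : {measure set (measurableTypeR R) -> \bar R}) (mu : R) : R[i] :=
  ((0 +i* (b * mu)) - (a * mu ^+ 2 / 2)%:C +
   Cintegral nu (fun x => expi (mu * x) - 1 - (0 +i* (mu * trunc x))))%C.

End levy_triplet.

Section probability.
Context {d} {Omega : measurableType d} {R : realType} (P : probability Omega R).

Definition charfun (X : Omega -> R) (mu : R) : R[i] :=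
  Cintegral P (fun w => expi (mu * X w)).

(* Taking B i = setT for some of the i gives the product rule for subfamilies. *)
Definition mutually_independent n (X : 'I_n -> Omega -> R) :=
  forall B : 'I_n -> set R, (forall i, measurable (B i)) ->
    P (\bigcap_(i in [set: 'I_n]) X i @^-1` B i) =
    (\prod_(i < n) P (X i @^-1` B i))%E.

Definition cvg_in_probability (X : nat -> Omega -> R) (Y : Omega -> R) :=
  forall e : R, 0 < e ->
    P [set w | e <= `|X n w - Y w|] @[n --> \oo] --> 0%E.

Record levy_process (Z : R -> {RV P >-> R}) : Prop := {
  levy_start : {ae P, forall w, Z 0 w = 0} ;
  levy_independent : forall n (t : nat -> R),
    0 <= t 0%N -> (forall i, t i <= t i.+1) ->
    mutually_independent (fun (i : 'I_n) w => Z (t i.+1) w - Z (t i) w) ;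
  levy_stationary : forall s t : R, 0 <= s -> s <= t ->
    forall B : set R, measurable B ->
      P [set w | B (Z t w - Z s w)] = P (Z (t - s) @^-1` B) ;
  levy_stochastically_continuous : forall t : R, 0 <= t ->
    forall e : R, 0 < e ->
      P [set w | e <= `|Z u w - Z t w|]
        @[u --> within [set u | 0 <= u] (nbhs t)] --> 0%E ;
  levy_cadlag : {ae P, forall w, forall t : R, 0 <= t ->
      (Z u w @[u --> t^'+] --> Z t w) /\
      (0 < t -> cvg (Z u w @[u --> t^'-]))} }.

Definition levy_process_triplet (Z : R -> {RV P >-> R}) (a b : R)
    (nu : {measure set (measurableTypeR R) -> \bar R}) :=
  levy_process Z /\
  forall t mu : R, 0 <= t ->
    charfun (Z t) mu = expC ((t%:C)%C * levy_exponent a b nu mu).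

(* the delta-ring of bounded Borel subsets of ]0, +oo[ *)
Definition bounded_borel (A : set R) :=
  measurable A /\ exists t : R, A `<=` `]0, t].

(* L is the independently scattered random measure with L ]s, t] = Z_t - Z_s *)
Record levy_random_measure (Z : R -> {RV P >-> R})
    (L : set R -> Omega -> R) : Prop := {
  lrm_measurable : forall A, bounded_borel A -> measurable_fun setT (L A) ;
  lrm_independent : forall n (A : 'I_n -> set R),
    (forall i, bounded_borel (A i)) -> trivIset setT A ->
    mutually_independent (fun i => L (A i)) ;
  lrm_sigma_additive : forall A : nat -> set R,
    (forall i, bounded_borel (A i)) -> trivIset setT A ->
    bounded_borel (\bigcup_i A i) ->
    {ae P, forall w,
      \sum_(0 <= i < n) L (A i) w @[n --> \oo] --> L (\bigcup_i A i) w} ;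
  lrm_increment : forall s t : R, 0 <= s -> s <= t ->
    {ae P, forall w, L `]s, t]%classic w = Z t w - Z s w} }.

(* the elementary integral of a simple function over a bounded Borel set A *)
Definition simple_integral (L : set R -> Omega -> R)
    (f : {sfun measurableTypeR R >-> R}) (A : set R) (w : Omega) : R :=
  \sum_(x \in range f) x * L (A `&` f @^-1` [set x]) w.

(* X is the Rajput--Rosinski integral of f over ]0, t] with respect to Z; as in
   their definition, convergence is required over every Borel subset. *)
Definition levy_integral (Z : R -> {RV P >-> R}) (t : R) (f : R -> R)
    (X : {RV P >-> R}) :=
  exists L : set R -> Omega -> R, levy_random_measure Z L /\
  exists f_ : nat -> {sfun measurableTypeR R >-> R},
    [/\ {ae lebesgue_measure, forall u : R, `]0, t]%classic u ->
           f_ n u @[n --> \oo] --> f u},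
        forall A : set R, measurable A -> A `<=` `]0, t] ->
          exists XA : {RV P >-> R},
            cvg_in_probability (fun n => simple_integral L (f_ n) A) XA &
        cvg_in_probability (fun n => simple_integral L (f_ n) `]0, t]%classic) X].

Definition modification_on (D : set R) (X Y : R -> {RV P >-> R}) :=
  forall t, D t -> {ae P, forall w, X t w = Y t w}.

End probability.

Section hoelder.
Context {R : realType}.

Definition hoelder_on (D : set R) (rho : R) (f : R -> R) :=
  exists K : R, forall s t, D s -> D t -> `|f t - f s| <= K * `|t - s| `^ rho.

Definition hoelder_up_to (D : set R) (r : R) (f : R -> R) :=
  forall rho : R, 0 < rho -> rho < r -> hoelder_on D rho f.

End hoelder.

(* Main.v *)
(** The heart of the matter is the estimate [E |\int F dZ|^p <= K \int |F|^p du].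
Moments are only reached through bounded random variables: summing
[sin (m x) ^ 2K] over dyadic scales [m] with weights [m ^ -p] gives a quantity
comparable to [|x| ^ p].  For a simple integrand one cuts the time interval into
small cells; adding one cell, whose law is symmetric and infinitely divisible,
increases [E (sin (m X) ^ 2K)] by a controlled amount, and a discrete Gronwall
argument bounds it by a power of the energy [\int psi (m F)] plus the jump part
[\int \int sin (m F z) ^ 2K nu (dz) du].  The bound passes to the limit because a
sequence of symmetric integrals converging in probability is Cauchy in the energy.
Summing over dyadic scales turns the jump part into [\int |F|^p].  For
[F = g(t, .) - g(s, .)] the conditions (B1) and (B2) bound [\int |F|^p] by a power of
[t - s], and the path regularity is Kolmogorov--Chentsov. *)

Require Import Defs.
From HB Require Import structures.
From mathcomp Require Import all_boot all_order all_algebra.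
From mathcomp Require Import finmap complex ring lra.
From mathcomp Require Import all_classical all_reals all_analysis measurable_realfun.

Set Implicit Arguments.
Unset Strict Implicit.
Unset Printing Implicit Defensive.

Import Order.TTheory GRing.Theory Num.Theory.
Import numFieldNormedType.Exports HBSimple.

Local Open Scope classical_set_scope.
Local Open Scope ring_scope.

(** * Trigonometric and power inequalities *)

Section elementary.
Context {R : realType}.
Implicit Types x y z a b : R.

(** The integral is known only as a limit in probability, and its law only through characteristic
    functions. Since [sin x ^+ (2 * K)] is a finite sum of cosines, its mean is a combination of
    values of the characteristic function, hence explicit. The order K satisfies 2K >= p + 1: at
    small scales the sine power then beats the weight m^-p, while at large scales boundedness is
    enough. As p >= 2 this forces K >= 2, so the Gaussian part, quadratic in m, cancels from the
    first-order term of a small cell and enters only through a power of the energy. A direct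
    Gronwall argument would produce exp (C * energy), useless at large m. Comparing the lower power
    sin^(2K-2) with a level theta that dominates the energy normalises the Gronwall weights to total
    at most 1, so the factor [expR C] is the same at every scale. A Levy measure with a p-th moment,
    p >= 2, has a second moment; this makes the characteristic exponent Lipschitz in m^2, and
    energies are then controlled by the L^2 norm of the integrand. *)

Lemma expRN_le x : 0 <= x -> expR (- x) <= 1 - x + x ^+ 2.
Proof.
move=> x0; have x1 : 0 < 1 + x by lra.
rewrite expRN; apply: (@le_trans _ _ (1 + x)^-1).
  by rewrite lef_pV2 ?posrE ?expR_gt0// expR_ge1Dx.
rewrite -[leLHS]mul1r ler_pdivrMr//.
have -> : (1 - x + x ^+ 2) * (1 + x) = 1 + x ^+ 3 by rewrite ?exprS; ring.
by rewrite lerDl exprn_ge0.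
Qed.

(** A mixed monomial lies below one of the two on the right, according to which of x and y is
    larger. This and the next lemma absorb the intermediate terms of the recursion in
    [even_power_sym]. *)
Lemma mulr_expn_le x y k : 0 <= x -> 0 <= y ->
  x * y ^+ k.+1 <= x ^+ k.+1 * y + y ^+ k.+2.
Proof.
move=> x0 y0; have [xy|/ltW yx] := leP x y.
  rewrite [y ^+ k.+2]exprS ler_wpDl ?mulr_ge0 ?exprn_ge0//.
  by rewrite ler_pM ?exprn_ge0.
rewrite ler_wpDr ?exprn_ge0// [y ^+ k.+1]exprSr [x ^+ _]exprS -!mulrA.
by rewrite !ler_pM ?exprn_ge0 ?mulr_ge0 ?exprn_ge0// lerXn2r ?nnegrE.
Qed.

Lemma mulr_expn_le2 x y k : 0 <= x -> 0 <= y ->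
  x ^+ k * y ^+ 2 <= x ^+ k.+1 * y + y ^+ k.+2.
Proof.
move=> x0 y0; have [xy|/ltW yx] := leP x y.
  rewrite ler_wpDl ?mulr_ge0 ?exprn_ge0//.
  have -> : y ^+ k.+2 = y ^+ k * y ^+ 2 by rewrite -exprD addn2.
  by rewrite ler_pM ?exprn_ge0// lerXn2r ?nnegrE.
rewrite ler_wpDr ?exprn_ge0//.
have -> : x ^+ k.+1 * y = x ^+ k * (x * y) by rewrite exprSr mulrA.
rewrite expr2.
by rewrite !ler_pM ?exprn_ge0 ?mulr_ge0.
Qed.

(* With [E] the even part and [O] the odd part in [b] of [(a + b) ^ 2k], the
   identity [(a + b)^2 = (a^2 + b^2) + 2ab] gives a joint recursion. *)
Lemma even_power_sym k : exists2 C : R, 0 <= C & forall a b,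
  ((a + b) ^+ (2 * k.+1) + (a - b) ^+ (2 * k.+1)) / 2 <=
    a ^+ (2 * k.+1) + C * (a ^+ (2 * k) * b ^+ 2 + b ^+ (2 * k.+1)).
Proof.
pose E m a b : R := ((a + b) ^+ (2 * m) + (a - b) ^+ (2 * m)) / 2.
pose O m a b : R := (2 * a * b) * (((a + b) ^+ (2 * m) - (a - b) ^+ (2 * m)) / 2).
have key : exists2 C : R, 0 <= C & forall a b, let A := a ^+ 2 in let B := b ^+ 2 in
   E k.+1 a b <= A ^+ k.+1 + C * (A ^+ k * B + B ^+ k.+1) /\
   O k.+1 a b <= C * (A ^+ k.+1 * B + A * B ^+ k.+1).
  elim: k => [|k [C C0 IH]].
    exists 4 => // a b A B; split.
      rewrite /E /A /B muln1 expr0 mul1r !expr1.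
      have -> : ((a + b) ^+ 2 + (a - b) ^+ 2) / 2 = a ^+ 2 + b ^+ 2 by field.
      by have := sqr_ge0 b; lra.
    rewrite /O /A /B muln1 !expr1.
    have -> : 2 * a * b * (((a + b) ^+ 2 - (a - b) ^+ 2) / 2) =
              4 * (a ^+ 2 * b ^+ 2) by field.
    by have := mulr_ge0 (sqr_ge0 a) (sqr_ge0 b); lra.
  (* A generous common constant: the even part needs about 5C + 1 and the odd part about 11C + 4. *)
  exists (20 * (C + 1)); first by lra.
  move=> a b A B; have [IHE IHO] := IH a b.
  have A0 : 0 <= A by exact: sqr_ge0.
  have B0 : 0 <= B by exact: sqr_ge0.
  have powS (x : R) : x ^+ (2 * k.+2) = x ^+ 2 * x ^+ (2 * k.+1).
    by rewrite mulnS exprD.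
  have ES : E k.+2 a b = (A + B) * E k.+1 a b + O k.+1 a b.
    rewrite /E /O /A /B !powS.
    set u := (a + b) ^+ (2 * _); set v := (a - b) ^+ (2 * _).
    by move: u v => u v; field.
  have OS : O k.+2 a b = (A + B) * O k.+1 a b + 4 * A * B * E k.+1 a b.
    rewrite /E /O /A /B !powS.
    set u := (a + b) ^+ (2 * _); set v := (a - b) ^+ (2 * _).
    by move: u v => u v; field.
  rewrite -/A -/B in IHE IHO; clearbody A B.
  have e1 : A * B ^+ k.+1 <= A ^+ k.+1 * B + B ^+ k.+2 by exact: mulr_expn_le.
  have e2 : A ^+ k * B ^+ 2 <= A ^+ k.+1 * B + B ^+ k.+2 by exact: mulr_expn_le2.
  have p1 : 0 <= A ^+ k.+1 * B by apply: mulr_ge0 => //; exact: exprn_ge0.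
  have p2 : 0 <= B ^+ k.+2 by exact: exprn_ge0.
  have e3 : A ^+ k.+1 * B ^+ 2 <= A ^+ k.+2 * B + A * B ^+ k.+2.
    have -> : A ^+ k.+1 * B ^+ 2 = A * (A ^+ k * B ^+ 2) by rewrite ?exprS; ring.
    have -> : A ^+ k.+2 * B + A * B ^+ k.+2 = A * (A ^+ k.+1 * B + B ^+ k.+2) by rewrite ?exprS; ring.
    exact: ler_wpM2l.
  have e4 : A ^+ 2 * B ^+ k.+1 <= A ^+ k.+2 * B + A * B ^+ k.+2.
    have -> : A ^+ 2 * B ^+ k.+1 = A * (A * B ^+ k.+1) by rewrite ?exprS; ring.
    have -> : A ^+ k.+2 * B + A * B ^+ k.+2 = A * (A ^+ k.+1 * B + B ^+ k.+2) by rewrite ?exprS; ring.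
    exact: ler_wpM2l.
  have p3 : 0 <= A ^+ k.+2 * B by apply: mulr_ge0 => //; exact: exprn_ge0.
  have p4 : 0 <= A * B ^+ k.+2 by apply: mulr_ge0 => //; exact: exprn_ge0.
  split.
    rewrite ES.
    have : (A + B) * E k.+1 a b <=
           (A + B) * (A ^+ k.+1 + C * (A ^+ k * B + B ^+ k.+1)).
      by rewrite ler_wpM2l ?addr_ge0.
    have -> : (A + B) * (A ^+ k.+1 + C * (A ^+ k * B + B ^+ k.+1)) =
      A ^+ k.+2 + A ^+ k.+1 * B + C * (A ^+ k.+1 * B + A * B ^+ k.+1
        + A ^+ k * B ^+ 2 + B ^+ k.+2) by rewrite ?exprS; ring.
    set X := A ^+ k.+1 * B in e1 e2 p1 IHO *; set Y := B ^+ k.+2 in e1 e2 p2 *.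
    set U := A * B ^+ k.+1 in e1 IHO *; set V := A ^+ k * B ^+ 2 in e2 *.
    have : C * (X + U + V + Y) <= C * (3 * (X + Y)) by rewrite ler_wpM2l//; lra.
    have : C * (X + U) <= C * (2 * (X + Y)) by rewrite ler_wpM2l//; lra.
    have : 0 <= C * (X + Y) by rewrite mulr_ge0 ?addr_ge0.
    lra.
  rewrite OS.
  have : (A + B) * O k.+1 a b <= (A + B) * (C * (A ^+ k.+1 * B + A * B ^+ k.+1)).
    by rewrite ler_wpM2l ?addr_ge0.
  have -> : (A + B) * (C * (A ^+ k.+1 * B + A * B ^+ k.+1)) =
     C * (A ^+ k.+2 * B + A ^+ 2 * B ^+ k.+1 + A ^+ k.+1 * B ^+ 2 + A * B ^+ k.+2).
    by rewrite ?exprS; ring.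
  have : 4 * A * B * E k.+1 a b <=
      4 * A * B * (A ^+ k.+1 + C * (A ^+ k * B + B ^+ k.+1)).
    by rewrite ler_wpM2l ?mulr_ge0.
  have -> : 4 * A * B * (A ^+ k.+1 + C * (A ^+ k * B + B ^+ k.+1)) =
    4 * (A ^+ k.+2 * B) + 4 * C * (A ^+ k.+1 * B ^+ 2 + A * B ^+ k.+2).
    by rewrite ?exprS; ring.
  set X := A ^+ k.+2 * B in e3 e4 p3 *; set Y := A * B ^+ k.+2 in e3 e4 p4 *.
  set U := A ^+ k.+1 * B ^+ 2 in e3 *; set V := A ^+ 2 * B ^+ k.+1 in e4 *.
  have : C * (X + V + U + Y) <= C * (3 * (X + Y)) by rewrite ler_wpM2l//; lra.
  have : C * (U + Y) <= C * (2 * (X + Y)) by rewrite ler_wpM2l//; lra.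
  have : 0 <= C * (X + Y) by rewrite mulr_ge0 ?addr_ge0.
  lra.
have [C C0 H] := key; exists C => // a b.
by have [+ _] := H a b; rewrite /E -!exprM.
Qed.

Lemma sqr_cos_le1 x : cos x ^+ 2 <= 1.
Proof. by rewrite cos2sin2 gerBl sqr_ge0. Qed.

Lemma sqr_sin_le1 x : sin x ^+ 2 <= 1.
Proof. by rewrite sin2cos2 gerBl sqr_ge0. Qed.

(** Averaging over y and -y is the effect of adding an independent symmetric variable. There is no
    term linear in [sin y], and [sin x ^+ (2 * k.+1)] keeps coefficient 1, so the estimate can be
    iterated over arbitrarily many small increments. *)
Definition sin_pow_bound k C := forall x y : R,
  (sin (x + y) ^+ (2 * k.+1) + sin (x - y) ^+ (2 * k.+1)) / 2 <=
    sin x ^+ (2 * k.+1) +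
    C * (sin x ^+ (2 * k) * sin y ^+ 2 + sin y ^+ (2 * k.+1)).

(** By the addition formulas sin (x + y) and sin (x - y) are a + b and a - b with a = sin x cos y
    and b = cos x sin y; after [even_power_sym] the cosines are bounded by 1. *)
Lemma sin_pow_sym k : exists2 C : R, 0 <= C & sin_pow_bound k C.
Proof.
have [C C0 H] := even_power_sym k; exists C => // x y.
rewrite sinD sinB; apply: (le_trans (H _ _)).
have le1 (u v : R) m : (u * cos v) ^+ (2 * m) <= u ^+ (2 * m).
  have n0 (w : R) : 0 <= w ^+ (2 * m) by rewrite exprM exprn_ge0 ?sqr_ge0.
  have v1 : cos v ^+ (2 * m) <= 1 by rewrite exprM exprn_ile1 ?sqr_ge0 ?sqr_cos_le1.
  by rewrite exprMn -[leRHS]mulr1 ler_pM.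
have n0 (u : R) m : 0 <= u ^+ (2 * m) by rewrite exprM exprn_ge0 ?sqr_ge0.
apply: lerD => //; apply: ler_wpM2l => //; apply: lerD.
  apply: ler_pM => //; first exact: sqr_ge0.
  by rewrite mulrC; have := le1 (sin y) x 1%N; rewrite muln1.
by rewrite mulrC.
Qed.

Lemma normr_sin_le x : `|sin x| <= `|x|.
Proof.
wlog x0 : x / 0 < x.
  move=> H; have [x0|x0|->] := ltgtP x 0; last by rewrite sin0.
    by have := H (- x); rewrite sinN !normrN oppr_gt0; apply.
  exact: H.
have [c _] := @MVT R sin cos 0 x x0 (fun y _ => is_derive_sin y)
  (continuous_subspaceT (@continuous_sin R)).
by rewrite sin0 !subr0 => ->; rewrite normrM ler_piMl ?cos_max.
Qed.

(** With u and v the half sum and half difference, the left side is 2 |sin u sin v| <= 2 |u v|, and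
    4 u v is the difference of squares. Bounding by squares rather than by |x - y| is what lets a
    second moment of [nu] suffice later. *)
Lemma cosB_le x y : `|cos x - cos y| <= `|x ^+ 2 - y ^+ 2| / 2.
Proof.
pose u := (x + y) / 2; pose v := (x - y) / 2.
have -> : x = u + v by rewrite /u /v; field.
have -> : y = u - v by rewrite /u /v; field.
clearbody u v; rewrite cosD cosB.
have -> : cos u * cos v - sin u * sin v - (cos u * cos v + sin u * sin v) =
  - (2 * (sin u * sin v)) by rewrite ?exprS; ring.
have -> : (u + v) ^+ 2 - (u - v) ^+ 2 = 4 * (u * v) by rewrite ?exprS; ring.
rewrite normrN !normrM (ger0_norm (_ : 0 <= 2))// (ger0_norm (_ : 0 <= 4))//.
have : `|sin u| * `|sin v| <= `|u| * `|v| by rewrite ler_pM ?normr_sin_le.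
lra.
Qed.

Lemma sin2_half x : sin x ^+ 2 = (1 - cos (2 * x)) / 2.
Proof.
by rewrite mulr_natl cos_mulr2n sin2cos2 mulr2n; field.
Qed.

Lemma onemcosE x : 1 - cos x = 2 * sin (x / 2) ^+ 2.
Proof. rewrite sin2_half; have -> : 2 * (x / 2) = x by field.
by field. Qed.

Lemma sinD_sqr_le x y : sin (x + y) ^+ 2 <= 2 * (sin x ^+ 2 + sin y ^+ 2).
Proof.
rewrite sinD; apply: (@le_trans _ _ (2 * ((sin x * cos y) ^+ 2 + (cos x * sin y) ^+ 2))).
  by have := sqr_ge0 (sin x * cos y - cos x * sin y); rewrite sqrrB sqrrD; lra.
rewrite ler_wpM2l// !exprMn lerD//.
  by rewrite -[leRHS]mulr1 ler_pM ?sqr_ge0 ?sqr_cos_le1.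
by rewrite -[leRHS]mul1r ler_pM ?sqr_ge0 ?sqr_cos_le1.
Qed.

(** The larger of the two squared sines controls the sum, with factor 4; the k-th power is taken
    only after discarding the smaller one. *)
Lemma sinD_pow_le k x y :
  sin (x + y) ^+ (2 * k) <= 4 ^+ k * (sin x ^+ (2 * k) + sin y ^+ (2 * k)).
Proof.
rewrite !exprM; set s := sin x ^+ 2; set t := sin y ^+ 2.
have s0 : 0 <= s by exact: sqr_ge0.
have t0 : 0 <= t by exact: sqr_ge0.
have le1 : sin (x + y) ^+ 2 <= 2 * (s + t) by exact: sinD_sqr_le.
wlog st : s t s0 t0 le1 / s <= t.
  move=> H; have [st|/ltW st] := leP s t; first exact: H.
  by rewrite [X in _ * X]addrC; apply: H => //; rewrite [t + s]addrC.
have le2 : sin (x + y) ^+ 2 <= 4 * t by lra.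
apply: (@le_trans _ _ ((4 * t) ^+ k)).
  by rewrite lerXn2r ?nnegrE ?sqr_ge0// mulr_ge0.
by rewrite exprMn ler_wpM2l ?exprn_ge0// lerDr exprn_ge0.
Qed.

Lemma onemcosD_le x y : 1 - cos (x + y) <= 2 * (1 - cos x) + 2 * (1 - cos y).
Proof.
rewrite !onemcosE; have := sinD_sqr_le (x / 2) (y / 2).
by rewrite -mulrDl; lra.
Qed.

Lemma sin_pow_le k x : (0 < k)%N -> sin x ^+ (2 * k) <= (1 - cos (2 * x)) / 2.
Proof.
case: k => // k _; rewrite -sin2_half mulnS exprD -[leRHS]mulr1.
rewrite ler_wpM2l ?sqr_ge0// exprM exprn_ile1 ?sqr_ge0 ?sqr_sin_le1.
Qed.

Lemma sin_pow_ge0 k x : 0 <= sin x ^+ (2 * k).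
Proof. by rewrite exprM exprn_ge0 ?sqr_ge0. Qed.

Lemma sin_pow_le1 k x : sin x ^+ (2 * k) <= 1.
Proof.
by rewrite exprM exprn_ile1 ?sqr_ge0 ?sqr_sin_le1.
Qed.

(** Pairs are (coefficient, frequency). The two vanishing sums express that the function vanishes at
    0, and to order above 2 when k > 1: the first removes constants, the second removes every
    contribution quadratic in the frequency, in particular the Gaussian one. *)
Lemma sin_pow_trig k : exists s : seq (R * R),
  [/\ forall x, sin x ^+ (2 * k) = \sum_(c <- s) c.1 * cos (c.2 * x),
      (0 < k)%N -> \sum_(c <- s) c.1 = 0 &
      (1 < k)%N -> \sum_(c <- s) c.1 * c.2 ^+ 2 = 0].
Proof.
elim: k => [|k [s [sE s0 s2]]].
  exists [:: (1, 0)]; split => // x.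
  by rewrite big_seq1 /= muln0 expr0 mul0r cos0 mulr1.
(* Multiplying cos (c x) by (1 - cos (2 x)) / 2 keeps the frequency c with weight 1/2 and creates c
   + 2 and c - 2 with weight -1/4 each. *)
exists (flatten [seq [:: (c.1 / 2, c.2); (- c.1 / 4, c.2 + 2);
                        (- c.1 / 4, c.2 - 2)] | c <- s]).
have FE (F : R * R -> R) : \sum_(c <- flatten [seq [:: (c.1 / 2, c.2);
    (- c.1 / 4, c.2 + 2); (- c.1 / 4, c.2 - 2)] | c <- s]) F c =
  \sum_(c <- s) (F (c.1 / 2, c.2) + F (- c.1 / 4, c.2 + 2) +
                 F (- c.1 / 4, c.2 - 2)).
  rewrite big_flatten big_map; apply: eq_bigr => c _.
  by rewrite unlock /= addr0 addrA.
split.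
- move=> x; rewrite FE mulnS exprD sE sin2_half mulr_sumr; apply: eq_bigr => c _ /=.
  by rewrite (mulrDl c.2 2) (mulrBl _ c.2 2) cosD cosB; field.
- by move=> _; rewrite FE big1// => c _ /=; field.
- rewrite ltnS => k0; rewrite FE.
  transitivity (\sum_(c <- s) - 2 * c.1); last by rewrite -mulr_sumr s0// mulr0.
  by apply: eq_bigr => c _ /=; field.
Qed.

End elementary.

(** * Dyadic sums comparable to powers of the absolute value *)

Section dyadic.
Context {R : realType}.
Implicit Types x y z p : R.

(** For m < 2 * N these are the powers of two from 2^-N to 2^(N-1), so a single natural index covers
    a window growing in both directions. *)
Definition scale (N m : nat) : R := 2 ^+ m / 2 ^+ N.

Lemma scale_gt0 N m : 0 < scale N m.
Proof. by rewrite divr_gt0 ?exprn_gt0. Qed.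

Lemma scaleS N m : scale N m.+1 = 2 * scale N m.
Proof. by rewrite /scale exprS mulrA. Qed.

(* [z / (1 + z)] is a bounded increasing function whose dyadic increments
   dominate [min (z, 1/z)], so the dyadic sum telescopes. *)
Lemma min_pow_telescope p k z : 1 <= p -> p + 1 <= (2 * k)%:R -> 0 < z ->
  Num.min 1 (z ^+ (2 * k)) <=
  6 * z `^ p * (2 * z / (1 + 2 * z) - z / (1 + z)).
Proof.
move=> p1 pk z0.
have -> : 2 * z / (1 + 2 * z) - z / (1 + z) = z / ((1 + 2 * z) * (1 + z)).
  by field; rewrite !gt_eqF//; lra.
have zp0 : 0 < z `^ p by rewrite powR_gt0.
have D0 : 0 < (1 + 2 * z) * (1 + z) by rewrite mulr_gt0//; lra.
(* The 6 bounds (1 + 2z)(1 + z) by 6 for z <= 1 and by 6 z^2 for z > 1. The first range uses p + 1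
   <= 2k, the second uses 1 <= p. *)
rewrite mulrA ler_pdivlMr//; have [z1|z1] := leP z 1.
  apply: (@le_trans _ _ (z ^+ (2 * k) * 6)).
    rewrite ler_pM//; last 1 first.
    - nra.
    - by rewrite le_min ler01 exprn_ge0// ltW.
    - exact: ltW.
    - by rewrite ge_min lexx orbT.
  rewrite [leLHS]mulrC -mulrA ler_wpM2l//.
  rewrite -powR_mulrn ?(ltW z0)// -{3}(@powRr1 _ z) ?(ltW z0)//.
  rewrite -powRD; last by rewrite (gt_eqF z0) implybT.
  by apply: ger_powR => //; rewrite z0.
apply: (@le_trans _ _ (1 * (6 * z ^+ 2))).
  rewrite ler_pM//.
  - by rewrite le_min ler01 exprn_ge0// ltW.
  - exact: ltW.
  - by rewrite ge_min lexx.
  - nra.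
rewrite mul1r -mulrA ler_wpM2l// expr2 ler_wpM2r//; first exact: ltW.
rewrite -{1}(@powRr1 _ z) ?(ltW z0)//.
by apply: ler_powR => //; exact: ltW.
Qed.

(** Apply [min_pow_telescope] at z = [scale N m * y]: the factor scale^p contained in z^p cancels
    the weight, and the remaining increments of z / (1 + z) telescope to at most 1. Hence the bound
    is uniform in N. *)
Lemma dyadic_sum_le p k N y : 1 <= p -> p + 1 <= (2 * k)%:R -> 0 <= y ->
  \sum_(0 <= m < 2 * N) scale N m `^ (- p) * Num.min 1 ((scale N m * y) ^+ (2 * k))
    <= 6 * y `^ p.
Proof.
move=> p1 pk; rewrite le_eqVlt => /orP[/eqP<-|y0].
  rewrite powR0; last by rewrite gt_eqF//; lra.
  rewrite mulr0 big1// => m _; rewrite mulr0 expr0n.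
  have -> : (2 * k == 0)%N = false.
    by apply/negP => /eqP k0; move: pk; rewrite k0; lra.
  by rewrite (min_idPr _)// mulr0.
pose G (z : R) := z / (1 + z).
have GE m : scale N m `^ (- p) * Num.min 1 ((scale N m * y) ^+ (2 * k)) <=
    6 * y `^ p * (G (scale N m.+1 * y) - G (scale N m * y)).
  have s0 := scale_gt0 N m.
  have := min_pow_telescope p1 pk (mulr_gt0 s0 y0).
  rewrite powRM ?(ltW y0) ?(ltW s0)// => H.
  rewrite powRN -(@ler_pM2l _ (scale N m `^ p)) ?powR_gt0//.
  rewrite mulrA divff ?mul1r ?gt_eqF ?powR_gt0//.
  have yE : scale N m.+1 * y = 2 * (scale N m * y) by rewrite scaleS mulrA.
  apply: (le_trans H); rewrite yE -/(G _) -/(G _) le_eqVlt; apply/orP; left.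
  by apply/eqP; move: (G _) (G _) => u v; ring.
apply: (le_trans (ler_sum _ (fun m _ => GE m))).
rewrite -mulr_sumr telescope_sumr// ler_piMr ?mulr_ge0 ?powR_ge0// /G.
have p0 m : 0 < scale N m * y by rewrite mulr_gt0// scale_gt0.
apply: (@le_trans _ _ (scale N (2 * N) * y / (1 + scale N (2 * N) * y))).
  by rewrite gerBl divr_ge0// ?addr_ge0// ltW.
by rewrite ler_pdivrMr; [have := p0 (2 * N)%N; lra|have := p0 (2 * N)%N; lra].
Qed.

(** A bounded substitute for |x|^p, integrable for any random variable, whose mean is a finite
    combination of sine moments. *)
Definition dyadic_sin p k N x : R :=
  \sum_(0 <= m < 2 * N) scale N m `^ (- p) * sin (scale N m * x) ^+ (2 * k).

Lemma dyadic_sin_ge0 p k N x : 0 <= dyadic_sin p k N x.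
Proof. by apply: sumr_ge0 => m _; rewrite mulr_ge0 ?powR_ge0 ?sin_pow_ge0. Qed.

Lemma exists_lt_expr2 x : exists N0 : nat, forall N, (N0 <= N)%N -> x < 2 ^+ N.
Proof.
exists (Num.bound `|x|) => N N0N.
apply: (le_lt_trans (ler_norm x)); apply: (lt_le_trans (archi_boundP _)) => //.
by rewrite -natrX ler_nat (leq_trans N0N)// ltnW// ltn_expl.
Qed.

(** Some scale m places m |x| in (1/2, 1]; that single term has sine at least sin (1/2) and weight
    m^-p >= |x|^p. The threshold depends on x, which is why Fatou's lemma is used when
    integrating. *)
Lemma dyadic_sin_ge p k x : 0 < p -> exists N0 : nat, forall N, (N0 <= N)%N ->
  sin (2^-1) ^+ (2 * k) * `|x| `^ p <= dyadic_sin p k N x.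
Proof.
move=> p0; have [->|x0] := eqVneq x 0.
  by exists 0%N => N _; rewrite normr0 powR0 ?gt_eqF// mulr0; exact: dyadic_sin_ge0.
have nx0 : 0 < `|x| by rewrite normr_gt0.
have [N1 H1] := exists_lt_expr2 (2 * `|x|).
have [N2 H2] := exists_lt_expr2 `|x|^-1.
(* [H1] makes the smallest scale bring |x| below 1/2, [H2] makes the largest one bring it above 1/2,
   so the crossing happens inside the window. *)
exists (maxn N1 N2) => N; rewrite geq_max => /andP[/H1 {}H1 /H2 {}H2].
have e0 n : 0 < 2 ^+ n :> R by rewrite exprn_gt0.
have N0 : (0 < N)%N.
  rewrite lt0n; apply/negP => /eqP N0; move: H1 H2; rewrite N0 expr0 => H1.
  by rewrite invf_plt ?posrE// invr1; lra.
have last_m : 2^-1 < scale N (2 * N).-1 * `|x|.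
  rewrite /scale; have -> : (2 * N).-1 = (N + N.-1)%N by rewrite mul2n -addnn -subn1 -addnBA// subn1.
  rewrite exprD [2 ^+ N * _]mulrC mulfK ?gt_eqF//.
  rewrite -(@ltr_pM2l _ 2)// divff// mulrA -exprS prednK//.
  by rewrite -ltr_pdivrMr// div1r.
have ex_m : exists m, 2^-1 < scale N m * `|x| by exists (2 * N).-1.
(* Minimality gives the upper bound: the preceding scale is half as large and does not exceed 1/2,
   so this one does not exceed 1. *)
have [m Hm min_m] := ex_minnP ex_m.
have m2N : (m < 2 * N)%N.
  by apply: (@leq_ltn_trans (2 * N).-1); [exact: min_m|rewrite prednK// muln_gt0].
have m0 : (0 < m)%N.
  rewrite lt0n; apply/negP => /eqP m0; move: Hm; rewrite m0 /scale expr0 div1r.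
  rewrite mulrC ltr_pdivlMr//; lra.
have mx1 : scale N m * `|x| <= 1.
  have : ~~ (2^-1 < scale N m.-1 * `|x|).
    by apply/negP => /min_m; rewrite leqNgt prednK// leqnn.
  rewrite -leNgt -{2}(prednK m0) scaleS; lra.
have s0 := scale_gt0 N m.
rewrite /dyadic_sin (@big_cat_nat _ _ _ m)//=; last exact: ltnW.
rewrite ler_wpDl//; first by apply: sumr_ge0 => i _; rewrite mulr_ge0 ?powR_ge0 ?sin_pow_ge0.
rewrite big_ltn// ler_wpDr//; first by apply: sumr_ge0 => i _; rewrite mulr_ge0 ?powR_ge0 ?sin_pow_ge0.
rewrite mulrC ler_pM ?powR_ge0 ?sin_pow_ge0//.
  rewrite powRN -div1r ler_pdivlMr ?powR_gt0// -powRM ?(ltW s0)// mulrC.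
  have -> : 1 = 1 `^ p :> R by rewrite powR1.
  by rewrite ge0_ler_powR ?nnegrE ?mulr_ge0 ?(ltW s0) ?(ltW p0).
have sE : sin (scale N m * x) ^+ (2 * k) = sin (scale N m * `|x|) ^+ (2 * k).
  have [//|xlt0] := ltP 0 x; first by move=> /gtr0_norm ->.
  by rewrite ler0_norm// mulrN sinN !exprM sqrrN.
have pi2 := @pihalf_ge1 R.
have s1 : 0 < sin (2^-1 : R) by apply: sin_gt0_pihalf; rewrite invr_gt0//=; lra.
have lt_sin : sin 2^-1 < sin (scale N m * `|x|).
  by rewrite ltr_sin// in_itv/=; apply/andP; split; lra.
by rewrite sE lerXn2r ?nnegrE ?ltW// (lt_trans s1).
Qed.

End dyadic.

(** * Expectations of bounded random variables *)

Section bounded_expectation.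
Context d (Omega : measurableType d) (R : realType) (P : probability Omega R).
Implicit Types (f g X Y : Omega -> R) (c M : R).

(** Under a probability such functions are always integrable, so the real-valued [Rintegral] is
    linear and monotone on them and its default value for non-integrable functions never
    interferes. *)
Definition bounded_mfun f :=
  measurable_fun setT f /\ exists M, forall w, `|f w| <= M.

Local Notation E f := (Rintegral P setT f).

Lemma bounded_mfun_integrable f : bounded_mfun f -> P.-integrable setT (EFin \o f).
Proof.
move=> [mf [M fM]].
apply: (@le_integrable _ _ _ P setT measurableT _ (EFin \o cst M)) => //.
- exact/measurable_EFinP.
- by move=> w _ /=; rewrite lee_fin (le_trans (fM w))// ler_norm.
- exact: finite_measure_integrable_cst.
Qed.

Lemma bounded_mfun_cst c : bounded_mfun (cst c).
Proof. by split; [exact: measurable_cst|exists `|c|]. Qed.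

Lemma bounded_mfunD f g : bounded_mfun f -> bounded_mfun g ->
  bounded_mfun (fun w => f w + g w).
Proof.
move=> [mf [M fM]] [mg [N gN]]; split; first exact: measurable_funD.
by exists (M + N) => w; rewrite (le_trans (ler_normD _ _))// lerD.
Qed.

Lemma bounded_mfunM f g : bounded_mfun f -> bounded_mfun g ->
  bounded_mfun (fun w => f w * g w).
Proof.
move=> [mf [M fM]] [mg [N gN]]; split; first exact: measurable_funM.
by exists (M * N) => w; rewrite normrM ler_pM.
Qed.

Lemma bounded_mfunZ c f : bounded_mfun f -> bounded_mfun (fun w => c * f w).
Proof. by move=> bf; apply: bounded_mfunM => //; exact: bounded_mfun_cst. Qed.

Lemma bounded_mfunN f : bounded_mfun f -> bounded_mfun (fun w => - f w).
Proof.
move=> [mf [M fM]]; split; first exact: measurable_funN.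
by exists M => w; rewrite normrN.
Qed.

Lemma bounded_mfunB f g : bounded_mfun f -> bounded_mfun g ->
  bounded_mfun (fun w => f w - g w).
Proof. by move=> bf bg; apply: bounded_mfunD => //; exact: bounded_mfunN. Qed.

Lemma bounded_mfun_sum I (s : seq I) (F : I -> Omega -> R) :
  (forall i, bounded_mfun (F i)) -> bounded_mfun (fun w => \sum_(i <- s) F i w).
Proof.
move=> bF; elim: s => [|i s IH].
  by under eq_fun do rewrite big_nil; exact: bounded_mfun_cst.
by under eq_fun do rewrite big_cons; exact: bounded_mfunD.
Qed.

Lemma bounded_mfun_cos X : measurable_fun setT X -> bounded_mfun (fun w => cos (X w)).
Proof.
move=> mX; split; last by exists 1 => w; exact: cos_max.
by apply: measurableT_comp => //; apply: continuous_measurable_fun; exact: continuous_cos.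
Qed.

Lemma bounded_mfun_sin X : measurable_fun setT X -> bounded_mfun (fun w => sin (X w)).
Proof.
move=> mX; split; last by exists 1 => w; exact: sin_max.
by apply: measurableT_comp => //; apply: continuous_measurable_fun; exact: continuous_sin.
Qed.

Lemma bounded_mfun_exp n f : bounded_mfun f -> bounded_mfun (fun w => f w ^+ n).
Proof.
move=> [mf [M fM]]; split; first exact: measurable_funX.
by exists (M ^+ n) => w; rewrite normrX lerXn2r ?nnegrE// (le_trans _ (fM w)).
Qed.

Lemma EFin_Rintegral_bounded f : bounded_mfun f ->
  (E f)%:E = (\int[P]_w (f w)%:E)%E.
Proof.
by move=> /bounded_mfun_integrable bf; rewrite /Rintegral fineK// integrable_fin_num.
Qed.

Lemma bRintegralD f g : bounded_mfun f -> bounded_mfun g ->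
  E (fun w => f w + g w) = E f + E g.
Proof. by move=> bf bg; rewrite RintegralD//; exact: bounded_mfun_integrable. Qed.

Lemma bRintegralZ c f : bounded_mfun f -> E (fun w => c * f w) = c * E f.
Proof. by move=> bf; rewrite RintegralZl//; exact: bounded_mfun_integrable. Qed.

Lemma bRintegralB f g : bounded_mfun f -> bounded_mfun g ->
  E (fun w => f w - g w) = E f - E g.
Proof. by move=> bf bg; rewrite RintegralB//; exact: bounded_mfun_integrable. Qed.

Lemma bRintegral_cst c : E (fun=> c) = c.
Proof.
rewrite Rintegral_cst// [X in fine X](_ : _ = 1%E) ?mulr1//.
exact: probability_setT.
Qed.

Lemma bRintegral_sum I (s : seq I) (F : I -> Omega -> R) :
  (forall i, bounded_mfun (F i)) ->
  E (fun w => \sum_(i <- s) F i w) = \sum_(i <- s) E (F i).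
Proof.
move=> bF; elim: s => [|i s IH].
  by under eq_fun do rewrite big_nil; rewrite big_nil bRintegral_cst.
under eq_fun do rewrite big_cons; rewrite big_cons bRintegralD ?IH//.
exact: bounded_mfun_sum.
Qed.

Lemma le_bRintegral f g : bounded_mfun f -> bounded_mfun g ->
  (forall w, f w <= g w) -> E f <= E g.
Proof. by move=> bf bg fg; apply: le_Rintegral => //; exact: bounded_mfun_integrable. Qed.

Lemma bRintegral_ge0 f : (forall w, 0 <= f w) -> 0 <= E f.
Proof. by move=> f0; apply: Rintegral_ge0. Qed.

Lemma le_bRintegral_cst f c : bounded_mfun f -> (forall w, f w <= c) -> E f <= c.
Proof.
move=> bf fc; rewrite -[leRHS]bRintegral_cst; apply: le_bRintegral => //.
exact: bounded_mfun_cst.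
Qed.

Lemma ae_eq_Rintegral f g : measurable_fun setT f -> measurable_fun setT g ->
  {ae P, forall w, f w = g w} -> E f = E g.
Proof.
move=> mf mg fg; rewrite /Rintegral; congr fine.
apply: ae_eq_integral => //; [exact/measurable_EFinP|exact/measurable_EFinP|].
by apply: filterS fg => w /= -> _.
Qed.

End bounded_expectation.

(** * The symbol of a symmetric Levy process *)

Section levy_symbol.
Context {R : realType} (a : R) (nu : {measure set (measurableTypeR R) -> \bar R}).
Hypothesis a0 : 0 <= a.
Hypothesis nu2 : (\int[nu]_x (x ^+ 2)%:E < +oo)%E.
Implicit Types (x y z m : R) (k : nat).

(** Minus the Levy exponent, which is real when [nu] is symmetric and the drift is zero. *)
Definition symbol m : R := a * m ^+ 2 / 2 + \int[nu]_x (1 - cos (m * x)).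

(** The variance per unit time; it serves as the Lipschitz constant of [symbol] as a function of
    m^2. *)
Definition symbol_var : R := a + \int[nu]_x (x ^+ 2).

(** For k > 1 this is the rate at which E (sin (z Z_t) ^ 2k) grows at t = 0: to first order only
    jumps contribute. *)
Definition jump_sin k z : R := \int[nu]_x (sin (z * x) ^+ (2 * k)).

Lemma measurable_cos : measurable_fun setT (@cos R : measurableTypeR R -> measurableTypeR R).
Proof. by apply: continuous_measurable_fun; exact: continuous_cos. Qed.

Lemma measurable_sin : measurable_fun setT (@sin R : measurableTypeR R -> measurableTypeR R).
Proof. by apply: continuous_measurable_fun; exact: continuous_sin. Qed.

Lemma measurable_cosM m : measurable_fun setT (fun x : measurableTypeR R => cos (m * x)).
Proof. by apply: (measurableT_comp measurable_cos); exact: measurable_funM. Qed.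

Lemma measurable_sinM m : measurable_fun setT (fun x : measurableTypeR R => sin (m * x)).
Proof. by apply: (measurableT_comp measurable_sin); exact: measurable_funM. Qed.

Lemma integrable_sqr : nu.-integrable setT (fun x => (x ^+ 2)%:E).
Proof.
apply/integrableP; split; first by apply/measurable_EFinP; exact: measurable_funX.
under eq_integral do rewrite gee0_abs ?lee_fin ?sqr_ge0//.
exact: nu2.
Qed.

Lemma integrable_le_sqr (f : R -> R) (c : R) :
  measurable_fun setT (f : measurableTypeR R -> R) ->
  (forall x, `|f x| <= c * x ^+ 2) -> nu.-integrable setT (EFin \o f).
Proof.
move=> mf fc; apply: (le_integrable measurableT _ _ (integrableZl measurableT c integrable_sqr)).
  exact/measurable_EFinP.
move=> x _ /=; rewrite lee_fin (le_trans (fc x))//.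
exact: ler_norm.
Qed.

Lemma onemcos_le_sqr x : 0 <= 1 - cos x <= x ^+ 2 / 2.
Proof.
rewrite subr_ge0 cos_le1/=; have := cosB_le 0 x.
rewrite cos0 expr0n/= sub0r normrN (ger0_norm (sqr_ge0 x)).
exact: le_trans (ler_norm _).
Qed.

Lemma integrable_onemcos m : nu.-integrable setT (EFin \o (fun x => 1 - cos (m * x))).
Proof.
apply: (@integrable_le_sqr _ (m ^+ 2 / 2)).
  by apply: measurable_funB => //; exact: measurable_cosM.
move=> x; have /andP[h0 h1] := onemcos_le_sqr (m * x).
by rewrite ger0_norm// (le_trans h1)// exprMn; lra.
Qed.

Lemma integrable_sin_pow k z : (0 < k)%N ->
  nu.-integrable setT (EFin \o (fun x => sin (z * x) ^+ (2 * k))).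
Proof.
move=> k0; apply: (@integrable_le_sqr _ (z ^+ 2)).
  by apply: measurable_funX; exact: measurable_sinM.
move=> x; rewrite ger0_norm ?sin_pow_ge0// (le_trans (sin_pow_le _ k0))//.
by have /andP[_ h1] := onemcos_le_sqr (2 * (z * x)); rewrite !exprMn in h1; lra.
Qed.

Lemma symbol0 : symbol 0 = 0.
Proof.
rewrite /symbol expr0n/= mulr0 mul0r add0r.
under eq_Rintegral do rewrite mul0r cos0 subrr.
by rewrite Rintegral_cst// mul0r.
Qed.

Lemma symbol_ge0 m : 0 <= symbol m.
Proof.
rewrite addr_ge0//; first by rewrite divr_ge0// mulr_ge0// sqr_ge0.
by apply: Rintegral_ge0 => x _; have /andP[] := onemcos_le_sqr (m * x).
Qed.

Lemma symbol_var_ge0 : 0 <= symbol_var.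
Proof. by rewrite addr_ge0//; apply: Rintegral_ge0 => x _; exact: sqr_ge0. Qed.

(** [onemcosD_le] integrated against [nu] for the jumps, the parallelogram identity for the Gaussian
    term. It serves as a triangle inequality for energies when the integrand is perturbed. *)
Lemma symbolD_le x y : symbol (x + y) <= 2 * symbol x + 2 * symbol y.
Proof.
rewrite /symbol.
have H : \int[nu]_u (1 - cos ((x + y) * u)) <=
    2 * \int[nu]_u (1 - cos (x * u)) + 2 * \int[nu]_u (1 - cos (y * u)).
  have ix := integrable_onemcos x; have iy := integrable_onemcos y.
  have ix2 : nu.-integrable setT (EFin \o (fun u => 2 * (1 - cos (x * u)))).
    exact: (integrableZl measurableT 2 ix).
  have iy2 : nu.-integrable setT (EFin \o (fun u => 2 * (1 - cos (y * u)))).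
    exact: (integrableZl measurableT 2 iy).
  rewrite -!RintegralZl// -RintegralD//; apply: le_Rintegral => //.
  - exact: integrable_onemcos.
  - exact: (integrableD measurableT ix2 iy2).
  - by move=> u _; rewrite mulrDl; exact: onemcosD_le.
have : 0 <= a * (x - y) ^+ 2 by rewrite mulr_ge0 ?sqr_ge0.
by rewrite sqrrB sqrrD; lra.
Qed.

(** [cosB_le] integrated against [nu]. It yields the continuity of [symbol], hence its
    measurability, and with y = 0 its quadratic growth. *)
Lemma symbol_lip x y : `|symbol x - symbol y| <= symbol_var * `|x ^+ 2 - y ^+ 2| / 2.
Proof.
have -> : symbol x - symbol y = a * (x ^+ 2 - y ^+ 2) / 2 +
    \int[nu]_u (cos (y * u) - cos (x * u)).
  rewrite /symbol.
  have -> : \int[nu]_u (cos (y * u) - cos (x * u)) =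
     \int[nu]_u (1 - cos (x * u)) - \int[nu]_u (1 - cos (y * u)).
    rewrite -RintegralB//; try exact: integrable_onemcos.
    by apply: eq_Rintegral => u _; lra.
  lra.
rewrite /symbol_var (le_trans (ler_normD _ _))// 2!mulrDl lerD//.
  by rewrite !normrM (ger0_norm a0) (@ger0_norm _ 2^-1).
have mf : measurable_fun setT ((fun u => cos (y * u) - cos (x * u)) : measurableTypeR R -> R).
  by apply: measurable_funB; exact: measurable_cosM.
have bnd u : `|cos (y * u) - cos (x * u)| <= `|x ^+ 2 - y ^+ 2| / 2 * u ^+ 2.
  rewrite (le_trans (cosB_le _ _))// !exprMn -mulrBl normrM (ger0_norm (sqr_ge0 u)).
  by rewrite distrC; lra.
have if1 := integrable_le_sqr mf bnd.
apply: (le_trans (le_normr_Rintegral _ if1)) => //.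
have -> : (\int[nu]_x (x ^+ 2)) * `|x ^+ 2 - y ^+ 2| / 2 =
   \int[nu]_u (`|x ^+ 2 - y ^+ 2| / 2 * u ^+ 2).
  rewrite RintegralZl//; last exact: integrable_sqr.
  by move: (Rintegral _ _ _) => I; ring.
apply: le_Rintegral => //.
- exact: (integrable_norm if1).
- exact: (integrableZl measurableT _ integrable_sqr).
Qed.

Lemma symbol_le m : symbol m <= symbol_var * m ^+ 2 / 2.
Proof.
have := symbol_lip m 0; rewrite symbol0 subr0 expr0n/= subr0.
by rewrite (ger0_norm (symbol_ge0 m)) (ger0_norm (sqr_ge0 m)).
Qed.

Lemma continuous_symbol : continuous symbol.
Proof.
move=> x; apply/cvgrPdist_le => e e0.
have c : (fun y => symbol_var * `|x ^+ 2 - y ^+ 2| / 2) y @[y --> x] --> 0.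
  have -> : 0 = symbol_var * `|x ^+ 2 - x ^+ 2| / 2 :> R.
    by rewrite subrr normr0 mulr0 mul0r.
  apply: cvgMl; apply: cvgMr; apply: cvg_norm; apply: cvgB; first exact: cvg_cst.
  exact: exprn_continuous.
move/cvgrPdist_le : c => /(_ _ e0); apply: filterS => y.
rewrite sub0r normrN => H; apply: (le_trans (symbol_lip _ _)).
by apply: le_trans H; rewrite ler_norm.
Qed.

Lemma measurable_symbol :
  measurable_fun setT (symbol : measurableTypeR R -> measurableTypeR R).
Proof. by apply: continuous_measurable_fun; exact: continuous_symbol. Qed.

Lemma jump_sin_ge0 k z : 0 <= jump_sin k z.
Proof. by apply: Rintegral_ge0 => x _; exact: sin_pow_ge0. Qed.

(** The doubled frequency comes from sin^2 x = (1 - cos (2 x)) / 2; this is why energies are taken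
    at [2 * m] from here on. *)
Lemma jump_sin_le k z : (0 < k)%N -> jump_sin k z <= symbol (2 * z) / 2.
Proof.
move=> k0; rewrite /jump_sin /symbol.
apply: (@le_trans _ _ ((\int[nu]_x (1 - cos (2 * z * x))) / 2)); last first.
  by rewrite ler_pM2r// lerDr divr_ge0// mulr_ge0// sqr_ge0.
rewrite mulrC -RintegralZl//; last exact: integrable_onemcos.
apply: le_Rintegral => //.
- exact: integrable_sin_pow.
- exact: (integrableZl measurableT _ (integrable_onemcos _)).
- by move=> x _; rewrite (le_trans (sin_pow_le _ k0))// mulrA mulrC.
Qed.

Lemma jump_sinD_le k x y : (0 < k)%N ->
  jump_sin k (x + y) <= 4 ^+ k * (jump_sin k x + jump_sin k y).
Proof.
move=> k0.
have i1 z := @integrable_sin_pow k z k0.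
have i2 := integrableD measurableT (i1 x) (i1 y).
rewrite /jump_sin -RintegralD// -RintegralZl//.
apply: le_Rintegral => //.
- exact: (integrableZl measurableT _ i2).
- by move=> u _; rewrite mulrDl; exact: sinD_pow_le.
Qed.

(** Write each cosine as 1 - (1 - cos): the constants cancel by the first vanishing sum, and the
    Gaussian terms that complete the integrals to values of [symbol] cancel by the second. *)
Lemma jump_sin_symbol k (s : seq (R * R)) : (1 < k)%N ->
  (forall x, sin x ^+ (2 * k) = \sum_(c <- s) c.1 * cos (c.2 * x)) ->
  \sum_(c <- s) c.1 = 0 -> \sum_(c <- s) c.1 * c.2 ^+ 2 = 0 ->
  forall z, jump_sin k z = - \sum_(c <- s) c.1 * symbol (c.2 * z).
Proof.
move=> k1 sE s0 s2 z.
have -> : \sum_(c <- s) c.1 * symbol (c.2 * z) =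
   \sum_(c <- s) c.1 * \int[nu]_x (1 - cos (c.2 * z * x)).
  rewrite /symbol; under eq_bigr do rewrite mulrDr.
  rewrite big_split/=.
  have -> : \sum_(c <- s) c.1 * (a * (c.2 * z) ^+ 2 / 2) =
    (\sum_(c <- s) c.1 * c.2 ^+ 2) * (a * z ^+ 2 / 2).
    by rewrite mulr_suml; apply: eq_bigr => c _; rewrite exprMn; ring.
  by rewrite s2 mul0r add0r.
(* Integrability and value are proved together by induction, since linearity of the integral at each
   step requires the former. *)
have key (r : seq (R * R)) : nu.-integrable setT
      (EFin \o (fun x => \sum_(c <- r) c.1 * (1 - cos (c.2 * z * x)))) /\
   \int[nu]_x (\sum_(c <- r) c.1 * (1 - cos (c.2 * z * x))) =
   \sum_(c <- r) c.1 * \int[nu]_x (1 - cos (c.2 * z * x)).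
  elim: r => [|c r [IHi IHe]].
    rewrite big_nil; split.
      by under eq_fun do rewrite big_nil; exact: integrable0.
    by under eq_Rintegral do rewrite big_nil; rewrite Rintegral_cst// mul0r.
  have ic := integrableZl measurableT c.1 (integrable_onemcos (c.2 * z)).
  rewrite big_cons; split.
    have := integrableD measurableT ic IHi.
    by apply: eq_integrable => // x _ /=; rewrite big_cons.
  under eq_Rintegral do rewrite big_cons.
  by rewrite RintegralD// IHe RintegralZl//; exact: integrable_onemcos.
rewrite -(key s).2 /jump_sin.
transitivity (\int[nu]_x (- 1 * (\sum_(c <- s) c.1 * (1 - cos (c.2 * z * x))))).
  apply: eq_Rintegral => x _; rewrite sE mulN1r.
  under [in RHS]eq_bigr do rewrite mulrBr mulr1.
  rewrite sumrB s0 sub0r opprK; apply: eq_bigr => c _; by rewrite mulrA.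
by rewrite RintegralZl ?mulN1r//; exact: (key s).1.
Qed.

(** Being a finite combination of values of the continuous [symbol], the function is measurable
    without an argument on integrals with a parameter. *)
Lemma measurable_jump_sin k : (1 < k)%N ->
  measurable_fun setT (jump_sin k : measurableTypeR R -> measurableTypeR R).
Proof.
move=> k1; have [s [sE /(_ (ltnW k1)) s0 /(_ k1) s2]] := @sin_pow_trig R k.
have -> : jump_sin k = (fun z => - \sum_(c <- s) c.1 * symbol (c.2 * z)).
  by apply/funext => z; exact: jump_sin_symbol.
apply: measurable_funN; apply: measurable_sum => c.
apply: measurable_funM => //; apply: (measurableT_comp measurable_symbol).
exact: measurable_funM.
Qed.

(** [dyadic_sum_le] at y = |z x| for each jump size x, then integration in x. This is where the p-th
    moment of [nu] enters. *)
Lemma dyadic_jump_sin_le p k N z : 1 <= p -> p + 1 <= (2 * k)%:R ->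
  nu.-integrable setT (fun x => (`|x| `^ p)%:E) ->
  \sum_(0 <= m < 2 * N) scale N m `^ (- p) * jump_sin k (scale N m * z)
    <= 6 * `|z| `^ p * \int[nu]_x (`|x| `^ p).
Proof.
move=> p1 pk ip.
have k0 : (0 < k)%N.
  by rewrite lt0n; apply/negP => /eqP k0; move: pk; rewrite k0; lra.
have key n : nu.-integrable setT (EFin \o (fun x => \sum_(0 <= m < n)
       scale N m `^ (- p) * sin (scale N m * z * x) ^+ (2 * k))) /\
   \int[nu]_x (\sum_(0 <= m < n) scale N m `^ (- p) * sin (scale N m * z * x) ^+ (2 * k)) =
   \sum_(0 <= m < n) scale N m `^ (- p) * jump_sin k (scale N m * z).
  elim: n => [|n [IHi IHe]].
    rewrite big_nil; split.
      by under eq_fun do rewrite big_nil; exact: integrable0.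
    by under eq_Rintegral do rewrite big_nil; rewrite Rintegral_cst// mul0r.
  have ic := integrableZl measurableT (scale N n `^ (- p))
     (integrable_sin_pow (scale N n * z) k0).
  rewrite big_nat_recr//=; split.
    have := integrableD measurableT IHi ic.
    by apply: eq_integrable => // x _ /=; rewrite big_nat_recr.
  under eq_Rintegral do rewrite big_nat_recr//=.
  by rewrite RintegralD// IHe RintegralZl//; exact: integrable_sin_pow.
rewrite -(key _).2 -RintegralZl//; apply: le_Rintegral => //.
- exact: (key _).1.
- exact: (integrableZl measurableT _ ip).
move=> x _; rewrite -mulrA -powRM// -normrM.
apply: le_trans (dyadic_sum_le N p1 pk (normr_ge0 (z * x))).
apply: ler_sum => m _; rewrite ler_wpM2l ?powR_ge0// le_min sin_pow_le1/=.
rewrite -mulrA !exprM lerXn2r ?nnegrE ?sqr_ge0//.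
rewrite -real_normK ?num_real// lerXn2r ?nnegrE// ?mulr_ge0 ?(ltW (scale_gt0 _ _))//.
by rewrite (le_trans (normr_sin_le _))// normrM ger0_norm// ltW// scale_gt0.
Qed.

End levy_symbol.

Lemma Rintegral_odd (R : realType) (nu : {measure set (measurableTypeR R) -> \bar R})
    (f : R -> R) : symmetric_measure nu ->
  measurable_fun setT (f : measurableTypeR R -> R) ->
  (forall x, f (- x) = - f x) -> \int[nu]_x f x = 0.
Proof.
move=> sym mf fodd; rewrite /Rintegral integralE.
pose neg : measurableTypeR R -> measurableTypeR R := fun x => - x.
have mN : measurable_fun setT neg.
  exact: (measurable_funN (@measurable_id _ _ setT)).
(* Equal finite halves cancel; if both are infinite, their extended difference is infinite and
   [fine] returns 0, so the conclusion covers that case too. *)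
suff -> : (\int[nu]_x (fun x => (f x)%:E)^\- x = \int[nu]_x (fun x => (f x)%:E)^\+ x)%E.
  by case: (\int[nu]_x _)%E => [r| |] //; rewrite -EFinB subrr.
have mp : measurable_fun setT ((fun x : measurableTypeR R => (f x)%:E)^\+)%E.
  by apply: measurable_funepos; exact/measurable_EFinP.
transitivity (\int[pushforward nu neg]_x (fun x => (f x)%:E)^\+ x)%E.
  rewrite (ge0_integral_pushforward mN)//.
  by apply: eq_integral => x _ /=; rewrite funeposE funenegE /neg fodd EFinN.
by apply: eq_measure_integral => A mA _; exact: sym.
Qed.

(** * Symmetric laws given by a real exponent *)

Section symmetric_law.
Context d (Omega : measurableType d) (R : realType) (P : probability Omega R).
Implicit Types (X Y : Omega -> R) (eta : R -> R) (m : R).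

(* [X] is symmetric with characteristic function [expR (- eta)] *)
Definition sym_law X eta := forall m,
  \int[P]_w cos (m * X w) = expR (- eta m) /\ \int[P]_w sin (m * X w) = 0.

(** Symmetry of [nu] removes the imaginary part of the exponent, so the characteristic function
    splits into a cosine transform and a vanishing sine transform, and complex numbers are left
    behind. *)
Lemma levy_sym_law (Z : R -> {RV P >-> R}) (a : R)
    (nu : {measure set (measurableTypeR R) -> \bar R}) :
  symmetric_measure nu ->
  (\int[nu]_x (x ^+ 2)%:E < +oo)%E ->
  levy_process_triplet Z a 0 nu ->
  forall t, 0 <= t -> sym_law (Z t) (fun m => t * symbol a nu m).
Proof.
move=> sym nu2 [_ cfZ] t t0 m; have := cfZ t m t0.
have mtr : measurable_fun setT (@trunc R : measurableTypeR R -> R).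
  (* The truncation is the clamp to [-1, 1]; in this form its measurability is immediate. *)
  have -> : @trunc R = (fun x => Num.max (-1) (Num.min 1 x)).
    apply/funext => x; rewrite /trunc ler_norml.
    have [x1|x1] := leP (-1) x; have [x2|x2] := leP x 1 => /=.
    - by apply/esym/max_idPr.
    - have x0 : 0 < x by lra.
      by rewrite gtr0_norm// divff ?gt_eqF//; apply/esym/max_idPr; lra.
    - have x0 : x < 0 by lra.
      by rewrite ltr0_norm// invrN mulrN divff ?lt_eqF//; apply/esym/max_idPl; lra.
    - lra.
  apply: measurable_maxr => //; exact: measurable_minr.
(* The compensated sine is odd, so it integrates to zero against a symmetric measure. *)
have Im0 : \int[nu]_x (sin (m * x) - m * trunc x) = 0.
  apply: Rintegral_odd => //.
    apply: measurable_funB; first exact: measurable_sinM.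
    exact: measurable_funM.
  move=> x; rewrite mulrN sinN /trunc normrN.
  by case: ifP => _; rewrite ?mulNr mulrN opprB opprK addrC.
have Re0 : \int[nu]_x (cos (m * x) - 1) = - \int[nu]_x (1 - cos (m * x)).
  rewrite -[RHS]mulN1r -RintegralZl//; last exact: integrable_onemcos.
  by apply: eq_Rintegral => x _; rewrite mulN1r opprB.
have zE : levy_exponent a 0 nu m = ((- symbol a nu m)%:C)%C.
  rewrite /levy_exponent /Cintegral /symbol.
  have -> : \int[nu]_x complex.Re (expi (m * x) - 1 - (0 +i* (m * trunc x))%C) =
      \int[nu]_x (cos (m * x) - 1).
    by apply: eq_Rintegral => x _ /=; rewrite subr0.
  have -> : \int[nu]_x complex.Im (expi (m * x) - 1 - (0 +i* (m * trunc x))%C) =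
      \int[nu]_x (sin (m * x) - m * trunc x).
    by apply: eq_Rintegral => x _ /=; rewrite subr0.
  rewrite Im0 Re0; apply/eqP; rewrite eq_complex /= mul0r sub0r opprD.
  by rewrite !(addr0, subr0, oppr0) !eqxx.
rewrite zE /charfun /expC /Cintegral /expi /= => /eqP; rewrite eq_complex /=.
rewrite !(mul0r, mulr0, subr0, add0r, addr0, sin0, cos0, mulr1, mulrN).
by move=> /andP[/eqP -> /eqP ->].
Qed.

End symmetric_law.

(** * Independence *)

Section independence.
Context d (Omega : measurableType d) (R : realType) (P : probability Omega R).
Implicit Types (X Y V : Omega -> R) (f : R -> R).

Local Notation E f := (Rintegral P setT f).

(** S is the minimum of n and the integer part of y, written as a sum of indicators so that after
    composition with a random variable it becomes a combination of indicators of events. *)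
Lemma count_le_natr n (y : R) : 0 <= y ->
  let S : R := \sum_(0 <= k < n) (k.+1%:R <= y)%R%:R in
  [/\ S <= y, S <= n%:R & S = n%:R \/ y < S + 1].
Proof.
move=> y0; elim: n => [|n] /=; first by rewrite big_nil; split => //; left.
rewrite big_nat_recr//=; set S := \sum_(_ <= _ < n) _ => -[Sy Sn ySn].
have [ny|yn] := leP n.+1%:R y.
  case: ySn => [Sn'|ySn'].
    by rewrite Sn' -natr1; split => //; [rewrite natr1|left].
  by exfalso; move: ny; rewrite -natr1; lra.
rewrite addr0; split => //; first by rewrite -natr1; lra.
by case: ySn => [Sn'|]; [right; rewrite Sn' natr1|right].
Qed.

Lemma staircase_le n (y : R) : 0 <= y <= 1 ->
  `|y - \sum_(0 <= k < n.+1) n.+1%:R^-1 * (k.+1%:R / n.+1%:R <= y)%R%:R| <= n.+1%:R^-1.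
Proof.
move=> /andP[y0 y1]; rewrite -mulr_sumr.
have n0 : 0 < n.+1%:R :> R by rewrite ltr0n.
under eq_bigr do rewrite ler_pdivrMr//.
have [] := @count_le_natr n.+1 (y * n.+1%:R); first by rewrite mulr_ge0// ltW.
set S := \sum_(_ <= _ < _) _ => Sy Sn H.
have -> : y - n.+1%:R^-1 * S = (y * n.+1%:R - S) / n.+1%:R.
  by rewrite mulrBl mulfK ?gt_eqF// [X in _ - X]mulrC.
have yn : y * n.+1%:R <= n.+1%:R by rewrite ler_piMl// ltW.
rewrite ger0_norm; last by rewrite divr_ge0 ?subr_ge0// ltW.
by rewrite ler_pdivrMr// mulVf ?gt_eqF//; case: H => H; lra.
Qed.

Lemma bounded_mfun_comp f X c : measurable_fun setT (f : measurableTypeR R -> measurableTypeR R) ->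
  measurable_fun setT X -> (forall x, `|f x| <= c) -> bounded_mfun (fun w => f (X w)).
Proof. by move=> mf mX fc; split; [exact: measurableT_comp|exists c]. Qed.

Lemma bounded_mfun_indic (A : set Omega) : measurable A ->
  bounded_mfun (\1_A : Omega -> R).
Proof.
move=> mA; split; first exact: measurable_indic.
by exists 1 => w; rewrite ger0_norm// indicE; case: (_ \in _).
Qed.

Lemma Rintegral_indic_prob (A : set Omega) : measurable A -> E (\1_A) = fine (P A).
Proof. by move=> mA; rewrite /Rintegral integral_indic// setIT. Qed.

(** The factorisation on indicators passes to staircase functions by linearity, and then to f
    because staircases approximate it uniformly, with error at most 1 / (n + 1). The constant c
    plays the role of the mean of V. *)
Lemma Rintegral_factor01 V X (c : R) f : bounded_mfun V -> measurable_fun setT X ->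
  (forall B : set R, measurable B ->
     E (fun w => V w * \1_(X @^-1` B) w) = c * E (\1_(X @^-1` B))) ->
  measurable_fun setT (f : measurableTypeR R -> measurableTypeR R) ->
  (forall x, 0 <= f x <= 1) ->
  E (fun w => V w * f (X w)) = c * E (fun w => f (X w)).
Proof.
move=> bV mX VX mf f01.
have [mV [M VM]] := bV.
(* Superlevel sets of f: the staircase sums their indicators with equal heights 1 / (n + 1). *)
pose D n k := f @^-1` [set y | k.+1%:R / n.+1%:R <= y].
have mD n k : measurable (D n k : set (measurableTypeR R)).
  rewrite -[D n k]setTI; apply: mf => //.
  have -> : [set y : R | k.+1%:R / n.+1%:R <= y] = `[k.+1%:R / n.+1%:R, +oo[%classic.
    by rewrite set_itvcy.
  exact: measurable_itv.
pose g n w : R := \sum_(0 <= k < n.+1) n.+1%:R^-1 * \1_(X @^-1` D n k) w.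
have gE n w : g n w = \sum_(0 <= k < n.+1) n.+1%:R^-1 * (k.+1%:R / n.+1%:R <= f (X w))%R%:R.
  apply: eq_bigr => k _; rewrite indicE; congr (_ * (nat_of_bool _)%:R).
  by apply/idP/idP => [/set_mem|H]; [|apply/mem_set].
have mXD n k : measurable (X @^-1` D n k).
  by have := mX measurableT _ (mD n k); rewrite setTI.
have b1 n k : bounded_mfun (\1_(X @^-1` D n k) : Omega -> R) by exact: bounded_mfun_indic.
have bg n : bounded_mfun (g n).
  by apply: bounded_mfun_sum => k; exact: bounded_mfunZ.
have bf : bounded_mfun (fun w => f (X w)).
  apply: (bounded_mfun_comp (c := 1)) => // x.
  by have /andP[f0 f1] := f01 x; rewrite ger0_norm.
have Eg n : E (fun w => V w * g n w) = c * E (g n).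
  rewrite [in RHS]/g bRintegral_sum; last by move=> k; exact: bounded_mfunZ.
  transitivity (E (fun w => \sum_(0 <= k < n.+1) n.+1%:R^-1 * (V w * \1_(X @^-1` D n k) w))).
    by apply: eq_Rintegral => w _; rewrite /g mulr_sumr; apply: eq_bigr => k _; rewrite mulrCA.
  rewrite bRintegral_sum; last by move=> k; apply: bounded_mfunZ; exact: bounded_mfunM.
  rewrite mulr_sumr; apply: eq_bigr => k _.
  rewrite bRintegralZ; last exact: bounded_mfunM.
  rewrite VX; last exact: mD.
  rewrite mulrCA; congr (_ * _); apply/esym.
  exact: (bRintegralZ P n.+1%:R^-1 (b1 n k)).
have fg n w : `|f (X w) - g n w| <= n.+1%:R^-1.
  by rewrite gE; exact: staircase_le.
have M0 : 0 <= M by rewrite (le_trans _ (VM point)).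
have err n : `|E (fun w => V w * f (X w)) - c * E (fun w => f (X w))| <=
    (M + `|c|) * n.+1%:R^-1.
  have -> : E (fun w => V w * f (X w)) - c * E (fun w => f (X w)) =
     E (fun w => V w * (f (X w) - g n w)) - c * E (fun w => f (X w) - g n w).
    rewrite (bRintegralB P bf (bg n)) mulrBr -Eg opprB addrA; congr (_ - _).
    rewrite -bRintegralD; last 2 first.
    - by apply: bounded_mfunM => //; exact: bounded_mfunB.
    - exact: bounded_mfunM.
    by apply: eq_Rintegral => w _; ring.
  have bfg : bounded_mfun (fun w => f (X w) - g n w) by exact: bounded_mfunB.
  have bVfg : bounded_mfun (fun w => V w * (f (X w) - g n w)) by exact: bounded_mfunM.
  have absE h k : bounded_mfun h -> (forall w, `|h w| <= k) -> `|E h| <= k.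
    move=> bh hk; rewrite ler_norml; apply/andP; split.
      rewrite -[leLHS](bRintegral_cst P); apply: le_bRintegral => //.
        exact: bounded_mfun_cst.
      by move=> w; have := hk w; rewrite ler_norml => /andP[].
    apply: le_bRintegral_cst => // w.
    by have := hk w; rewrite ler_norml => /andP[].
  rewrite (le_trans (ler_normB _ _))// mulrDl lerD//.
    by apply: absE => // w; rewrite normrM ler_pM.
  by rewrite normrM ler_wpM2l//; exact: absE.
apply/eqP; rewrite -subr_eq0 -normr_eq0; apply/eqP/le_anti; rewrite normr_ge0 andbT.
apply/ler_addgt0Pl => e e0; rewrite addr0.
have Mc0 : 0 <= M + `|c| by rewrite addr_ge0.
have [n Hn] : exists n : nat, (M + `|c|) / e <= n.+1%:R.
  exists (Num.bound ((M + `|c|) / e)).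
  apply: (@le_trans _ _ (Num.bound ((M + `|c|) / e))%:R); last by rewrite ler_nat.
  by apply/ltW/archi_boundP; rewrite divr_ge0// ltW.
apply: (le_trans (err n)).
by rewrite ler_pdivrMr ?ltr0n// mulrC -ler_pdivrMr.
Qed.

(** The affine map (1 + f) / 2 takes values in [0, 1]; undoing it requires the factorisation for
    constants, that is E V = c. *)
Lemma Rintegral_factor V X (c : R) f : bounded_mfun V -> measurable_fun setT X ->
  (forall B : set R, measurable B ->
     E (fun w => V w * \1_(X @^-1` B) w) = c * E (\1_(X @^-1` B))) ->
  measurable_fun setT (f : measurableTypeR R -> measurableTypeR R) ->
  (forall x, `|f x| <= 1) ->
  E (fun w => V w * f (X w)) = c * E (fun w => f (X w)).
Proof.
move=> bV mX VX mf f1.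
pose h x := (1 + f x) / 2.
have mh : measurable_fun setT (h : measurableTypeR R -> measurableTypeR R).
  by apply: measurable_funM => //; exact: measurable_funD.
have h01 x : 0 <= h x <= 1.
  have := f1 x; rewrite ler_norml /h => /andP[f1' f2'].
  by rewrite divr_ge0//=; lra.
(* The hypothesis at B = [setT]. *)
have VE : E V = c.
  have := VX setT measurableT; rewrite preimage_setT.
  have -> : E (\1_(setT : set Omega)) = 1.
    by rewrite indicT; exact: bRintegral_cst.
  rewrite mulr1 => <-; apply: eq_Rintegral => w _.
  by rewrite indicT/= mulr1.
have := Rintegral_factor01 bV mX VX mh h01.
have bf : bounded_mfun (fun w => f (X w)) by exact: (bounded_mfun_comp (c := 1)).
have bh : bounded_mfun (fun w => h (X w)).
  apply: (bounded_mfun_comp (c := 1)) => // x.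
  by have /andP[h0 h1] := h01 x; rewrite ger0_norm.
have -> : (fun w => f (X w)) = (fun w => 2 * h (X w) - 1).
  by apply/funext => w; rewrite /h; field.
move=> H; rewrite bRintegralB; last 2 first.
- exact: bounded_mfunZ.
- exact: bounded_mfun_cst.
rewrite bRintegralZ// bRintegral_cst.
transitivity (E (fun w => 2 * (V w * h (X w)) - V w)).
  by apply: eq_Rintegral => w _; rewrite /h; field.
rewrite bRintegralB//; last by apply: bounded_mfunZ; exact: bounded_mfunM.
rewrite bRintegralZ; last exact: bounded_mfunM.
by rewrite H VE; ring.
Qed.

End independence.

Section independent_sum.
Context d (Omega : measurableType d) (R : realType) (P : probability Omega R).
Variables (n : nat) (X : 'I_n -> Omega -> R) (eta : 'I_n -> R -> R).
Hypothesis mX : forall i, measurable_fun setT (X i).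
Hypothesis indX : mutually_independent P X.
Hypothesis lawX : forall i, sym_law P (X i) (eta i).

Local Notation E f := (Rintegral P setT f).

Let bx (B : 'I_n -> set R) : set Omega := \bigcap_(i in [set: 'I_n]) X i @^-1` B i.

Let measurable_bx B : (forall i, measurable (B i)) -> measurable (bx B).
Proof.
move=> mB; rewrite /bx; apply: fin_bigcap_measurable => // i _.
by rewrite -[_ @^-1` _]setTI; exact: mX.
Qed.

Let fine_bx B : (forall i, measurable (B i)) ->
  fine (P (bx B)) = \prod_(i < n) fine (P (X i @^-1` B i)).
Proof.
move=> mB; rewrite /bx indX// (eq_bigr (fun i => (fine (P (X i @^-1` B i)))%:E)).
  by rewrite prodEFin.
by move=> i _; rewrite fineK// fin_num_measure// -[_ @^-1` _]setTI; exact: mX.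
Qed.

(** Independence is given only as a product rule on boxes, so the induction carries the indicator of
    a box that leaves the coordinates already summed unconstrained. To add coordinate m, apply
    [Rintegral_factor] with V the trigonometric factor times this indicator; its hypothesis on a
    test set D is the induction hypothesis for the box that has D in coordinate m. *)
Lemma independent_sum_box (c : 'I_n -> R) m : (m <= n)%N ->
  forall B : 'I_n -> set R, (forall i, measurable (B i)) ->
  (forall i : 'I_n, (i < m)%N -> B i = setT) ->
  let S w := \sum_(i < n | (i < m)%N) c i * X i w in
  E (fun w => cos (S w) * \1_(bx B) w) =
    expR (- \sum_(i < n | (i < m)%N) eta i (c i)) * E (\1_(bx B)) /\
  E (fun w => sin (S w) * \1_(bx B) w) = 0.
Proof.
elim: m => [|m IH] mn B mB BT S.
  rewrite /S big_pred0// oppr0 expR0 mul1r; split.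
    by apply: eq_Rintegral => w _; rewrite big_pred0// cos0 mul1r.
  under eq_Rintegral do rewrite big_pred0// sin0 mul0r.
  exact: bRintegral_cst.
pose im : 'I_n := Ordinal mn.
pose S0 w := \sum_(i < n | (i < m)%N) c i * X i w.
have SE w : S w = S0 w + c im * X im w.
  rewrite /S (bigD1 im)//= addrC; congr (_ + _); apply: eq_bigl => i.
  by rewrite ltnS [RHS]ltn_neqAle andbC -val_eqE.
have etaE : \sum_(i < n | (i < m.+1)%N) eta i (c i) =
    \sum_(i < n | (i < m)%N) eta i (c i) + eta im (c im).
  rewrite (bigD1 im)//= addrC; congr (_ + _); apply: eq_bigl => i.
  by rewrite ltnS [RHS]ltn_neqAle andbC -val_eqE.
have mS0 : measurable_fun setT S0.
  have -> : S0 = fun w => \sum_(i < n) if (i < m)%N then c i * X i w else 0.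
    by apply/funext => w; rewrite /S0 big_mkcond.
  have mh (i : 'I_n) : measurable_fun setT
      (fun w => if (i < m)%N then c i * X i w else 0).
    case: (i < m)%N; last exact: measurable_cst.
    by apply: measurable_funM => //; exact: mX.
  exact: (measurable_sum _ mh).
have bW : bounded_mfun (\1_(bx B) : Omega -> R).
  by apply: bounded_mfun_indic; exact: measurable_bx.
have bC : bounded_mfun (fun w => cos (S0 w) * \1_(bx B) w).
  by apply: bounded_mfunM => //; exact: bounded_mfun_cos.
have bS : bounded_mfun (fun w => sin (S0 w) * \1_(bx B) w).
  by apply: bounded_mfunM => //; exact: bounded_mfun_sin.
(* Coordinate m of the box is [setT], so replacing it by D is the same as intersecting with the
   event that X_m lies in D. *)
pose upd D (i : 'I_n) : set R := if i == im then D else B i.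
have updT (i : 'I_n) : (i < m)%N -> forall D, upd D i = setT.
  move=> im' D; rewrite /upd ifN; first by rewrite BT// ltnS ltnW.
  by rewrite -val_eqE/= ltn_eqF.
have mupd D : measurable D -> forall i, measurable (upd D i).
  by move=> mD i; rewrite /upd; case: ifP.
have Bim : B im = setT by exact: BT.
have indicE2 D w : \1_(bx B) w * \1_(X im @^-1` D) w = \1_(bx (upd D)) w :> R.
  have -> : bx (upd D) = bx B `&` X im @^-1` D.
    apply/seteqP; split => [v Hv|v [Hv Dv] i _].
      split=> [i _|].
        have := Hv i I; rewrite /upd; case: eqP => // -> _.
        by rewrite Bim.
      by have := Hv im I; rewrite /upd eqxx.
    by rewrite /upd; case: eqP => [->//|_]; exact: Hv.
  by rewrite indicI.
have probE D : measurable D -> fine (P (bx (upd D))) =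
    fine (P (bx B)) * fine (P (X im @^-1` D)).
  move=> mD; rewrite !fine_bx//; last exact: mupd.
  rewrite (bigD1 im)//= [in RHS](bigD1 im)//= {1}/upd eqxx Bim preimage_setT.
  rewrite [in RHS](_ : P setT = 1%E); last exact: probability_setT.
  rewrite mul1r mulrC; congr (_ * _); apply: eq_bigr => i iim.
  by rewrite /upd (negbTE iim).
have mXD D : measurable D -> measurable (X im @^-1` D).
  by move=> mD; rewrite -[_ @^-1` _]setTI; exact: mX.
(* Cosine and sine of the partial sum separate from any bounded function of the next variable; the
   addition formulas then finish the induction. *)
have [f1 f2] : (forall f : R -> R, measurable_fun setT (f : measurableTypeR R -> measurableTypeR R) ->
   (forall x, `|f x| <= 1) ->
   E (fun w => cos (S0 w) * \1_(bx B) w * f (X im w)) =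
   (expR (- \sum_(i < n | (i < m)%N) eta i (c i)) * E (\1_(bx B))) * E (fun w => f (X im w))) /\
   (forall f : R -> R, measurable_fun setT (f : measurableTypeR R -> measurableTypeR R) ->
   (forall x, `|f x| <= 1) ->
   E (fun w => sin (S0 w) * \1_(bx B) w * f (X im w)) = 0).
  split=> f mf fle.
    apply: Rintegral_factor => // D mD.
    transitivity (E (fun w => cos (S0 w) * \1_(bx (upd D)) w)).
      by apply: eq_Rintegral => w _; rewrite -mulrA indicE2.
    have [-> _] := IH (ltnW mn) (upd D) (mupd D mD) (fun i im' => updT i im' D).
    rewrite !Rintegral_indic_prob//; [|exact: mXD|exact: measurable_bx|].
      by rewrite probE// mulrA.
    by apply: measurable_bx; exact: mupd.
  rewrite -[RHS](mul0r (E (fun w => f (X im w)))).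
  apply: Rintegral_factor => // D mD; rewrite mul0r.
  transitivity (E (fun w => sin (S0 w) * \1_(bx (upd D)) w)).
    by apply: eq_Rintegral => w _; rewrite -mulrA indicE2.
  by have [_ ->] := IH (ltnW mn) (upd D) (mupd D mD) (fun i im' => updT i im' D).
have mcos : measurable_fun setT ((fun x => cos (c im * x)) : measurableTypeR R -> measurableTypeR R).
  exact: measurable_cosM.
have msin : measurable_fun setT ((fun x => sin (c im * x)) : measurableTypeR R -> measurableTypeR R).
  exact: measurable_sinM.
have [lc ls] := lawX im (c im).
have bcX : bounded_mfun (fun w => cos (c im * X im w)).
  by apply: bounded_mfun_cos; apply: measurable_funM => //; exact: mX.
have bsX : bounded_mfun (fun w => sin (c im * X im w)).
  by apply: bounded_mfun_sin; apply: measurable_funM => //; exact: mX.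
split.
  transitivity (E (fun w => cos (S0 w) * \1_(bx B) w * cos (c im * X im w) -
                           sin (S0 w) * \1_(bx B) w * sin (c im * X im w))).
    by apply: eq_Rintegral => w _; rewrite SE cosD; ring.
  rewrite bRintegralB; [|exact: bounded_mfunM|exact: bounded_mfunM].
  rewrite (f2 _ msin (fun x => sin_max _)) (f1 _ mcos (fun x => cos_max _)).
  by rewrite lc etaE opprD expRD subr0; ring.
transitivity (E (fun w => sin (S0 w) * \1_(bx B) w * cos (c im * X im w) +
                         cos (S0 w) * \1_(bx B) w * sin (c im * X im w))).
  by apply: eq_Rintegral => w _; rewrite SE sinD; ring.
rewrite bRintegralD; [|exact: bounded_mfunM|exact: bounded_mfunM].
rewrite (f2 _ mcos (fun x => cos_max _)) (f1 _ msin (fun x => sin_max _)).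
by rewrite ls mulr0 addr0.
Qed.

Lemma independent_sum_law (c : 'I_n -> R) :
  sym_law P (fun w => \sum_(i < n) c i * X i w)
    (fun m => \sum_(i < n) eta i (m * c i)).
Proof.
move=> m.
have [] := @independent_sum_box (fun i => m * c i) n (leqnn n) (fun=> setT)
  (fun=> measurableT) (fun _ _ => erefl).
have -> : bx (fun=> setT) = setT.
  by rewrite /bx; apply/seteqP; split => // w _ i _.
rewrite indicT (bRintegral_cst P) mulr1.
have SE w : \sum_(i < n | (i < n)%N) m * c i * X i w = m * \sum_(i < n) c i * X i w.
  rewrite mulr_sumr; apply: eq_big => [i|i _]; first by rewrite ltn_ord.
  by rewrite mulrA.
have -> : \sum_(i < n | (i < n)%N) eta i (m * c i) = \sum_(i < n) eta i (m * c i).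
  by apply: eq_bigl => i; rewrite ltn_ord.
move=> H1 H2; split; [apply: etrans H1|apply: etrans H2];
  by apply: eq_Rintegral => w _; rewrite SE /= mulr1.
Qed.

End independent_sum.

(** * Independently scattered random measures *)

Section pair_independence.
Context d (Omega : measurableType d) (R : realType) (P : probability Omega R).
Implicit Types (X Y : Omega -> R) (f g : R -> R).

Local Notation E f := (Rintegral P setT f).

(** [Rintegral_factor] used twice: first for g (Y) against f (X), then, with an indicator of Y as
    the fixed factor, for f (X). *)
Lemma independent_pair_product X Y f g :
  measurable_fun setT X -> measurable_fun setT Y ->
  (forall A B : set R, measurable A -> measurable B ->
     P (X @^-1` A `&` Y @^-1` B) = (P (X @^-1` A) * P (Y @^-1` B))%E) ->
  measurable_fun setT (f : measurableTypeR R -> measurableTypeR R) ->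
  measurable_fun setT (g : measurableTypeR R -> measurableTypeR R) ->
  (forall x, `|f x| <= 1) -> (forall x, `|g x| <= 1) ->
  E (fun w => f (X w) * g (Y w)) = E (fun w => f (X w)) * E (fun w => g (Y w)).
Proof.
move=> mX mY XY mf mg f1 g1.
have mXA (A : set R) : measurable A -> measurable (X @^-1` A).
  by move=> mA; have := mX measurableT _ mA; rewrite setTI.
have mYB (B : set R) : measurable B -> measurable (Y @^-1` B).
  by move=> mB; have := mY measurableT _ mB; rewrite setTI.
apply: Rintegral_factor => //.
  exact: (bounded_mfun_comp (c := 1)).
move=> B mB; rewrite mulrC.
transitivity (E (fun w => \1_(Y @^-1` B) w * f (X w))).
  by apply: eq_Rintegral => w _; rewrite mulrC.
apply: Rintegral_factor => //; first by apply: bounded_mfun_indic; exact: mYB.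
move=> A mA.
transitivity (E (\1_(X @^-1` A `&` Y @^-1` B))).
  by apply: eq_Rintegral => w _; rewrite !indicE in_setI -natrM mulnb andbC.
rewrite !Rintegral_indic_prob//; [|exact: mXA|exact: mYB|].
  rewrite XY// fineM ?fin_num_measure//; [by rewrite mulrC|exact: mXA|exact: mYB].
by apply: measurableI; [exact: mXA|exact: mYB].
Qed.

Lemma eq_law_Rintegral X Y f : measurable_fun setT X -> measurable_fun setT Y ->
  (forall B : set R, measurable B -> P (X @^-1` B) = P (Y @^-1` B)) ->
  measurable_fun setT (f : measurableTypeR R -> measurableTypeR R) ->
  (forall x, `|f x| <= 1) ->
  E (fun w => f (X w)) = E (fun w => f (Y w)).
Proof.
move=> mX mY XY mf f1.
have b1 : bounded_mfun ((fun=> 1) : Omega -> R) by exact: bounded_mfun_cst.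
pose YX B : set Omega := Y @^-1` B.
have mXA (A : set R) : measurable A -> measurable (X @^-1` A).
  by move=> mA; have := mX measurableT _ mA; rewrite setTI.
have mYB (B : set R) : measurable B -> measurable (Y @^-1` B).
  by move=> mB; have := mY measurableT _ mB; rewrite setTI.
(* Made nonnegative so that the change of variables for pushforward measures applies directly. *)
pose g (x : R) : \bar R := ((1 + f x) / 2)%:E.
have mg : measurable_fun setT (g : measurableTypeR R -> \bar R).
  by apply/measurable_EFinP; apply: measurable_funM => //; exact: measurable_funD.
have g0 x : (0 <= g x)%E.
  by have := f1 x; rewrite ler_norml lee_fin => /andP[? ?]; rewrite divr_ge0//; lra.
have push (W : Omega -> measurableTypeR R) : measurable_fun setT W ->
    (\int[P]_w g (W w) = \int[pushforward P W]_x g x)%E.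
  by move=> mW; rewrite (ge0_integral_pushforward mW).
have gXY : (\int[P]_w g (X w) = \int[P]_w g (Y w))%E.
  rewrite (push X)// (push Y)//.
  apply: eq_measure_integral => A mA _; exact: XY.
have bf (W : Omega -> R) : measurable_fun setT W -> bounded_mfun (fun w => f (W w)).
  by move=> mW; exact: (bounded_mfun_comp (c := 1)).
have h (W : Omega -> R) : measurable_fun setT W ->
    E (fun w => f (W w)) = 2 * fine (\int[P]_w g (W w)) - 1.
  move=> mW; rewrite -[fine _]/(E (fun w => (1 + f (W w)) / 2)).
  have -> : E (fun w => (1 + f (W w)) / 2) = (1 + E (fun w => f (W w))) / 2.
    have -> : (fun w => (1 + f (W w)) / 2) = (fun w => 2^-1 * (1 + f (W w))).
      by apply/funext => w; rewrite mulrC.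
    rewrite bRintegralZ; last by apply: bounded_mfunD => //; exact: bf.
    by rewrite bRintegralD//; [rewrite bRintegral_cst mulrC|exact: bf].
  lra.
by rewrite !h// gXY.
Qed.

Lemma cvg_Rintegral_ae (X_ : nat -> Omega -> R) X f :
  (forall n, measurable_fun setT (X_ n)) -> measurable_fun setT X ->
  {ae P, forall w, X_ n w @[n --> \oo] --> X w} ->
  continuous f -> (forall x, `|f x| <= 1) ->
  E (fun w => f (X_ n w)) @[n --> \oo] --> E (fun w => f (X w)).
Proof.
move=> mX_ mX X_X cf f1.
have mf : measurable_fun setT (f : measurableTypeR R -> measurableTypeR R).
  exact: continuous_measurable_fun.
have bX : bounded_mfun (fun w => f (X w)) by exact: (bounded_mfun_comp (c := 1)).
have bXn n : bounded_mfun (fun w => f (X_ n w)) by exact: (bounded_mfun_comp (c := 1)).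
have [//| | | | | ] := @dominated_convergence _ _ _ P setT measurableT
  (fun n w => (f (X_ n w))%:E) (fun w => (f (X w))%:E) (cst 1%:E).
- by move=> n; apply/measurable_EFinP; case: (bXn n).
- by apply/measurable_EFinP; case: bX.
- apply: filterS X_X => w Xw _; apply: cvg_EFin.
    exact: nearW.
  by apply: (cvg_comp _ _ Xw); exact: cf.
- exact: finite_measure_integrable_cst.
- by apply: aeW => w n _ /=; rewrite lee_fin.
move=> _ _; rewrite -(EFin_Rintegral_bounded P bX) => H.
exact: (fine_cvg H).
Qed.

End pair_independence.

Section random_measure.
Context d (Omega : measurableType d) (R : realType) (P : probability Omega R).
Variables (Z : R -> {RV P >-> R}) (L : set R -> Omega -> R).
Hypothesis levyZ : levy_process Z.
Hypothesis measL : levy_random_measure Z L.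
Implicit Types (A B : set R).

Local Notation E f := (Rintegral P setT f).

Lemma bounded_borel0 : bounded_borel (set0 : set R).
Proof. by split => //; exists 0 => x. Qed.

Lemma bounded_borelU A B : bounded_borel A -> bounded_borel B -> bounded_borel (A `|` B).
Proof.
move=> [mA [t At]] [mB [s Bs]]; split; first exact: measurableU.
exists (Num.max t s) => x [/At|/Bs] /=; rewrite !in_itv/= => /andP[-> h];
  by rewrite le_max h ?orbT.
Qed.

Lemma bounded_borelS A B : measurable A -> A `<=` B -> bounded_borel B -> bounded_borel A.
Proof. by move=> mA AB [_ [t Bt]]; split => //; exists t; exact: subset_trans Bt. Qed.

Lemma bounded_borel_itv (t : R) : bounded_borel `]0, t].
Proof. by split; [exact: measurable_itv|exists t]. Qed.

Lemma bounded_borelI A (t : R) : measurable A -> bounded_borel (A `&` `]0, t]).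
Proof.
move=> mA; apply: (bounded_borelS _ _ (bounded_borel_itv t)) => //.
by apply: measurableI => //; exact: measurable_itv.
Qed.

(** The interval ]0, 0] is empty, so the increment axiom gives the value at the empty set. *)
Lemma lrm0 : {ae P, forall w, L set0 w = 0}.
Proof.
have := lrm_increment measL (lexx 0) (lexx 0).
by apply: filterS => w; rewrite set_itvoc0 subrr.
Qed.

Lemma lrmU A B : bounded_borel A -> bounded_borel B -> A `&` B = set0 ->
  {ae P, forall w, L (A `|` B) w = L A w + L B w}.
Proof.
move=> bA bB AB.
(* Finite additivity comes from sigma-additivity on A, B, followed by empty sets, whose terms vanish
   almost surely. *)
have bF i : bounded_borel (bigcup2 A B i) by case: i => [|[|i]] //=; exact: bounded_borel0.
have := lrm_sigma_additive measL bF.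
rewrite bigcup2E -trivIset_bigcup2 => /(_ AB (bounded_borelU bA bB)) H.
apply: filterS2 H lrm0 => w H L0.
apply: (cvg_unique _ H) => //; apply: cvg_near_cst.
exists 2%N => // n /= n2; rewrite -(subnKC n2).
rewrite big_mkord !big_ord_recl/= big1 ?addr0// => i _.
Qed.

Lemma lrmD A B : bounded_borel A -> bounded_borel B -> B `<=` A ->
  {ae P, forall w, L A w = L B w + L (A `\` B) w}.
Proof.
move=> bA bB BA; have := @lrmU B (A `\` B) bB _ (setDIK _ _).
rewrite (setDUK BA); apply.
apply: (bounded_borelS _ _ bA); last exact: subDsetl.
by apply: measurableD; [case: bA|case: bB].
Qed.

Lemma lrm_bigsetU (I : eqType) (s : seq I) (A_ : I -> set R) : uniq s ->
  (forall i, bounded_borel (A_ i)) -> (forall i j, i != j -> A_ i `&` A_ j = set0) ->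
  {ae P, forall w, L (\big[setU/set0]_(i <- s) A_ i) w = \sum_(i <- s) L (A_ i) w}.
Proof.
move=> us bA tA; suff [] : bounded_borel (\big[setU/set0]_(i <- s) A_ i) /\
  {ae P, forall w, L (\big[setU/set0]_(i <- s) A_ i) w = \sum_(i <- s) L (A_ i) w} by [].
elim: s us => [_|i s IH /= /andP[ins us]].
  rewrite big_nil; split; first exact: bounded_borel0.
  by apply: filterS lrm0 => w ->; rewrite big_nil.
have [bs Hs] := IH us; rewrite big_cons; split; first exact: bounded_borelU.
have := @lrmU (A_ i) _ (bA i) bs.
have -> : A_ i `&` \big[setU/set0]_(j <- s) A_ j = set0.
  rewrite big_distrr/= big_seq big1// => j js.
  by apply: tA; apply: contraNneq ins => ->.
by move=> /(_ erefl) HU; apply: filterS2 HU Hs => w -> ->; rewrite big_cons.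
Qed.

(** Continuity from below: sigma-additivity on the disjoint successive differences, whose partial
    sums telescope. All n are treated on one event of full measure. *)
Lemma lrm_nondecreasing (F : nat -> set R) : (forall n, bounded_borel (F n)) ->
  bounded_borel (\bigcup_n F n) -> nondecreasing_seq F ->
  {ae P, forall w, L (F n) w @[n --> \oo] --> L (\bigcup_n F n) w}.
Proof.
move=> bF bUF ndF.
have bD i : bounded_borel (seqD F i).
  case: i => [|i] /=; first exact: bF.
  apply: (bounded_borelS _ _ (bF i.+1)); last exact: subDsetl.
  by apply: measurableD; [case: (bF i.+1)|case: (bF i)].
have := lrm_sigma_additive measL bD.
rewrite eq_bigcup_seqD => /(_ (trivIset_seqD ndF) bUF) H.
have Hn : {ae P, forall w n, \sum_(0 <= i < n.+1) L (seqD F i) w = L (F n) w}.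
  apply: ae_foralln; elim => [|n IH].
    by apply: aeW => w; rewrite big_nat1.
  have HD := lrmD (bF n.+1) (bF n) (subsetPset _ _ (ndF _ _ (leqnSn n))).
  by apply: filterS2 IH HD => w IH HD; rewrite big_nat_recr//= IH HD.
apply: filterS2 H Hn => w H Hn.
move: H; rewrite -cvg_shiftS /=.
by under eq_cvg do rewrite Hn.
Qed.

Lemma lrm_independent2 A B : bounded_borel A -> bounded_borel B -> A `&` B = set0 ->
  forall C D : set R, measurable C -> measurable D ->
  P (L A @^-1` C `&` L B @^-1` D) = (P (L A @^-1` C) * P (L B @^-1` D))%E.
Proof.
move=> bA bB AB C D mC mD.
pose S (i : 'I_2) := if i == ord0 then A else B.
pose T (i : 'I_2) := if i == ord0 then C else D.
have bS i : bounded_borel (S i) by rewrite /S; case: ifP.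
have tS : trivIset setT S.
  apply/trivIsetP => i j _ _; rewrite /S.
  by case: i => [[|[|i]]] //= hi; case: j => [[|[|j]]] //= hj _; rewrite // setIC.
have mT i : measurable (T i) by rewrite /T; case: ifP.
have := lrm_independent measL bS tS mT.
rewrite big_ord_recl big_ord1 /S /T/= => <-; congr (P _).
apply/seteqP; split => [w [wC wD] i _|w Hw].
  by case: ifP => // _.
by split; [exact: (Hw ord0 I)|exact: (Hw (lift ord0 ord0) I)].
Qed.

Lemma sym_law_ae (X Y : Omega -> R) eta : measurable_fun setT X -> measurable_fun setT Y ->
  {ae P, forall w, X w = Y w} -> sym_law P X eta -> sym_law P Y eta.
Proof.
move=> mX mY XY lX m; have [lc ls] := lX m.
have mmX : measurable_fun setT (fun w => m * X w) by exact: measurable_funM.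
have mmY : measurable_fun setT (fun w => m * Y w) by exact: measurable_funM.
split; [apply: etrans lc|apply: etrans ls]; apply: ae_eq_Rintegral.
- by have [] := bounded_mfun_cos mmY.
- by have [] := bounded_mfun_cos mmX.
- by apply: filterS XY => w ->.
- by have [] := bounded_mfun_sin mmY.
- by have [] := bounded_mfun_sin mmX.
- by apply: filterS XY => w ->.
Qed.

Variable psi : R -> R.
Hypothesis lawZ : forall t, 0 <= t -> sym_law P (Z t) (fun m => t * psi m).

Lemma lrm_law_itv (s t : R) : 0 <= s -> s <= t ->
  sym_law P (L `]s, t]) (fun m => (t - s) * psi m).
Proof.
move=> s0 st.
have ts0 : 0 <= t - s by rewrite subr_ge0.
have mI : measurable_fun setT (L `]s, t]).
  apply: (lrm_measurable measL); split; first exact: measurable_itv.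
  by exists t => x /=; rewrite !in_itv/= => /andP[sx ->]; rewrite (le_lt_trans s0).
have mZ : measurable_fun setT (fun w => Z t w - Z s w) by exact: measurable_funB.
apply: (@sym_law_ae (fun w => Z t w - Z s w)) => //.
  by have := lrm_increment measL s0 st; apply: filterS => w ->.
move=> m; have [lc ls] := lawZ ts0 m.
have stat (B : set R) : measurable B ->
    P ((fun w => Z t w - Z s w) @^-1` B) = P (Z (t - s) @^-1` B).
  by move=> mB; exact: (levy_stationary levyZ s0 st).
have mcos : measurable_fun setT ((fun x => cos (m * x)) : measurableTypeR R -> measurableTypeR R).
  exact: measurable_cosM.
have msin : measurable_fun setT ((fun x => sin (m * x)) : measurableTypeR R -> measurableTypeR R).
  exact: measurable_sinM.
split; [apply: etrans lc|apply: etrans ls].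
  exact: (eq_law_Rintegral mZ _ stat mcos (fun x => cos_max _)).
exact: (eq_law_Rintegral mZ _ stat msin (fun x => sin_max _)).
Qed.

(** The cosine transform of X is an exponential and never vanishes, so it can be divided out of that
    of X + Y. This gives stability of the law formula under proper differences of sets. *)
Lemma sym_law_div (X Y W : Omega -> R) eta zeta :
  measurable_fun setT X -> measurable_fun setT Y -> measurable_fun setT W ->
  {ae P, forall w, W w = X w + Y w} ->
  (forall A B : set R, measurable A -> measurable B ->
     P (X @^-1` A `&` Y @^-1` B) = (P (X @^-1` A) * P (Y @^-1` B))%E) ->
  sym_law P W zeta -> sym_law P X eta -> sym_law P Y (fun m => zeta m - eta m).
Proof.
move=> mX mY mW WXY XY lW lX.
have {WXY}lXY : sym_law P (fun w => X w + Y w) zeta.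
  by apply: (@sym_law_ae W) => //; exact: measurable_funD.
move=> m; have [cX sX] := lX m; have [cW sW] := lXY m.
have mcos : measurable_fun setT ((fun x => cos (m * x)) : measurableTypeR R -> measurableTypeR R).
  exact: measurable_cosM.
have msin : measurable_fun setT ((fun x => sin (m * x)) : measurableTypeR R -> measurableTypeR R).
  exact: measurable_sinM.
have c1 x : `|cos (m * x)| <= 1 by exact: cos_max.
have s1 x : `|sin (m * x)| <= 1 by exact: sin_max.
have cc := independent_pair_product mX mY XY mcos mcos c1 c1.
have cs := independent_pair_product mX mY XY mcos msin c1 s1.
have sc := independent_pair_product mX mY XY msin mcos s1 c1.
have ss := independent_pair_product mX mY XY msin msin s1 s1.
rewrite cX in cc cs; rewrite sX !mul0r in sc ss.
have bcX : bounded_mfun (fun w => cos (m * X w)) by exact: (bounded_mfun_comp mcos mX c1).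
have bcY : bounded_mfun (fun w => cos (m * Y w)) by exact: (bounded_mfun_comp mcos mY c1).
have bsX : bounded_mfun (fun w => sin (m * X w)) by exact: (bounded_mfun_comp msin mX s1).
have bsY : bounded_mfun (fun w => sin (m * Y w)) by exact: (bounded_mfun_comp msin mY s1).
have e0 : expR (- eta m) != 0 by rewrite gt_eqF ?expR_gt0.
split.
  move: cW; under eq_Rintegral do rewrite mulrDr cosD.
  rewrite bRintegralB; [|exact: bounded_mfunM|exact: bounded_mfunM].
  rewrite cc ss subr0 opprB expRD => H.
  by apply: (mulfI e0); rewrite H mulrA -expRD addNr expR0 mul1r.
move: sW; under eq_Rintegral do rewrite mulrDr sinD.
rewrite bRintegralD; [|exact: bounded_mfunM|exact: bounded_mfunM].
by rewrite cs sc add0r => /eqP; rewrite mulf_eq0 (negbTE e0) => /eqP.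
Qed.

Lemma lebesgue_measure_itvoc (s t : R) : s <= t ->
  fine (lebesgue_measure `]s, t]%classic) = t - s.
Proof.
move=> st; rewrite lebesgue_measure_itv/= lte_fin.
by case: ltgtP st => // ->; rewrite subrr.
Qed.

(** Only the law on intervals is known from the process. The sets satisfying the formula form a
    lambda-system: [sym_law_div] handles proper differences, [lrm_nondecreasing] with dominated
    convergence handles increasing unions. The half-open intervals are stable under intersection and
    generate the Borel sets. *)
Lemma lrm_law A : bounded_borel A ->
  sym_law P (L A) (fun m => fine (lebesgue_measure A) * psi m).
Proof.
move=> [mA [N AN]].
wlog N0 : N AN / 0 <= N.
  move=> H; apply: (H (Num.max N 0)); last by rewrite le_max lexx orbT.
  by move=> x /AN /=; rewrite !in_itv/= => /andP[-> xN]; rewrite le_max xN.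
pose I : set R := `]0, N]%classic.
(* Intersecting with a fixed bounded interval makes the class contain the whole line and keeps all
   measures finite. *)
pose G := [set A : set R | measurable A /\
  sym_law P (L (A `&` I)) (fun m => fine (lebesgue_measure (A `&` I)) * psi m)].
have bI B : measurable B -> bounded_borel (B `&` I) by move=> mB; exact: bounded_borelI.
have mL B : bounded_borel B -> measurable_fun setT (L B) by move=> bB; exact: (lrm_measurable measL bB).
have finI B : measurable B -> lebesgue_measure (B `&` I) \is a fin_num.
  move=> mB; rewrite ge0_fin_numE//.
  apply: (@le_lt_trans _ _ (lebesgue_measure I)).
    apply: le_measure; rewrite ?inE; [|exact: measurable_itv|exact: subIsetr].
    by apply: measurableI => //; exact: measurable_itv.
  by rewrite /I lebesgue_measure_itv/=; case: ifP => // _; rewrite -EFinD ltry.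
suff GA : G A.
  by have [_] := GA; rewrite setIidl.
have [] := @lambda_system_subset R (@ocitv R) (@ocitvI R) setT G _ _ _ A.
- split.
  + by [].
  + split; first exact: measurableT.
    rewrite setTI /I lebesgue_measure_itvoc//.
    exact: lrm_law_itv.
  + move=> B C CB [mB lB] [mC lC]; split; first exact: measurableD.
    have mBI : measurable (B `&` I) by case: (bI _ mB).
    have mCI : measurable (C `&` I) by case: (bI _ mC).
    have CBI : C `&` I `<=` B `&` I by apply: setSI.
    have DE : (B `\` C) `&` I = (B `&` I) `\` (C `&` I).
      apply/seteqP; split => [x [[Bx Cx] Ix]|x [[Bx Ix] Cx]].
        by split => // -[].
      by split => //; split => // Cx'; exact: Cx.
    have lebE : fine (lebesgue_measure ((B `\` C) `&` I)) =
        fine (lebesgue_measure (B `&` I)) - fine (lebesgue_measure (C `&` I)).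
      rewrite DE measureD//; last by rewrite -ge0_fin_numE//; exact: finI.
      rewrite (setIidr CBI) fineB//; exact: finI.
    rewrite lebE; under eq_fun do rewrite mulrBl.
    apply: (sym_law_div _ _ _ _ _ lB lC).
    * exact/mL/bI.
    * by apply/mL/bI; exact: measurableD.
    * exact/mL/bI.
    * by rewrite DE; apply: lrmD => //; exact: bI.
    * apply: lrm_independent2; [exact: bI|exact/bI/measurableD|].
      by rewrite DE setDIK.
  + move=> F ndF GF.
    have mF n : measurable (F n) by case: (GF n).
    split; first exact: bigcupT_measurable.
    have UE : (\bigcup_n F n) `&` I = \bigcup_n (F n `&` I) by rewrite setI_bigcupl.
    have ndFI : nondecreasing_seq (fun n => F n `&` I).
      by move=> n m nm; apply/subsetPset; apply: setSI; exact/subsetPset/ndF.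
    have bFI n : bounded_borel (F n `&` I) by exact: bI.
    have bUI : bounded_borel (\bigcup_n (F n `&` I)).
      by rewrite -UE; apply: bI; exact: bigcupT_measurable.
    have H := lrm_nondecreasing bFI bUI ndFI.
    rewrite UE => m.
    have cl : fine (lebesgue_measure (F n `&` I)) @[n --> \oo] -->
              fine (lebesgue_measure (\bigcup_n (F n `&` I))).
      apply: fine_cvg; rewrite fineK; last by rewrite -UE; apply: finI; exact: bigcupT_measurable.
      apply: nondecreasing_cvg_mu => //; last by case: bUI.
      by move=> n; case: (bFI n).
    have cos_cont : continuous (fun x : R => cos (m * x)).
      by move=> x; apply: continuous_comp; [exact: mulrl_continuous|exact: continuous_cos].
    have sin_cont : continuous (fun x : R => sin (m * x)).
      by move=> x; apply: continuous_comp; [exact: mulrl_continuous|exact: continuous_sin].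
    have mLn n := mL _ (bFI n).
    have cc := cvg_Rintegral_ae mLn (mL _ bUI) H cos_cont (fun x => cos_max _).
    have cs := cvg_Rintegral_ae mLn (mL _ bUI) H sin_cont (fun x => sin_max _).
    have ce n : E (fun w => cos (m * L (F n `&` I) w)) =
        expR (- (fine (lebesgue_measure (F n `&` I)) * psi m)) by exact: ((GF n).2 m).1.
    have se n : E (fun w => sin (m * L (F n `&` I) w)) = 0 by exact: ((GF n).2 m).2.
    rewrite (funext ce) in cc; rewrite (funext se) in cs.
    split; last by apply: (cvg_unique _ cs); first exact: Rhausdorff; exact: cvg_cst.
    apply: (cvg_unique _ cc); first exact: Rhausdorff.
    apply: (@continuous_cvg _ _ _ _ _ _ expR); first exact: continuous_expR.
    by apply: cvgN; exact: cvgMl.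
- move=> _ [[s t] _ <-]; split; first exact: measurable_itv.
  (* The outer maximum turns an empty intersection into a degenerate interval, so the endpoints are
     always ordered. *)
  have -> : `]s, t] `&` I = `](Num.max s 0), (Num.max (Num.max s 0) (Num.min t N))]%classic.
    apply/seteqP; split => x; rewrite /I /= !in_itv/= gt_max le_max le_min.
      by move=> [/andP[-> ->] /andP[-> ->]]; rewrite orbT.
    move=> /andP[/andP[sx x0]] /orP[|/andP[xt xN]]; last by rewrite sx x0 xt xN.
    by rewrite le_max leNgt sx/= leNgt x0.
  have le_maxl (u v : R) : u <= Num.max u v by rewrite le_max lexx.
  rewrite lebesgue_measure_itvoc//; apply: lrm_law_itv => //.
  by rewrite le_max lexx orbT.
- by [].
- exact: mA.
- by [].
Qed.

End random_measure.

(** The same lambda-system argument for almost sure equality. It is needed because the integrals at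
    two different times each come with a random measure of their own. *)
Lemma lrm_unique d (Omega : measurableType d) (R : realType) (P : probability Omega R)
    (Z : R -> {RV P >-> R}) (L L' : set R -> Omega -> R) (A : set R) :
  levy_random_measure Z L -> levy_random_measure Z L' -> bounded_borel A ->
  {ae P, forall w, L A w = L' A w}.
Proof.
move=> mL mL' [mA [N AN]].
wlog N0 : N AN / 0 <= N.
  move=> H; apply: (H (Num.max N 0)); last by rewrite le_max lexx orbT.
  by move=> x /AN /=; rewrite !in_itv/= => /andP[-> xN]; rewrite le_max xN.
pose I : set R := `]0, N]%classic.
pose G := [set A : set R | measurable A /\
  {ae P, forall w, L (A `&` I) w = L' (A `&` I) w}].
have bI B : measurable B -> bounded_borel (B `&` I) by move=> mB; exact: bounded_borelI.
have incr (s t : R) : 0 <= s -> s <= t ->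
    {ae P, forall w, L `]s, t]%classic w = L' `]s, t]%classic w}.
  move=> s0 st; have := lrm_increment mL' s0 st; have := lrm_increment mL s0 st.
  by apply: filterS2 => w -> ->.
suff GA : G A.
  by have [_] := GA; rewrite setIidl.
have [] := @lambda_system_subset R (@ocitv R) (@ocitvI R) setT G _ _ _ A.
- split.
  + by [].
  + split; first exact: measurableT.
    by rewrite setTI /I; exact: incr.
  + move=> B C CB [mB lB] [mC lC]; split; first exact: measurableD.
    have CBI : C `&` I `<=` B `&` I by apply: setSI.
    have -> : (B `\` C) `&` I = (B `&` I) `\` (C `&` I).
      apply/seteqP; split => [x [[Bx Cx] Ix]|x [[Bx Ix] Cx]].
        by split => // -[].
      by split => //; split => // Cx'; exact: Cx.
    have D1 := lrmD mL (bI _ mB) (bI _ mC) CBI.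
    have D2 := lrmD mL' (bI _ mB) (bI _ mC) CBI.
    apply: filterS2 (filterI D1 D2) (filterI lB lC) => w [e1 e2] [e3 e4].
    by apply: (addrI (L (C `&` I) w)); rewrite -e1 e4 -e2.
  + move=> F ndF GF.
    have mF n : measurable (F n) by case: (GF n).
    split; first exact: bigcupT_measurable.
    have UE : (\bigcup_n F n) `&` I = \bigcup_n (F n `&` I) by rewrite setI_bigcupl.
    have ndFI : nondecreasing_seq (fun n => F n `&` I).
      by move=> n m nm; apply/subsetPset; apply: setSI; exact/subsetPset/ndF.
    have bFI n : bounded_borel (F n `&` I) by exact: bI.
    have bUI : bounded_borel (\bigcup_n (F n `&` I)).
      by rewrite -UE; apply: bI; exact: bigcupT_measurable.
    have H := lrm_nondecreasing mL bFI bUI ndFI.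
    have H' := lrm_nondecreasing mL' bFI bUI ndFI.
    have Hn : {ae P, forall w n, L (F n `&` I) w = L' (F n `&` I) w}.
      by apply: ae_foralln => n; case: (GF n).
    rewrite UE; apply: filterS2 (filterI H H') Hn => w [h h'] hn.
    rewrite (funext hn) in h.
    by apply: (cvg_unique _ h h'); exact: Rhausdorff.
- move=> _ [[s t] _ <-]; split; first exact: measurable_itv.
  have -> : `]s, t] `&` I = `](Num.max s 0), (Num.max (Num.max s 0) (Num.min t N))]%classic.
    apply/seteqP; split => x; rewrite /I /= !in_itv/= gt_max le_max le_min.
      by move=> [/andP[-> ->] /andP[-> ->]]; rewrite orbT.
    move=> /andP[/andP[sx x0]] /orP[|/andP[xt xN]]; last by rewrite sx x0 xt xN.
    by rewrite le_max leNgt sx/= leNgt x0.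
  have le_maxl (u v : R) : u <= Num.max u v by rewrite le_max lexx.
  by apply: incr => //; rewrite le_max lexx orbT.
- by [].
- exact: mA.
- by [].
Qed.

Lemma ae_seq d (T : measurableType d) (R : realType) (mu : {measure set T -> \bar R})
    (I : eqType) (s : seq I) (Q : I -> T -> Prop) :
  (forall i, {ae mu, forall x, Q i x}) ->
  {ae mu, forall x, forall i, i \in s -> Q i x}.
Proof.
move=> HQ; elim: s => [|i s IH]; first exact: aeW.
apply: filterS2 (HQ i) IH => x Qi Qs j; rewrite inE => /predU1P[->//|].
exact: Qs.
Qed.

(** * Elementary integrals of simple functions *)

Section simple_integral_theory.
Context d (Omega : measurableType d) (R : realType) (P : probability Omega R).
Variables (Z : R -> {RV P >-> R}) (L : set R -> Omega -> R).
Hypothesis measL : levy_random_measure Z L.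
Implicit Types (A B : set R) (f : {sfun measurableTypeR R >-> R}).

Let values f : seq R := fset_set (range f).

Let mem_values f u : f u \in values f.
Proof. by rewrite in_fset_set; [rewrite inE; exists u|exact: fimfunP]. Qed.

Lemma measurable_fiber f (x : R) : measurable (f @^-1` [set x] : set R).
Proof.
have mf : measurable_fun setT f by [].
by have := mf measurableT [set x] (measurable_set1 x); rewrite setTI.
Qed.

Lemma simple_integralE f A w :
  simple_integral L f A w = \sum_(x <- fset_set (range f)) x * L (A `&` f @^-1` [set x]) w.
Proof. by rewrite /simple_integral fsbig_finite//; exact: fimfunP. Qed.

(** The elementary integral may be computed on any finite measurable partition, given by a labelling
    [kap], on whose cells f is constant. Both partitions are cut into their common refinement.
    Labels allow several simple functions to be put on one partition. *)
Lemma simple_integral_label (I : choiceType) (r : seq I) (kap : R -> I) (c : I -> R) f A :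
  uniq r -> (forall i, measurable (kap @^-1` [set i])) ->
  bounded_borel A -> (forall u, A u -> kap u \in r) ->
  (forall u, A u -> f u = c (kap u)) ->
  {ae P, forall w, simple_integral L f A w =
     \sum_(i <- r) c i * L (A `&` kap @^-1` [set i]) w}.
Proof.
move=> ur mkap bA kr fc.
have us : uniq (values f) by exact: fset_uniq.
pose D x i := A `&` f @^-1` [set x] `&` kap @^-1` [set i].
have mf x : measurable (f @^-1` [set x]).
  exact: measurable_fiber.
have bD x i : bounded_borel (D x i).
  apply: (bounded_borelS _ _ bA); last by move=> u [[]].
  apply: measurableI; last exact: mkap.
  by apply: measurableI; [case: bA|exact: mf].
have U1 x : {ae P, forall w, L (A `&` f @^-1` [set x]) w = \sum_(i <- r) L (D x i) w}.
  have := lrm_bigsetU measL ur (bD x).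
  have -> : \big[setU/set0]_(i <- r) D x i = A `&` f @^-1` [set x].
    rewrite -bigcup_seq; apply/seteqP; split => [u [i _ []]//|u [Au fu]].
    by exists (kap u) => //=; exact: kr.
  apply=> i j ij; rewrite -subset0 => u [[_ /= ki] [_ /= kj]].
  by move: ij; rewrite -ki -kj eqxx.
have U2 i : {ae P, forall w, L (A `&` kap @^-1` [set i]) w = \sum_(x <- values f) L (D x i) w}.
  have := lrm_bigsetU measL us (bD^~ i).
  have -> : \big[setU/set0]_(x <- values f) D x i = A `&` kap @^-1` [set i].
    rewrite -bigcup_seq; apply/seteqP; split => [u [x _ [[]]]//|u [Au ku]].
    by exists (f u) => //=; exact: mem_values.
  apply=> x y xy; rewrite -subset0 => u [[[_ /= fx] _] [[_ /= fy] _]].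
  by move: xy; rewrite -fx -fy eqxx.
apply: filterS3 (ae_seq (values f) U1) (ae_seq r U2) (lrm0 measL) => w H1 H2 L0.
rewrite simple_integralE -/(values f).
transitivity (\sum_(x <- values f) \sum_(i <- r) x * L (D x i) w).
  by apply: eq_big_seq => x xs; rewrite H1// mulr_sumr.
rewrite exchange_big/=; apply: eq_big_seq => i ir.
rewrite H2// mulr_sumr; apply: eq_bigr => x _.
(* On an empty cell x and c i may differ, but L is zero there; on a nonempty one any point shows x =
   c i. *)
have [->|/set0P[u [[Au /= fu] /= ku]]] := eqVneq (D x i) set0; first by rewrite L0 !mulr0.
by rewrite -fu fc// ku.
Qed.

Lemma simple_integralB f1 f2 f3 A : bounded_borel A ->
  (forall u, A u -> f3 u = f1 u - f2 u) ->
  {ae P, forall w, simple_integral L f3 A w =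
     simple_integral L f1 A w - simple_integral L f2 A w}.
Proof.
move=> bA f3E.
pose r := [seq (x, y) | x <- values f1, y <- values f2].
(* The pair of values labels a partition on which all three functions are constant. *)
pose kap (u : R) := (f1 u, f2 u).
have ur : uniq r.
  by apply: allpairs_uniq => //; [exact: fset_uniq|exact: fset_uniq|move=> [? ?] [? ?]].
have kr u : A u -> kap u \in r by move=> _; apply: allpairs_f; exact: mem_values.
have mkap i : measurable (kap @^-1` [set i]).
  have -> : kap @^-1` [set i] = f1 @^-1` [set i.1] `&` f2 @^-1` [set i.2].
    apply/seteqP; split => u; rewrite /kap /=; first by move=> <-.
    by case: i => /= x y [-> ->].
  by apply: measurableI; exact: measurable_fiber.
have H1 := @simple_integral_label _ r kap fst f1 A ur mkap bA kr (fun _ _ => erefl).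
have H2 := @simple_integral_label _ r kap snd f2 A ur mkap bA kr (fun _ _ => erefl).
have H3 := @simple_integral_label _ r kap (fun i => i.1 - i.2) f3 A ur mkap bA kr f3E.
apply: filterS3 H1 H2 H3 => w -> -> ->; rewrite -sumrB.
by apply: eq_bigr => i _; rewrite mulrBl.
Qed.

(** Cutting off the integrand outside B amounts to shrinking the domain; integrals over ]0, s] and
    ]0, t] are thereby brought to the common domain ]0, T]. Points are labelled by the value of [f1]
    and membership in B. *)
Lemma simple_integral_setI f1 f2 A B : bounded_borel A -> measurable B ->
  (forall u, A u -> B u -> f2 u = f1 u) -> (forall u, A u -> ~ B u -> f2 u = 0) ->
  {ae P, forall w, simple_integral L f2 A w = simple_integral L f1 (A `&` B) w}.
Proof.
move=> bA mB f2E f20.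
pose r := [seq (x, b) | x <- values f1, b <- [:: true; false]].
pose kap (u : R) := (f1 u, u \in B).
have ur : uniq r.
  by apply: allpairs_uniq => //; [exact: fset_uniq|move=> [? ?] [? ?]].
have kr u : kap u \in r.
  by apply: allpairs_f; [exact: mem_values|case: (u \in B)].
have mkap i : measurable (kap @^-1` [set i]).
  have -> : kap @^-1` [set i] = f1 @^-1` [set i.1] `&` (if i.2 then B else ~` B).
    apply/seteqP; split => u; rewrite /kap /=.
      move=> <- /=; split => //; case: (boolP (u \in B)) => [/set_mem//|nB] /= Bu.
      by move: nB; rewrite mem_set.
    case: i => /= x [] [-> H]; [by rewrite mem_set|by rewrite memNset].
  apply: measurableI; first by exact: measurable_fiber.
  by case: i.2 => //; exact: measurableC.
have bAB : bounded_borel (A `&` B).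
  by apply: (bounded_borelS _ _ bA); [apply: measurableI => //; case: bA|exact: subIsetl].
pose c2 (i : R * bool) : R := if i.2 then i.1 else 0.
have f2c u : A u -> f2 u = c2 (kap u).
  move=> Au; rewrite /c2 /kap/=; case: ifP => [/set_mem Bu|nB]; first exact: f2E.
  by apply: f20 => // Bu; move: nB; rewrite mem_set.
have H1 := @simple_integral_label _ r kap fst f1 _ ur mkap bAB (fun u _ => kr u) (fun _ _ => erefl).
have H2 := @simple_integral_label _ r kap c2 f2 A ur mkap bA (fun u _ => kr u) f2c.
apply: filterS3 H1 H2 (lrm0 measL) => w -> -> L0.
apply: eq_bigr => -[x b] _ /=; case: b; rewrite /c2/=.
  congr (_ * L _ w); apply/seteqP; split => [u [Au ku]|u [[]]//].
  split => //; split => //; move: ku; rewrite /kap/= => -[_ Bu].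
  exact: set_mem.
rewrite mul0r (_ : _ `&` _ = set0) ?L0 ?mulr0//.
rewrite -subset0 => u [[_ Bu]]; rewrite /kap/= => -[_].
by rewrite mem_set.
Qed.

Lemma simple_integral_measurable f A : bounded_borel A ->
  measurable_fun setT (simple_integral L f A).
Proof.
move=> bA; rewrite (funext (simple_integralE f A)).
apply: measurable_sum => x; apply: measurable_funM => //.
apply: (lrm_measurable measL); apply: (bounded_borelS _ _ bA); last exact: subIsetl.
by apply: measurableI; [case: bA|exact: measurable_fiber].
Qed.

Hypothesis levyZ : levy_process Z.
Variable psi : R -> R.
Hypothesis psi_ge0 : forall x, 0 <= psi x.
Hypothesis lawZ : forall t, 0 <= t -> sym_law P (Z t) (fun m => t * psi m).

Lemma bounded_borel_fin_num A : bounded_borel A -> lebesgue_measure A \is a fin_num.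
Proof.
move=> [mA [t At]]; rewrite ge0_fin_numE//.
apply: (@le_lt_trans _ _ (lebesgue_measure `]0, t]%classic)).
  by apply: le_measure; rewrite ?inE//; exact: measurable_itv.
by rewrite lebesgue_measure_itv/=; case: ifP => // _; rewrite -EFinD ltry.
Qed.

Lemma integral_simple f A (h : R -> R) : bounded_borel A -> (forall x, 0 <= h x) ->
  (\int[lebesgue_measure]_(u in A) (h (f u))%:E)%E =
  (\sum_(x <- fset_set (range f)) h x * fine (lebesgue_measure (A `&` f @^-1` [set x])))%:E.
Proof.
move=> bA h0; have mA : measurable A by case: bA.
have mf x : measurable (f @^-1` [set x]).
  exact: measurable_fiber.
transitivity (\int[lebesgue_measure]_(u in A)
    (\sum_(x <- values f) (h x)%:E * (\1_(f @^-1` [set x]) u)%:E)%E)%E.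
  apply: eq_integral => u _.
  rewrite (bigD1_seq (f u))//=; last exact: fset_uniq.
  rewrite indicE mem_set// mule1 big1 ?adde0// => x xfu.
  by rewrite indicE memNset ?mule0// => /esym/eqP; rewrite (negbTE xfu).
rewrite ge0_integral_sum//; last 2 first.
- move=> x; apply: measurable_funeM; apply/measurable_EFinP.
  exact: measurable_funTS.
- by move=> x u _; rewrite mule_ge0 ?lee_fin.
rewrite -sumEFin; apply: eq_bigr => x _.
rewrite ge0_integralZl//; last 2 first.
- apply/measurable_EFinP; exact: measurable_funTS.
- by rewrite lee_fin.
rewrite integral_indic// EFinM fineK ?(setIC A)//.
rewrite setIC; apply: bounded_borel_fin_num; apply: (bounded_borelS _ _ bA).
  by apply: measurableI => //; exact: mf.
exact: subIsetl.
Qed.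

(** The fibres of f are disjoint, so their random measures are independent and the exponents add up,
    which is the energy integral of the simple function. *)
Lemma simple_integral_law f A : bounded_borel A ->
  sym_law P (simple_integral L f A)
    (fun m => fine (\int[lebesgue_measure]_(u in A) (psi (m * f u))%:E)).
Proof.
move=> bA; pose s := values f.
pose D (i : 'I_(size s)) := A `&` f @^-1` [set s`_i].
have us : uniq s by exact: fset_uniq.
have bD i : bounded_borel (D i).
  apply: (bounded_borelS _ _ bA); last exact: subIsetl.
  by apply: measurableI; [case: bA|exact: measurable_fiber].
have tD : trivIset setT D.
  apply/trivIsetP => i j _ _ ij; rewrite -subset0 => u [[_ /= fi] [_ /= fj]].
  have /eqP : s`_i = s`_j by rewrite -fi -fj.
  rewrite (nth_uniq 0 (ltn_ord i) (ltn_ord j) us) => /eqP/val_inj e.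
  by move: ij; rewrite e eqxx.
have mLD i : measurable_fun setT (L (D i)) by exact: (lrm_measurable measL (bD i)).
have := independent_sum_law mLD (lrm_independent measL bD tD)
  (fun i => lrm_law levyZ measL lawZ (bD i)) (fun i => s`_i).
have -> : (fun w => \sum_(i < size s) s`_i * L (D i) w) = simple_integral L f A.
  apply/funext => w; rewrite simple_integralE -/(values f) -/s.
  by rewrite (big_nth 0) big_mkord.
congr (sym_law P _ _); apply/funext => m.
rewrite (@integral_simple f A (fun x => psi (m * x)) bA (fun x => psi_ge0 (m * x)))/= -/(values f) -/s.
rewrite (big_nth 0) big_mkord; apply: eq_bigr => i _.
by rewrite mulrC.
Qed.

End simple_integral_theory.

(** * Moments of stochastic integrals *)

Section sin_moment_step.
Context d (Omega : measurableType d) (R : realType) (P : probability Omega R).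
Implicit Types (X S xi : Omega -> R).

Local Notation E f := (Rintegral P setT f).

Lemma bounded_mfun_sin_pow X (m : R) k : measurable_fun setT X ->
  bounded_mfun (fun w => sin (m * X w) ^+ k).
Proof.
move=> mX; apply: bounded_mfun_exp; apply: bounded_mfun_sin.
exact: measurable_funM.
Qed.

Lemma bounded_mfun_cosM X (m : R) : measurable_fun setT X ->
  bounded_mfun (fun w => cos (m * X w)).
Proof. by move=> mX; apply: bounded_mfun_cos; exact: measurable_funM. Qed.

Lemma Rintegral_sin_pow_trig X (m : R) k (s : seq (R * R)) : measurable_fun setT X ->
  (forall x, sin x ^+ (2 * k) = \sum_(c <- s) c.1 * cos (c.2 * x)) ->
  E (fun w => sin (m * X w) ^+ (2 * k)) =
  \sum_(c <- s) c.1 * E (fun w => cos (c.2 * m * X w)).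
Proof.
move=> mX sE.
transitivity (E (fun w => \sum_(c <- s) c.1 * cos (c.2 * m * X w))).
  by apply: eq_Rintegral => w _; rewrite sE; apply: eq_bigr => c _; rewrite mulrA.
rewrite bRintegral_sum; last by move=> c; apply: bounded_mfunZ; exact: bounded_mfun_cosM.
by apply: eq_bigr => c _; rewrite bRintegralZ//; exact: bounded_mfun_cosM.
Qed.

(* Only the characteristic functions have to multiply: the symmetrised
   expectation below is a linear combination of products of cosine transforms. *)
Lemma sin_moment_step k (C : R) X S xi (m : R) : 0 <= C ->
  sin_pow_bound k C ->
  measurable_fun setT X -> measurable_fun setT S -> measurable_fun setT xi ->
  (forall v, E (fun w => cos (v * X w)) = E (fun w => cos (v * S w)) * E (fun w => cos (v * xi w))) ->
  E (fun w => sin (m * X w) ^+ (2 * k.+1)) <=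
  E (fun w => sin (m * S w) ^+ (2 * k.+1)) +
  C * (E (fun w => sin (m * S w) ^+ (2 * k)) * E (fun w => sin (m * xi w) ^+ 2) +
       E (fun w => sin (m * xi w) ^+ (2 * k.+1))).
Proof.
move=> C0 HC mX mS mxi prod.
have [s [sE _ _]] := @sin_pow_trig R k.+1.
pose b1 := E (fun w => sin (m * xi w) ^+ 2).
pose b2 := E (fun w => sin (m * xi w) ^+ (2 * k.+1)).
(* G x is the mean over xi of the sine power averaged at x + xi and x - xi, the sine cross terms
   having cancelled. By [prod], the mean of G at S is exactly the sine moment of X. *)
pose G x := \sum_(c <- s) c.1 * E (fun w => cos (c.2 * m * xi w)) * cos (c.2 * m * x).
have bs2 : bounded_mfun (fun w => sin (m * xi w) ^+ 2) by exact: bounded_mfun_sin_pow.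
have bsK : bounded_mfun (fun w => sin (m * xi w) ^+ (2 * k.+1)) by exact: bounded_mfun_sin_pow.
have GE x : G x <= sin (m * x) ^+ (2 * k.+1) + C * (sin (m * x) ^+ (2 * k) * b1 + b2).
  have -> : G x = E (fun w => (sin (m * x + m * xi w) ^+ (2 * k.+1) +
                             sin (m * x - m * xi w) ^+ (2 * k.+1)) / 2).
    transitivity (E (fun w => \sum_(c <- s) (c.1 * cos (c.2 * m * x)) * cos (c.2 * m * xi w))).
      rewrite bRintegral_sum; last by move=> c; apply: bounded_mfunZ; exact: bounded_mfun_cosM.
      apply: eq_bigr => c _; rewrite bRintegralZ; last exact: bounded_mfun_cosM.
      by rewrite mulrAC.
    apply: eq_Rintegral => w _; rewrite !sE -big_split/= mulr_suml; apply: eq_bigr => c _.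
    by rewrite mulrDr mulrBr cosD cosB !mulrA; field.
  have mmxi : measurable_fun setT (fun w => m * xi w) by exact: measurable_funM.
  have bsq : bounded_mfun (fun w => sin (m * x) ^+ (2 * k) * sin (m * xi w) ^+ 2).
    exact: bounded_mfunZ.
  have bq0 : bounded_mfun (fun w => C * (sin (m * x) ^+ (2 * k) * sin (m * xi w) ^+ 2 +
      sin (m * xi w) ^+ (2 * k.+1))).
    by apply: bounded_mfunZ; exact: bounded_mfunD.
  have bc : bounded_mfun ((fun=> sin (m * x) ^+ (2 * k.+1)) : Omega -> R).
    exact: bounded_mfun_cst.
  have bl : bounded_mfun (fun w => (sin (m * x + m * xi w) ^+ (2 * k.+1) +
                             sin (m * x - m * xi w) ^+ (2 * k.+1)) / 2).
    apply: bounded_mfunM; last exact: bounded_mfun_cst.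
    by apply: bounded_mfunD; apply: bounded_mfun_exp; apply: bounded_mfun_sin;
      [exact: measurable_funD|exact: measurable_funB].
  apply: (le_trans (le_bRintegral P bl (bounded_mfunD bc bq0) (fun w => HC _ _))).
  rewrite bRintegralD// bRintegral_cst bRintegralZ; last exact: bounded_mfunD.
  by rewrite bRintegralD// bRintegralZ.
have EG : E (fun w => G (S w)) = E (fun w => sin (m * X w) ^+ (2 * k.+1)).
  rewrite (Rintegral_sin_pow_trig m mX sE) bRintegral_sum; last first.
    by move=> c; apply: bounded_mfunZ; exact: bounded_mfun_cosM.
  apply: eq_bigr => c _; rewrite bRintegralZ; last exact: bounded_mfun_cosM.
  by rewrite prod; ring.
rewrite -EG.
have bG : bounded_mfun (fun w => G (S w)).
  by apply: bounded_mfun_sum => c; apply: bounded_mfunZ; exact: bounded_mfun_cosM.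
have b3 : bounded_mfun (fun w => sin (m * S w) ^+ (2 * k) * b1 + b2).
  apply: bounded_mfunD; last exact: bounded_mfun_cst.
  by apply: bounded_mfunM; [exact: bounded_mfun_sin_pow|exact: bounded_mfun_cst].
have b4 : bounded_mfun (fun w => C * (sin (m * S w) ^+ (2 * k) * b1 + b2)).
  exact: bounded_mfunZ.
have b5 := bounded_mfun_sin_pow m (2 * k.+1) mS.
apply: (le_trans (le_bRintegral P bG (bounded_mfunD b5 b4) (fun w => GE (S w)))).
rewrite bRintegralD// lerD2l bRintegralZ// ler_wpM2l//.
rewrite bRintegralD; [|by apply: bounded_mfunM; [exact: bounded_mfun_sin_pow|exact: bounded_mfun_cst]|exact: bounded_mfun_cst].
rewrite bRintegral_cst lerD2r.
rewrite (_ : (fun w => _) = (fun w => b1 * sin (m * S w) ^+ (2 * k))); last first.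
  by apply/funext => w; rewrite mulrC.
rewrite bRintegralZ; last exact: bounded_mfun_sin_pow.
by rewrite -/b1 mulrC lexx.
Qed.

(** Each factor 1 + C a_j is at most exp (C a_j), and these exponentials are at least 1, so every
    b_j is amplified by at most the total exponential. *)
Lemma gronwall_sum (u a b : nat -> R) (C : R) n : 0 <= C -> u 0%N <= 0 ->
  (forall j, 0 <= a j) -> (forall j, 0 <= b j) ->
  (forall j, (j < n)%N -> u j.+1 <= (1 + C * a j) * u j + C * b j) ->
  u n <= expR (C * \sum_(0 <= j < n) a j) * (C * \sum_(0 <= j < n) b j).
Proof.
move=> C0 u0 a0 b0; elim: n => [|n IH] Hn.
  by rewrite !big_nil !mulr0.
have {}IH := IH (fun j jn => Hn j (ltnW jn)).
apply: (le_trans (Hn n (ltnSn n))); rewrite !big_nat_recr//= !mulrDr expRD.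
set A := expR (C * \sum_(_ <= _ < _) a _) in IH *.
set B := C * \sum_(_ <= _ < _) b _ in IH *.
have A1 : 1 <= A by rewrite -expR0 ler_expR mulr_ge0// sumr_ge0.
have B0 : 0 <= B by rewrite mulr_ge0// sumr_ge0.
have Ca : 0 <= C * a n by rewrite mulr_ge0.
have e1 : 1 + C * a n <= expR (C * a n) by exact: expR_ge1Dx.
have e2 : 1 <= expR (C * a n) by apply: le_trans e1; rewrite lerDl.
apply: lerD.
  apply: (@le_trans _ _ ((1 + C * a n) * (A * B))).
    by rewrite ler_wpM2l// addr_ge0.
  rewrite mulrA ler_pM// ?mulr_ge0 ?addr_ge0//; last by rewrite mulrC ler_wpM2l// (le_trans _ A1).
  by rewrite (le_trans _ A1).
rewrite -[leLHS]mul1r ler_pM ?mulr_ge0//.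
by rewrite -[leLHS]mulr1 ler_pM// (le_trans _ A1).
Qed.

End sin_moment_step.

(** * Sine moments of elementary integrals *)

Section simple_sin_moment.
Context d (Omega : measurableType d) (R : realType) (P : probability Omega R).
Variables (Z : R -> {RV P >-> R}) (L : set R -> Omega -> R).
Hypothesis measL : levy_random_measure Z L.
Hypothesis levyZ : levy_process Z.
Variables (a : R) (nu : {measure set (measurableTypeR R) -> \bar R}).
Hypothesis a0 : 0 <= a.
Hypothesis nu2 : (\int[nu]_x (x ^+ 2)%:E < +oo)%E.
Hypothesis lawZ : forall t, 0 <= t -> sym_law P (Z t) (fun m => t * symbol a nu m).
Variable f : {sfun measurableTypeR R >-> R}.
Implicit Types (A B : set R) (h : R -> R).

Local Notation E f := (Rintegral P setT f).

(** The integral of h (f u) over B as a finite real sum, defined for h of any sign and additive in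
    B, so the cell computations stay in the real numbers. *)
Definition sfun_int B h : R :=
  \sum_(x <- fset_set (range f)) h x * fine (lebesgue_measure (B `&` f @^-1` [set x])).

Let bI B x : bounded_borel B -> bounded_borel (B `&` f @^-1` [set x]).
Proof.
move=> bB; apply: (bounded_borelS _ _ bB); last exact: subIsetl.
by apply: measurableI; [case: bB|exact: measurable_fiber].
Qed.

Lemma sfun_intE B h : bounded_borel B -> (forall x, 0 <= h x) ->
  (\int[lebesgue_measure]_(u in B) (h (f u))%:E)%E = (sfun_int B h)%:E.
Proof. by move=> bB h0; rewrite integral_simple. Qed.

Lemma sfun_int_ge0 B h : (forall x, 0 <= h x) -> 0 <= sfun_int B h.
Proof. by move=> h0; apply: sumr_ge0 => x _; rewrite mulr_ge0// fine_ge0. Qed.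

Lemma sfun_intU A B h : bounded_borel A -> bounded_borel B -> A `&` B = set0 ->
  sfun_int (A `|` B) h = sfun_int A h + sfun_int B h.
Proof.
move=> bA bB AB; rewrite /sfun_int -big_split/=; apply: eq_bigr => x _.
rewrite -mulrDr setIUl measureU; [|by case: (bI x bA)|by case: (bI x bB)|].
  by rewrite fineD// bounded_borel_fin_num//; exact: bI.
by rewrite setIACA AB set0I.
Qed.

Lemma sfun_int_set0 h : sfun_int set0 h = 0.
Proof. by apply: big1 => x _; rewrite set0I measure0 mulr0. Qed.

Lemma sfun_int1 B : bounded_borel B -> sfun_int B (fun=> 1) = fine (lebesgue_measure B).
Proof.
move=> bB; have := sfun_intE bB (fun=> ler01); rewrite integral_cst; last by case: bB.
by rewrite mul1e => ->.
Qed.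

Lemma sfun_int_le B h M : bounded_borel B ->
  (forall x, x \in (fset_set (range f) : seq R) -> h x <= M) ->
  sfun_int B h <= M * fine (lebesgue_measure B).
Proof.
move=> bB hM; rewrite -(sfun_int1 bB) /sfun_int mulr_sumr big_seq [leRHS]big_seq.
by apply: ler_sum => x xs; rewrite mul1r ler_wpM2r ?fine_ge0// hM.
Qed.

Lemma sfun_int_sum B (s : seq (R * R)) (h : R * R -> R -> R) :
  sfun_int B (fun x => - \sum_(c <- s) c.1 * h c x) =
  - \sum_(c <- s) c.1 * sfun_int B (h c).
Proof.
rewrite /sfun_int -sumrN.
transitivity (- \sum_(x <- fset_set (range f)) \sum_(c <- s)
   c.1 * (h c x * fine (lebesgue_measure (B `&` f @^-1` [set x])))).
  rewrite -sumrN; apply: eq_bigr => x _; rewrite mulNr mulr_suml; congr (- _).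
  by apply: eq_bigr => c _; rewrite mulrA.
rewrite exchange_big/= -sumrN; apply: eq_bigr => c _.
by rewrite mulr_sumr.
Qed.

Lemma sfun_cos B (v : R) : bounded_borel B ->
  E (fun w => cos (v * simple_integral L f B w)) =
  expR (- sfun_int B (fun x => symbol a nu (v * x))).
Proof.
move=> bB.
have [-> _] := simple_integral_law measL levyZ (symbol_ge0 nu a0) lawZ f bB v.
by rewrite (@sfun_intE B (fun x => symbol a nu (v * x)))// => x; exact: symbol_ge0.
Qed.

(** Cut ]0, T] into N equal cells and add them one at a time with [sin_moment_step]. The step
    involves the lower power 2k of the sine, which is brought back to the power 2k + 2 at the price
    of theta. Linearising the exponentials on each cell costs a total of D / N, which disappears as
    N grows. *)
Lemma simple_sin_moment_grid k (C : R) (T m theta : R) : (0 < k)%N -> 0 <= C ->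
  sin_pow_bound k C ->
  0 < T -> 0 < theta ->
  sfun_int `]0, T] (fun x => symbol a nu (2 * (m * x))) <= theta ->
  E (fun w => sin (m * simple_integral L f `]0, T] w) ^+ (2 * k.+1)) <=
  expR C * C * (theta ^+ k.+1 + sfun_int `]0, T] (fun x => jump_sin nu k.+1 (m * x))).
Proof.
move=> k0 C0 HC T0 th0 Hth.
have [s [sE /(_ isT) s0 s2]] := @sin_pow_trig R k.+1.
have {}s2 : \sum_(c <- s) c.1 * c.2 ^+ 2 = 0 by apply: s2; rewrite ltnS.
pose psi := symbol a nu.
have psi0 x : 0 <= psi x by exact: symbol_ge0.
(* M dominates the exponent at every frequency of the trigonometric sum and every value of f, so a
   cell has exponent at most M T / N; D collects the resulting squared errors. *)
pose M := \sum_(c <- s) \sum_(x <- fset_set (range f)) psi (c.2 * (m * x)).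
pose D := (\sum_(c <- s) `|c.1|) * (M * T) ^+ 2.
have M0 : 0 <= M by apply: sumr_ge0 => c _; apply: sumr_ge0.
have D0 : 0 <= D by rewrite mulr_ge0 ?sqr_ge0// sumr_ge0.
set chi := fun x => jump_sin nu k.+1 (m * x).
have chi0 x : 0 <= chi x by exact: jump_sin_ge0.
suff key N : (0 < N)%N ->
    E (fun w => sin (m * simple_integral L f `]0, T] w) ^+ (2 * k.+1)) <=
    expR C * C * (theta ^+ k.+1 + sfun_int `]0, T] chi + D / N%:R).
  apply/ler_addgt0Pr => e e0.
  have eC0 : 0 <= expR C * C by rewrite mulr_ge0// expR_ge0.
  pose N := (Num.bound (expR C * C * D / e)).+1.
  apply: (le_trans (key N isT)); rewrite mulrDr lerD2l mulrA ler_pdivrMr ?ltr0n//.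
  rewrite [leRHS]mulrC -ler_pdivrMr//; apply: (@le_trans _ _ (Num.bound (expR C * C * D / e))%:R).
    apply/ltW/archi_boundP; rewrite divr_ge0//; last exact: ltW.
    exact: mulr_ge0.
  by rewrite ler_nat.
move=> N0; have NR0 : 0 < N%:R :> R by rewrite ltr0n.
pose t j : R := T * j%:R / N%:R.
have t0 : t 0%N = 0 by rewrite /t mulr0 mul0r.
have tN : t N = T by rewrite /t mulfK ?gt_eqF.
have tS j : t j.+1 = t j + T / N%:R by rewrite /t -natr1 mulrDr mulr1 mulrDl.
have tge0 j : 0 <= t j by rewrite /t divr_ge0 ?mulr_ge0 ?(ltW T0) ?(ltW NR0).
have tlt j : t j <= t j.+1 by rewrite tS lerDl divr_ge0// ltW.
pose A j : set R := `]0, t j]%classic.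
pose B j : set R := `]t j, t j.+1]%classic.
have bA j : bounded_borel (A j) by exact: bounded_borel_itv.
have bB j : bounded_borel (B j).
  split; first exact: measurable_itv.
  by exists (t j.+1) => x; rewrite /B /= !in_itv/= => /andP[tx ->]; rewrite (le_lt_trans _ tx).
have AS j : A j.+1 = A j `|` B j.
  apply/seteqP; split => [x|x]; rewrite /A /B /= !in_itv/=.
    move=> /andP[x0 xt]; have [xj|xj] := leP x (t j); first by left; rewrite x0.
    by right.
  move=> [/andP[-> xt]|/andP[tx ->]]; first by rewrite (le_trans xt).
  by rewrite (le_lt_trans _ tx).
have AB j : A j `&` B j = set0.
  rewrite -subset0 => x []; rewrite /A /B /= !in_itv/= => /andP[_ xt] /andP[tx _].
  by move: (le_lt_trans xt tx); rewrite ltxx.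
have lebB j : fine (lebesgue_measure (B j)) = T / N%:R.
  by rewrite lebesgue_measure_itvoc// tS addrAC subrr add0r.
pose S j := simple_integral L f (A j).
pose xi j := simple_integral L f (B j).
have mS j : measurable_fun setT (S j) by exact: (simple_integral_measurable measL).
have mxi j : measurable_fun setT (xi j) by exact: (simple_integral_measurable measL).
have cosSE j v : E (fun w => cos (v * S j w)) = expR (- sfun_int (A j) (fun x => psi (v * x))).
  exact: sfun_cos.
have cosXE j v : E (fun w => cos (v * xi j w)) = expR (- sfun_int (B j) (fun x => psi (v * x))).
  exact: sfun_cos.
pose u j := E (fun w => sin (m * S j w) ^+ (2 * k.+1)).
(* The energy of a cell relative to theta: these Gronwall weights sum to at most 1. *)
pose aa j := sfun_int (B j) (fun x => psi (2 * (m * x))) / theta.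
pose bb j := aa j * theta ^+ k.+1 + sfun_int (B j) chi + D / N%:R ^+ 2.
have aa0 j : 0 <= aa j by rewrite divr_ge0 ?(ltW th0)// sfun_int_ge0.
have bb0 j : 0 <= bb j.
  rewrite !addr_ge0//; [by rewrite mulr_ge0// exprn_ge0// ltW|exact: sfun_int_ge0|].
  by rewrite divr_ge0// sqr_ge0.
have u0 : u 0%N <= 0.
  rewrite /u (Rintegral_sin_pow_trig P m (mS 0%N) sE).
  rewrite (eq_bigr (fun c => c.1)) ?s0// => c _.
  by rewrite cosSE /A t0 set_itvoc0 sfun_int_set0 oppr0 expR0 mulr1.
(* From sin^2 = (1 - cos) / 2 at the doubled frequency and 1 - exp (-I) <= I. *)
have xi2 j : E (fun w => sin (m * xi j w) ^+ 2) <= aa j * theta / 2.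
  have -> : E (fun w => sin (m * xi j w) ^+ 2) =
      2^-1 * (1 - E (fun w => cos (2 * m * xi j w))).
    transitivity (E (fun w => 2^-1 * (1 - cos (2 * m * xi j w)))).
      by apply: eq_Rintegral => w _; rewrite sin2_half mulrC mulrA.
    have bc := bounded_mfun_cosM (2 * m) (mxi j).
    rewrite bRintegralZ; last by apply: bounded_mfunB => //; exact: bounded_mfun_cst.
    by rewrite bRintegralB ?bRintegral_cst//; exact: bounded_mfun_cst.
  rewrite cosXE divfK ?gt_eqF// mulrC ler_pM2r//.
  have -> : (fun x => psi (2 * m * x)) = (fun x => psi (2 * (m * x))).
    by apply/funext => x; rewrite mulrA.
  set I := sfun_int _ _; have := expR_ge1Dx (- I); lra.
(* In the cosine expansion replace exp (-I) by 1 - I, with error between 0 and I^2. The coefficients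
   sum to zero, which removes the 1, and the linear terms assemble into the jump part by
   [jump_sin_symbol]. *)
have xiK j : E (fun w => sin (m * xi j w) ^+ (2 * k.+1)) <= sfun_int (B j) chi + D / N%:R ^+ 2.
  rewrite (Rintegral_sin_pow_trig P m (mxi j) sE).
  pose I (c : R * R) := sfun_int (B j) (fun x => psi (c.2 * (m * x))).
  have I0 c : 0 <= I c by exact: sfun_int_ge0.
  have IM c : c \in s -> I c <= M * T / N%:R.
    move=> cs; rewrite -mulrA -(lebB j); apply: sfun_int_le => // x xs.
    apply: (@le_trans _ _ (\sum_(y <- fset_set (range f)) psi (c.2 * (m * y)))).
      by rewrite (big_rem x)//= lerDl sumr_ge0.
    rewrite /M (big_rem c)//= lerDl; apply: sumr_ge0 => c' _.
    exact: sumr_ge0.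
  have chiE : sfun_int (B j) chi = - \sum_(c <- s) c.1 * I c.
    rewrite -sfun_int_sum; congr (sfun_int _ _); apply/funext => x.
    by rewrite /chi (@jump_sin_symbol _ a nu nu2 k.+1 s).
  have step c : c \in s -> c.1 * E (fun w => cos (c.2 * m * xi j w)) <=
      c.1 - c.1 * I c + `|c.1| * ((M * T) ^+ 2 / N%:R ^+ 2).
    move=> cs; rewrite cosXE.
    have -> : sfun_int (B j) (fun x => psi (c.2 * m * x)) = I c.
      by congr (sfun_int _ _); apply/funext => x; rewrite mulrA.
    have I2 : I c ^+ 2 <= (M * T) ^+ 2 / N%:R ^+ 2.
      by rewrite -expr_div_n lerXn2r ?nnegrE// ?IM// divr_ge0 ?mulr_ge0// ltW.
    have e1 := expR_ge1Dx (- I c); have e2 := expRN_le (I0 c).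
    set X := expR _ in e1 e2 *; set I2' := I c ^+ 2 in e2 I2 *.
    have c_pos : 0 <= `|c.1| by [].
    have : `|c.1| * I2' <= `|c.1| * ((M * T) ^+ 2 / N%:R ^+ 2) by rewrite ler_wpM2l.
    have -> : c.1 * X = c.1 - c.1 * I c + c.1 * (X - (1 - I c)) by ring.
    have : c.1 * (X - (1 - I c)) <= `|c.1| * I2'.
      apply: (@le_trans _ _ (`|c.1| * (X - (1 - I c)))).
        by rewrite ler_wpM2r ?ler_norm//; lra.
      by rewrite ler_wpM2l//; lra.
    lra.
  rewrite big_seq; apply: (le_trans (ler_sum _ step)); rewrite -big_seq.
  rewrite big_split/= sumrB s0 sub0r -chiE -mulr_suml /D.
  by rewrite -mulrA.
(* Pointwise with q the squared sine: q^k theta is at most theta^(k+1) if q <= theta and at most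
   q^(k+1) otherwise. *)
have vth j : E (fun w => sin (m * S j w) ^+ (2 * k)) * theta <= u j + theta ^+ k.+1.
  have bk := bounded_mfun_sin_pow m (2 * k) (mS j).
  have bK := bounded_mfun_sin_pow m (2 * k.+1) (mS j).
  have bt : bounded_mfun ((fun=> theta ^+ k.+1) : Omega -> R) by exact: bounded_mfun_cst.
  rewrite mulrC -bRintegralZ// -[X in _ + X](bRintegral_cst P) -bRintegralD//.
  apply: le_bRintegral; [exact: bounded_mfunZ|exact: bounded_mfunD|].
  move=> w; set z := sin (m * S j w); rewrite !exprM; set q := z ^+ 2.
  have q0 : 0 <= q by exact: sqr_ge0.
  have [qt|/ltW tq] := leP q theta.
    apply: (@le_trans _ _ (theta ^+ k.+1)); last by rewrite lerDr exprn_ge0.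
    have qk : q ^+ k <= theta ^+ k by rewrite lerXn2r ?nnegrE// ltW.
    rewrite [leRHS]exprS; apply: ler_pM => //; first exact: ltW.
    exact: exprn_ge0.
  apply: (@le_trans _ _ (q ^+ k.+1)); last by rewrite lerDl exprn_ge0// ltW.
  rewrite [leRHS]exprS; apply: ler_pM => //; first exact: ltW.
  exact: exprn_ge0.
have ustep j : (j < N)%N -> u j.+1 <= (1 + C * aa j) * u j + C * bb j.
  move=> _.
  have prod v : E (fun w => cos (v * S j.+1 w)) =
      E (fun w => cos (v * S j w)) * E (fun w => cos (v * xi j w)).
    by rewrite (cosSE j.+1) (cosSE j) (cosXE j) -expRD -opprD (AS j) (sfun_intU _ (bA j) (bB j) (AB j)).
  have := sin_moment_step m C0 HC (mS j.+1) (mS j) (mxi j) prod.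
  move/le_trans; apply.
  rewrite -/(u j).
  set vj := E (fun w => sin (m * S j w) ^+ (2 * k)) in vth *.
  have := vth j; have := xi2 j; have := xiK j.
  have vj0 : 0 <= vj by apply: bRintegral_ge0 => w; exact: sin_pow_ge0.
  have uj0 : 0 <= u j by apply: bRintegral_ge0 => w; exact: sin_pow_ge0.
  rewrite -/vj.
  set q2 := E _; set q1 := E _ => h2 h1 h3.
  have h4 : vj * q1 <= aa j * (u j + theta ^+ k.+1).
    apply: (@le_trans _ _ (vj * (aa j * theta / 2))); first by rewrite ler_wpM2l.
    have -> : vj * (aa j * theta / 2) = aa j * (vj * theta) / 2 by ring.
    have : aa j * (vj * theta) <= aa j * (u j + theta ^+ k.+1) by rewrite ler_wpM2l.
    have : 0 <= aa j * (u j + theta ^+ k.+1).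
      by rewrite mulr_ge0// addr_ge0// exprn_ge0// ltW.
    lra.
  have : C * (vj * q1 + q2) <= C * (aa j * u j + bb j).
    by rewrite ler_wpM2l// /bb; lra.
  by rewrite mulrDr; lra.
have sumI h n : \sum_(0 <= j < n) sfun_int (B j) h = sfun_int (A n) h.
  elim: n => [|n IH]; first by rewrite big_nil /A t0 set_itvoc0 sfun_int_set0.
  by rewrite big_nat_recr//= IH (AS n) (sfun_intU _ (bA n) (bB n) (AB n)).
have sa : \sum_(0 <= j < N) aa j <= 1.
  rewrite -mulr_suml sumI ler_pdivrMr// mul1r /A tN.
  exact: Hth.
have := gronwall_sum C0 u0 aa0 bb0 ustep.
rewrite /u /S /A tN => /le_trans; apply.
rewrite -mulrA; apply: ler_pM; first exact: expR_ge0.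
- by rewrite mulr_ge0// sumr_ge0.
- by rewrite ler_expR -[leRHS]mulr1 ler_wpM2l.
rewrite ler_wpM2l// /bb !big_split/= -mulr_suml sumI /A tN.
apply: lerD; first apply: lerD => //.
  by rewrite -[leRHS]mul1r ler_wpM2r// exprn_ge0// ltW.
rewrite big_const_nat subn0 iter_addr_0 -mulr_natr le_eqVlt; apply/orP; left.
by apply/eqP; move: (gt_eqF NR0) => /negbT NRn0; field.
Qed.

End simple_sin_moment.

(** * Passage to limits in probability *)

Lemma fatou_ae_le d (T : measurableType d) (R : realType)
    (mu : {measure set T -> \bar R}) (D : set T) (h : nat -> T -> \bar R)
    (g : T -> \bar R) (e : \bar R) (n0 : nat) :
  measurable D -> (forall n, measurable_fun D (h n)) ->
  (forall n x, D x -> (0 <= h n x)%E) ->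
  measurable_fun D g -> (forall x, D x -> (0 <= g x)%E) ->
  {ae mu, forall x, D x -> h ^~ x @ \oo --> g x} ->
  (forall n, (n0 <= n)%N -> (\int[mu]_(x in D) h n x <= e)%E) ->
  (\int[mu]_(x in D) g x <= e)%E.
Proof.
move=> mD mh h0 mg g0 [N [mN N0 subN]] he.
have mDN : measurable (D `\` N) by exact: measurableD.
rewrite (ge0_negligible_integral mN mD mg g0 N0).
have mhN n : measurable_fun (D `\` N) (h n).
  exact: (measurable_funS mD (@subDsetl _ _ _) (mh n)).
have h0N n x : (D `\` N) x -> (0 <= h n x)%E by move=> [Dx _]; exact: h0.
have -> : (\int[mu]_(x in D `\` N) g x =
           \int[mu]_(x in D `\` N) limn_einf (h ^~ x))%E.
  apply: eq_integral => x; rewrite inE => -[Dx Nx].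
  have hx : h ^~ x @ \oo --> g x.
    have : ~ ~ (D x -> h ^~ x @ \oo --> g x) by move=> nQ; exact/Nx/subN.
    by move=> /contrapT /(_ Dx).
  rewrite is_cvg_limn_einfE; last by apply/cvg_ex; eexists; exact: hx.
  by rewrite (cvg_lim _ hx).
apply: (le_trans (fatou mu mDN mhN h0N)).
rewrite limn_einf_lim; apply: lime_le; first exact: is_cvg_einfs.
apply: nearW => n.
apply: (@le_trans _ _ (\int[mu]_(x in D `\` N) h (maxn n n0) x)%E).
  by apply: ereal_inf_lbound; exists (maxn n n0) => //=; exact: leq_maxl.
apply: le_trans (he _ (leq_maxr n n0)).
by rewrite (ge0_negligible_integral mN mD (mh _) (h0 _) N0).
Qed.

Section limit_sin_moment.
Context d (Omega : measurableType d) (R : realType) (P : probability Omega R).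
Variables (Z : R -> {RV P >-> R}) (L : set R -> Omega -> R).
Hypothesis measL : levy_random_measure Z L.
Hypothesis levyZ : levy_process Z.
Variables (a : R) (nu : {measure set (measurableTypeR R) -> \bar R}).
Hypothesis a0 : 0 <= a.
Hypothesis nu2 : (\int[nu]_x (x ^+ 2)%:E < +oo)%E.
Hypothesis lawZ : forall t, 0 <= t -> sym_law P (Z t) (fun m => t * symbol a nu m).
Variables (T : R) (F_ : nat -> {sfun measurableTypeR R >-> R}) (F : R -> R).
Variable X : {RV P >-> R}.
Hypothesis T0 : 0 < T.
Hypothesis mF : measurable_fun setT (F : measurableTypeR R -> measurableTypeR R).

Local Notation E f := (Rintegral P setT f).
Local Notation mu := (@lebesgue_measure R).
Local Notation D := (`]0, T]%classic : set R).
Local Notation J n := (simple_integral L (F_ n) D).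
Local Notation psi := (symbol a nu).

Hypothesis F_F : {ae mu, forall u : R, D u -> F_ n u @[n --> \oo] --> F u}.
Hypothesis J_X : cvg_in_probability P (fun n => J n) X.

Let bD : bounded_borel D. Proof. exact: bounded_borel_itv. Qed.
Let mD : measurable D. Proof. exact: measurable_itv. Qed.
Let mJ n : measurable_fun setT (J n).
Proof. exact: (simple_integral_measurable measL). Qed.
Let mX : measurable_fun setT X. Proof. by []. Qed.

(** 1 - cos is at most 2 on the event of a large deviation and at most half the squared argument off
    it. *)
Lemma onemcos_cvg_probability (v e : R) : 0 < e ->
  \forall n \near \oo, E (fun w => 1 - cos (v * (J n w - X w))) <= e.
Proof.
move=> e0.
(* Chosen so that v^2 eta^2 <= e; small deviations then cost e / 2, and large ones, of probability
   at most e / 4, cost another e / 2. *)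
pose eta := Num.sqrt (e / (v ^+ 2 + 1)).
have v1 : 0 < v ^+ 2 + 1 by rewrite ltr_wpDl ?sqr_ge0.
have eta0 : 0 < eta by rewrite sqrtr_gt0 divr_gt0.
have eta2 : v ^+ 2 * eta ^+ 2 <= e.
  rewrite sqr_sqrtr; last by rewrite divr_ge0// ltW.
  by rewrite mulrA ler_pdivrMr// mulrC ler_wpM2l ?(ltW e0)// lerDl.
have /fine_cvgP[_ /cvgrPdist_le /(_ (e / 4))] := J_X eta0.
rewrite divr_gt0// => /(_ isT); apply: filterS => n.
rewrite sub0r normrN ger0_norm ?fine_ge0// => Hn.
pose A := [set w | eta <= `|J n w - X w|].
have mY : measurable_fun setT (fun w => J n w - X w) by exact: measurable_funB.
have mA : measurable A.
  have -> : A = (fun w => `|J n w - X w|) @^-1` `[eta, +oo[%classic.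
    by rewrite set_itvcy.
  have mN : measurable_fun setT (fun w => `|J n w - X w|) by exact: measurableT_comp.
  have := mN measurableT _ (@measurable_itv R `[eta, +oo[).
  by rewrite setTI.
have bA := bounded_mfun_indic R mA.
have bc : bounded_mfun (fun w => 1 - cos (v * (J n w - X w))).
  by apply: bounded_mfunB; [exact: bounded_mfun_cst|exact: bounded_mfun_cosM].
have be : bounded_mfun ((fun=> e / 2) : Omega -> R) by exact: bounded_mfun_cst.
apply: (@le_trans _ _ (E (fun w => e / 2 + 2 * \1_A w))).
  apply: le_bRintegral => //; first by apply: bounded_mfunD => //; exact: bounded_mfunZ.
  move=> w; rewrite indicE; have /andP[h0 h1] := onemcos_le_sqr (v * (J n w - X w)).
  have [wA|wA] := boolP (w \in A).
    have := cos_geN1 (v * (J n w - X w)); rewrite mulr1; lra.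
  rewrite mulr0 addr0 (le_trans h1)// ler_pM2r// (le_trans _ eta2)// exprMn.
  rewrite ler_wpM2l ?sqr_ge0// -real_normK ?num_real// lerXn2r ?nnegrE ?(ltW eta0)//.
  by rewrite leNgt; apply: contra wA => /ltW H; rewrite inE.
rewrite bRintegralD ?bRintegral_cst//; last exact: bounded_mfunZ.
rewrite bRintegralZ// Rintegral_indic_prob//.
have : fine (P A) <= e / 4 by [].
by lra.
Qed.

Lemma symbol_int_fin_num n m v :
  (\int[mu]_(u in D) (psi (v * (F_ n u - F_ m u)))%:E)%E \is a fin_num.
Proof.
by rewrite (@sfun_intE _ (F_ n - F_ m)%R D (fun x => psi (v * x)))// => x; exact: symbol_ge0.
Qed.

(** The difference of two elementary integrals is again elementary, so the mean of its cosine is exp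
    (-I) with I the energy of the difference. Convergence in probability forces this mean towards 1,
    hence I towards 0. *)
Lemma symbol_int_cauchy (v e : R) : 0 < e ->
  \forall N \near \oo, forall n m, (N <= n)%N -> (N <= m)%N ->
  (\int[mu]_(u in D) (psi (v * (F_ n u - F_ m u)))%:E <= e%:E)%E.
Proof.
(* With 1 - exp (-I) <= 4 e' <= 1/2, the inequality exp (-I) (1 + I) <= 1 gives I <= 8 e' <= e. *)
move=> e0; pose e' := Num.min 1 e / 8.
have e'0 : 0 < e' by rewrite divr_gt0// lt_min ltr01.
have [N _ HN] := onemcos_cvg_probability v e'0.
exists N => // N' /= NN' n m N'n N'm.
have en := HN n (leq_trans NN' N'n); have em := HN m (leq_trans NN' N'm).
pose f3 : {sfun measurableTypeR R >-> R} := F_ n - F_ m.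
rewrite -[leLHS]fineK ?symbol_int_fin_num// lee_fin.
set I := fine _.
have I0 : 0 <= I.
  by apply: fine_ge0; apply: integral_ge0 => u _; rewrite lee_fin symbol_ge0.
have IE : E (fun w => cos (v * (J n w - J m w))) = expR (- I).
  have [<- _] := simple_integral_law measL levyZ (symbol_ge0 nu a0) lawZ f3 bD v.
  apply: ae_eq_Rintegral.
  - by have [] := bounded_mfun_cosM v (measurable_funB (mJ n) (mJ m)).
  - by have [] := bounded_mfun_cosM v (simple_integral_measurable measL f3 bD).
  - have := @simple_integralB _ _ _ _ _ _ measL (F_ n) (F_ m) f3 _ bD (fun _ _ => erefl).
    by apply: filterS => w ->.
have bn k : bounded_mfun (fun w => 1 - cos (v * (J k w - X w))).
  apply: bounded_mfunB; first exact: bounded_mfun_cst.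
  by apply: bounded_mfun_cosM; exact: measurable_funB.
have bnm : bounded_mfun (fun w => cos (v * (J n w - J m w))).
  by apply: bounded_mfun_cosM; exact: measurable_funB.
have : 1 - expR (- I) <= 4 * e'.
  rewrite -IE -[X in X - _](bRintegral_cst P) -bRintegralB//; last exact: bounded_mfun_cst.
  apply: (@le_trans _ _ (E (fun w => 2 * (1 - cos (v * (J n w - X w))) +
                                   2 * (1 - cos (v * (J m w - X w)))))).
    apply: le_bRintegral.
    - by apply: bounded_mfunB => //; exact: bounded_mfun_cst.
    - by apply: bounded_mfunD; exact: bounded_mfunZ.
    move=> w; have -> : v * (J n w - J m w) =
        v * (J n w - X w) + - (v * (J m w - X w)) by ring.
    by rewrite (le_trans (onemcosD_le _ _))// cosN.
  rewrite bRintegralD; [|exact: bounded_mfunZ|exact: bounded_mfunZ].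
  by rewrite !bRintegralZ//; lra.
have e1 : 4 * e' <= 1 / 2.
  have : Num.min 1 e <= 1 by rewrite ge_min lexx.
  by rewrite /e'; lra.
have e2 : 8 * e' <= e.
  have : Num.min 1 e <= e by rewrite ge_min lexx orbT.
  by rewrite /e'; lra.
have eI : expR (- I) * (1 + I) <= 1.
  apply: (@le_trans _ _ (expR (- I) * expR I)); last by rewrite -expRD addNr expR0.
  by rewrite ler_wpM2l ?expR_ge0// expR_ge1Dx.
have := expR_ge0 (- I); set y := expR _ in eI *; nra.
Qed.

(** Let the second index of the Cauchy estimate tend to infinity and use Fatou. Almost everywhere
    convergence of the simple functions alone would not control the energy; this is where
    convergence of the integrals is essential. *)
Lemma symbol_int_cvg (v e : R) : 0 < e ->
  \forall n \near \oo,
  (\int[mu]_(u in D) (psi (v * (F_ n u - F u)))%:E <= e%:E)%E.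
Proof.
move=> e0; have [N0 _ /(_ N0 (leqnn _)) H] := symbol_int_cauchy v e0.
exists N0 => // n /= N0n.
have mpsi (g : R -> R) : measurable_fun setT (g : measurableTypeR R -> measurableTypeR R) ->
    measurable_fun D (fun u => (psi (v * g u))%:E).
  move=> mg; apply/measurable_EFinP; apply: measurable_funTS.
  apply: (measurableT_comp (measurable_symbol a0 nu2)).
  exact: measurable_funM.
have mFn k : measurable_fun setT (F_ k) by [].
pose h m u : \bar R := (psi (v * (F_ n u - F_ m u)))%:E.
have mh m : measurable_fun D (h m) by apply: mpsi; exact: measurable_funB.
have h0 m u : D u -> (0 <= h m u)%E by move=> _; rewrite lee_fin symbol_ge0.
apply: (@fatou_ae_le _ _ _ mu D h _ _ N0 mD mh h0).
- by apply: mpsi; exact: measurable_funB.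
- by move=> u _; rewrite lee_fin symbol_ge0.
- have [N [mN muN sN]] := F_F; exists N; split => // u /= nH; apply: sN => /= Fu.
  apply: nH => Du; have {}Fu := Fu Du.
  apply: cvg_EFin; first exact: nearW.
  apply: (@continuous_cvg _ _ _ _ _ _ psi); first exact: continuous_symbol.
  by apply: cvgMr; apply: cvgB => //; exact: cvg_cst.
- by move=> m N0m; exact: H.
Qed.

(** Compare X with one elementary integral whose integrand is close to F in energy. The
    quasi-triangle inequalities for [symbol], [jump_sin] and the sine power produce the factors 3
    and 4. *)
Lemma limit_sin_moment k (C m theta q : R) : (0 < k)%N -> 0 <= C ->
  sin_pow_bound k C ->
  0 < theta ->
  (\int[mu]_(u in D) (psi (2 * (m * F u)))%:E <= theta%:E)%E ->
  (\int[mu]_(u in D) (jump_sin nu k.+1 (m * F u))%:E <= q%:E)%E ->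
  E (fun w => sin (m * X w) ^+ (2 * k.+1)) <=
  4 ^+ k.+1 * (expR C * C * (3 ^+ k.+1 * theta ^+ k.+1 + 4 ^+ k.+1 * q)).
Proof.
move=> k0 C0 HC th0 Hth Hq.
pose K := k.+1; have K0 : (0 < K)%N by [].
have mFn n : measurable_fun setT (F_ n) by [].
have mpsi (g : R -> R) (v : R) : measurable_fun setT (g : measurableTypeR R -> measurableTypeR R) ->
    measurable_fun D (fun u => (psi (v * g u))%:E).
  move=> mg; apply/measurable_EFinP; apply: measurable_funTS.
  apply: (measurableT_comp (measurable_symbol a0 nu2)).
  exact: measurable_funM.
have mchi (g : R -> R) (v : R) : measurable_fun setT (g : measurableTypeR R -> measurableTypeR R) ->
    measurable_fun D (fun u => (jump_sin nu K (v * g u))%:E).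
  move=> mg; apply/measurable_EFinP; apply: measurable_funTS.
  apply: (measurableT_comp (@measurable_jump_sin _ a nu a0 nu2 K _)) => //.
  exact: measurable_funM.
have p0 x : (0 <= (psi x)%:E)%E by rewrite lee_fin symbol_ge0.
have c0 x : (0 <= (jump_sin nu K x)%:E)%E by rewrite lee_fin jump_sin_ge0.
set c1 := expR C * C.
have c1ge0 : 0 <= c1 by rewrite mulr_ge0 ?expR_ge0.
(* With e <= theta / 2 the energy of the simple integrand is at most 2 theta + 2 e <= 3 theta; the
   rest of the error vanishes with e. *)
suff H e : 0 < e -> e <= theta / 2 ->
   E (fun w => sin (m * X w) ^+ (2 * K)) <=
   4 ^+ K * (c1 * (3 ^+ K * theta ^+ K + 4 ^+ K * (q + e)) + e).
  apply/ler_addgt0Pr => e e0.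
  have e40 : 0 < 4 ^+ K * (c1 * 4 ^+ K + 1) :> R.
    by rewrite mulr_gt0 ?exprn_gt0// ltr_wpDl// mulr_ge0// exprn_ge0.
  pose e' := Num.min (theta / 2) (e / (4 ^+ K * (c1 * 4 ^+ K + 1))).
  have e'0 : 0 < e' by rewrite lt_min !divr_gt0.
  apply: (le_trans (H e' e'0 _)); first by rewrite ge_min lexx.
  have : e' * (4 ^+ K * (c1 * 4 ^+ K + 1)) <= e.
    by rewrite -ler_pdivlMr// ge_min lexx orbT.
  set A := 4 ^+ K; set B := 3 ^+ K * theta ^+ K => h.
  have -> : A * (c1 * (B + A * (q + e')) + e') =
    A * (c1 * (B + A * q)) + e' * (A * (c1 * A + 1)) by ring.
  by rewrite lerD2l.
move=> e0 eth.
have e2 : 0 < 2 * e by rewrite mulr_gt0.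
have H1 := symbol_int_cvg (2 * m) e0.
have H2 := onemcos_cvg_probability (2 * m) e2.
have [n _ /(_ n (leqnn n)) [] {}H1 {}H2] : \forall n \near \oo,
  (\int[mu]_(u in D) (psi (2 * m * (F_ n u - F u)))%:E <= e%:E)%E /\
  E (fun w => 1 - cos (2 * m * (J n w - X w))) <= 2 * e.
  by apply: filterS2 H1 H2.
have mFF : measurable_fun setT (fun u : measurableTypeR R => F_ n u - F u).
  exact: measurable_funB.
have I1 : sfun_int (F_ n) D (fun x => psi (2 * (m * x))) <= 3 * theta.
  rewrite -lee_fin -sfun_intE//; last by move=> x; exact: symbol_ge0.
  apply: (@le_trans _ _ (\int[mu]_(u in D) (2%:E * (psi (2 * m * F u))%:E +
      2%:E * (psi (2 * m * (F_ n u - F u)))%:E))%E).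
    apply: ge0_le_integral => //.
    - by apply: (mpsi (fun u => m * F_ n u)); exact: measurable_funM.
    - by apply: emeasurable_funD; apply: measurable_funeM; exact: mpsi.
    - move=> u _; rewrite -!EFinM -EFinD lee_fin.
      have -> : 2 * (m * F_ n u) = 2 * m * F u + 2 * m * (F_ n u - F u) by ring.
      exact: symbolD_le.
  rewrite ge0_integralD//; last 4 first.
  - by move=> u _; rewrite mule_ge0.
  - by apply: measurable_funeM; exact: mpsi.
  - by move=> u _; rewrite mule_ge0.
  - by apply: measurable_funeM; exact: mpsi.
  rewrite !ge0_integralZl//; [|exact: mpsi|exact: mpsi].
  under eq_integral do rewrite -mulrA.
  apply: (@le_trans _ _ (2%:E * theta%:E + 2%:E * e%:E)%E).
    by apply: leeD; rewrite lee_pmul2l.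
  by rewrite -!EFinM -EFinD lee_fin; lra.
have I2 : sfun_int (F_ n) D (fun x => jump_sin nu K (m * x)) <= 4 ^+ K * (q + e).
  rewrite -lee_fin -sfun_intE//; last by move=> x; exact: jump_sin_ge0.
  have p4 : 0 <= 4 ^+ K :> R by rewrite exprn_ge0.
  apply: (@le_trans _ _ (\int[mu]_(u in D) ((4 ^+ K)%:E * (jump_sin nu K (m * F u))%:E +
      (4 ^+ K)%:E * (psi (2 * m * (F_ n u - F u)))%:E))%E).
    apply: ge0_le_integral => //.
    - exact: (mchi (F_ n) m (mFn n)).
    - by apply: emeasurable_funD; apply: measurable_funeM; [exact: mchi|exact: mpsi].
    - move=> u _; rewrite -!EFinM -EFinD lee_fin -mulrDr.
      have -> : m * F_ n u = m * F u + m * (F_ n u - F u) by ring.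
      apply: (le_trans (jump_sinD_le nu2 _ _ K0)).
      rewrite ler_wpM2l// lerD2l (le_trans (jump_sin_le a0 nu2 _ K0))// mulrA.
      by have := symbol_ge0 nu a0 (2 * m * (F_ n u - F u)); lra.
  rewrite ge0_integralD//; last 4 first.
  - by move=> u _; rewrite mule_ge0.
  - by apply: measurable_funeM; exact: mchi.
  - by move=> u _; rewrite mule_ge0.
  - by apply: measurable_funeM; exact: mpsi.
  rewrite !ge0_integralZl//; [|exact: mpsi|exact: mchi].
  rewrite mulrDr EFinD !EFinM; apply: leeD; exact: lee_wpmul2l.
have th3 : 0 < 3 * theta by rewrite mulr_gt0.
have := simple_sin_moment_grid measL levyZ a0 nu2 lawZ k0 C0 HC T0 th3 I1.
rewrite -/K -/c1 exprMn => H3.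
have bX := bounded_mfun_sin_pow m (2 * K) mX.
have bJ := bounded_mfun_sin_pow m (2 * K) (mJ n).
have mXJ : measurable_fun setT (fun w => X w - J n w) by exact: measurable_funB.
have bXJ := bounded_mfun_sin_pow m (2 * K) mXJ.
apply: (@le_trans _ _ (E (fun w => 4 ^+ K * (sin (m * J n w) ^+ (2 * K) +
    sin (m * (X w - J n w)) ^+ (2 * K))))).
  apply: le_bRintegral => //.
    by apply: bounded_mfunZ; exact: bounded_mfunD.
  move=> w; have -> : m * X w = m * J n w + m * (X w - J n w) by ring.
  exact: sinD_pow_le.
rewrite bRintegralZ; last exact: bounded_mfunD.
rewrite ler_wpM2l ?exprn_ge0// bRintegralD//; apply: lerD.
  apply: (le_trans H3); rewrite ler_wpM2l//.
  by rewrite lerD2l.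
apply: (@le_trans _ _ (E (fun w => 2^-1 * (1 - cos (2 * m * (J n w - X w)))))).
  apply: le_bRintegral => //.
    apply: bounded_mfunZ; apply: bounded_mfunB; first exact: bounded_mfun_cst.
    by apply: bounded_mfun_cosM; exact: measurable_funB.
  move=> w; apply: (le_trans (sin_pow_le _ K0)).
  have -> : 2 * (m * (X w - J n w)) = - (2 * m * (J n w - X w)) by ring.
  by rewrite cosN mulrC.
rewrite bRintegralZ; first by lra.
apply: bounded_mfunB; first exact: bounded_mfun_cst.
by apply: bounded_mfun_cosM; exact: measurable_funB.
Qed.

End limit_sin_moment.

(** * The moment of order p of a stochastic integral *)

Lemma measurable_norm_powR d (U : measurableType d) (R : realType) (D : set U)
    (p : R) (f : U -> R) :
  measurable_fun D f -> measurable_fun D (fun x => `|f x| `^ p).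
Proof.
move=> mf; apply: (measurableT_comp (measurable_powR p)).
exact: measurableT_comp.
Qed.

(** The constant depends neither on the integrand nor on the approximating sequence. At scale m use
    [limit_sin_moment] with theta = (m y)^2, where y is proportional to w^(1/p); then the weighted
    sum of min (1, (m y)^2K) is of order y^p, hence of order w, and the jump terms sum by
    [dyadic_jump_sin_le]. *)
Lemma integral_moment_bound d (Omega : measurableType d) (R : realType)
    (P : probability Omega R) (Z : R -> {RV P >-> R}) (a : R)
    (nu : {measure set (measurableTypeR R) -> \bar R}) (T p : R) :
  levy_process Z -> 0 <= a -> (\int[nu]_x (x ^+ 2)%:E < +oo)%E ->
  (\int[nu]_x (`|x| `^ p)%:E < +oo)%E ->
  (forall t, 0 <= t -> sym_law P (Z t) (fun m => t * symbol a nu m)) ->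
  0 < T -> 2 <= p ->
  exists2 K : R, 0 <= K &
  forall (L : set R -> Omega -> R) (F_ : nat -> {sfun measurableTypeR R >-> R})
    (F : R -> R) (X : {RV P >-> R}) (w : R),
  levy_random_measure Z L ->
  measurable_fun setT (F : measurableTypeR R -> measurableTypeR R) ->
  {ae lebesgue_measure, forall u : R, `]0, T]%classic u -> F_ n u @[n --> \oo] --> F u} ->
  cvg_in_probability P (fun n => simple_integral L (F_ n) `]0, T]) X ->
  0 < w ->
  (\int[lebesgue_measure]_(u in `]0%R, T]) (`|F u| `^ p)%:E <= w%:E)%E ->
  (\int[P]_x (`|X x| `^ p)%:E <= (K * w)%:E)%E.
Proof.
move=> levyZ a0 nu2 nup lawZ T0 p2.
have p0 : 0 < p by lra.
(* The order required by the dyadic sums; with p >= 2 it also yields k > 0, as the cancellation of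
   the Gaussian part demands. *)
have [k] : exists k, p + 1 <= (2 * k.+1)%:R.
  exists (Num.bound p); have : p < (Num.bound p)%:R by apply: archi_boundP; lra.
  by rewrite natrM -!natr1; have := ler0n R (Num.bound p); lra.
set K := k.+1 => pK.
have k0 : (0 < k)%N.
  by rewrite lt0n; apply/eqP => k0; move: pK; rewrite /K k0; lra.
have [C C0 HC] := @sin_pow_sym R k.
pose sg := symbol_var a nu; have sg0 : 0 <= sg by exact: symbol_var_ge0.
(* Tuned so that the energy of F at frequency 2m is at most (m w^(1/p) B)^2; the added ones keep B
   positive, hence theta positive. *)
pose B := Num.sqrt ((2 * sg + 1) * (T + 1)).
pose mp := \int[nu]_x (`|x| `^ p).
have inup : nu.-integrable setT (fun x => (`|x| `^ p)%:E).
  apply/integrableP; split.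
    by apply/measurable_EFinP; apply: measurable_norm_powR; exact: measurable_id.
  by under eq_integral do rewrite gee0_abs ?lee_fin ?powR_ge0//.
have mp0 : 0 <= mp by apply: Rintegral_ge0 => x _; exact: powR_ge0.
pose c1 := 4 ^+ K * (expR C * C * (3 ^+ K + 4 ^+ K)).
have c10 : 0 <= c1.
  apply: mulr_ge0; first exact: exprn_ge0.
  by apply: mulr_ge0; [apply: mulr_ge0 => //; exact: expR_ge0|apply: addr_ge0; exact: exprn_ge0].
pose K0 := (1 + c1) * (6 * B `^ p + 6 * mp).
have K00 : 0 <= K0.
  by apply: mulr_ge0; [exact: addr_ge0|apply: addr_ge0; apply: mulr_ge0 => //; exact: powR_ge0].
pose c0 := sin (2^-1 : R) ^+ (2 * K).
have pi2 := @pihalf_ge1 R.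
have c00 : 0 < c0.
  rewrite exprn_gt0//; apply: sin_gt0_pihalf; rewrite invr_gt0//=; lra.
exists (K0 / c0); first by rewrite divr_ge0// ltW.
move=> L F_ F X w measL mF F_F J_X w0 Hw.
set D := (`]0, T]%classic : set R).
have mD : measurable D by exact: measurable_itv.
have muD : lebesgue_measure D = T%:E.
  by rewrite lebesgue_measure_itv/= lte_fin T0 -EFinB subr0.
have mX : measurable_fun setT X by [].
pose c := w `^ p^-1; have cgt0 : 0 < c by rewrite powR_gt0.
have cp : c `^ p = w by rewrite -powRrM mulVf ?gt_eqF// powRr1// ltW.
have B0 : 0 <= B by rewrite sqrtr_ge0.
have B2 : B ^+ 2 = (2 * sg + 1) * (T + 1).
  by rewrite sqr_sqrtr// mulr_ge0//; lra.
pose y := c * B; have y0 : 0 <= y by rewrite mulr_ge0// ltW.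
have yp : y `^ p = B `^ p * w by rewrite powRM ?(ltW cgt0)// cp mulrC.
have mFp : measurable_fun D (fun u => (`|F u| `^ p)%:E).
  by apply/measurable_EFinP; apply: measurable_norm_powR; exact: measurable_funTS.
have mF2 : measurable_fun D (fun u => (F u ^+ 2)%:E).
  by apply/measurable_EFinP; apply: measurable_funTS; exact: measurable_funX.
(* An elementary replacement for Hoelder's inequality: F^2 <= c^2 + (c^2 / w) |F|^p, by comparing
   |F| with the level c for which c^p = w. *)
have F2 : (\int[lebesgue_measure]_(u in D) (F u ^+ 2)%:E <= (c ^+ 2 * (T + 1))%:E)%E.
  apply: (@le_trans _ _ (\int[lebesgue_measure]_(u in D)
      ((c ^+ 2)%:E + (c ^+ 2 / w)%:E * (`|F u| `^ p)%:E))%E).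
    apply: ge0_le_integral => //.
    - by move=> u _; rewrite lee_fin sqr_ge0.
    - by apply: emeasurable_funD; [exact: measurable_cst|exact: measurable_funeM].
    - move=> u _; rewrite -EFinM -EFinD lee_fin.
      have q0 : 0 <= c ^+ 2 / w * `|F u| `^ p.
        by rewrite mulr_ge0 ?powR_ge0// divr_ge0 ?sqr_ge0// ltW.
      have [Fc|Fc] := leP `|F u| c.
        apply: ler_wpDr => //; rewrite -real_normK ?num_real//.
        by rewrite lerXn2r ?nnegrE// ltW.
      apply: ler_wpDl; first exact: sqr_ge0.
      rewrite mulrAC -mulrA -cp -ler_pdivrMl ?exprn_gt0// mulrC.
      have -> : `|F u| `^ p / c `^ p = (`|F u| / c) `^ p.
        rewrite powRM ?invr_ge0 ?(ltW cgt0)//; congr (_ * _).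
        by rewrite -[c^-1]powR_inv1 ?(ltW cgt0)// -powRrM mulN1r powRN.
      rewrite -real_normK ?num_real// -expr_div_n -powR_mulrn ?divr_ge0// ?(ltW cgt0)//.
      by apply: ler_powR => //; rewrite ler_pdivlMr// mul1r ltW.
  rewrite ge0_integralD//; last 3 first.
  - by move=> u _; rewrite lee_fin sqr_ge0.
  - by move=> u _; rewrite mule_ge0// ?lee_fin ?powR_ge0// divr_ge0 ?sqr_ge0// ltW.
  - exact: measurable_funeM.
  rewrite integral_cst// ge0_integralZl//; last first.
    by rewrite lee_fin divr_ge0 ?sqr_ge0// ltW.
  rewrite mulrDr EFinD; apply: leeD.
    by rewrite [leRHS]EFinM; apply: lee_wpmul2l; [rewrite lee_fin sqr_ge0|rewrite -muD].
  apply: (@le_trans _ _ ((c ^+ 2 / w)%:E * w%:E)%E).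
    by rewrite lee_wpmul2l// lee_fin divr_ge0 ?sqr_ge0// ltW.
  by rewrite -EFinM divfK ?gt_eqF// mulr1.
have mpsi v : measurable_fun D (fun u => (symbol a nu (v * F u))%:E).
  apply/measurable_EFinP; apply: measurable_funTS.
  apply: (measurableT_comp (measurable_symbol a0 nu2)).
  exact: measurable_funM.
have mchi v : measurable_fun D (fun u => (jump_sin nu K (v * F u))%:E).
  apply/measurable_EFinP; apply: measurable_funTS.
  apply: (measurableT_comp (@measurable_jump_sin _ a nu a0 nu2 K k0)).
  exact: measurable_funM.
have sgm0 m : 0 <= 2 * sg * m ^+ 2.
  by apply: mulr_ge0; [exact: mulr_ge0|exact: sqr_ge0].
have Ipsi m : (\int[lebesgue_measure]_(u in D) (symbol a nu (2 * (m * F u)))%:E <=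
    ((m * y) ^+ 2)%:E)%E.
  apply: (@le_trans _ _ (\int[lebesgue_measure]_(u in D)
      ((2 * sg * m ^+ 2)%:E * (F u ^+ 2)%:E))%E).
    apply: ge0_le_integral => //.
    - by move=> u _; rewrite lee_fin symbol_ge0.
    - by under eq_fun do rewrite mulrA; exact: mpsi.
    - exact: measurable_funeM.
    - move=> u _; rewrite -EFinM lee_fin (le_trans (symbol_le a0 nu2 _))// -/sg.
      by rewrite !exprMn; lra.
  rewrite ge0_integralZl//; last 2 first.
  - by move=> u _; rewrite lee_fin sqr_ge0.
  - by rewrite lee_fin sgm0.
  apply: (@le_trans _ _ ((2 * sg * m ^+ 2)%:E * (c ^+ 2 * (T + 1))%:E)%E).
    by rewrite lee_wpmul2l// lee_fin sgm0.
  rewrite -EFinM lee_fin /y !exprMn B2.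
  have : 0 <= m ^+ 2 * (c ^+ 2 * (T + 1)).
    by apply: mulr_ge0; [exact: sqr_ge0|apply: mulr_ge0; [exact: sqr_ge0|lra]].
  set z := _ * (_ * _) => z0; have -> : 2 * sg * m ^+ 2 * (c ^+ 2 * (T + 1)) = 2 * sg * z.
    by rewrite /z; ring.
  have -> : m ^+ 2 * (c ^+ 2 * ((2 * sg + 1) * (T + 1))) = (2 * sg + 1) * z.
    by rewrite /z; ring.
  by rewrite [leRHS]mulrDl mul1r lerDl.
pose q m := fine (\int[lebesgue_measure]_(u in D) (jump_sin nu K (m * F u))%:E)%E.
have qE m : (\int[lebesgue_measure]_(u in D) (jump_sin nu K (m * F u))%:E = (q m)%:E)%E.
  rewrite fineK// ge0_fin_numE; last first.
    by apply: integral_ge0 => u _; rewrite lee_fin jump_sin_ge0.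
  apply: le_lt_trans (ltry ((m * y) ^+ 2)); apply: le_trans (Ipsi m).
  apply: ge0_le_integral => //.
  - by move=> u _; rewrite lee_fin jump_sin_ge0.
  - exact: mchi.
  - by under eq_fun do rewrite mulrA; exact: mpsi.
  move=> u _; rewrite lee_fin (le_trans (jump_sin_le a0 nu2 _ _))//.
  by have := symbol_ge0 nu a0 (2 * (m * F u)); lra.
have q0 m : 0 <= q m by apply: fine_ge0; apply: integral_ge0 => u _; rewrite lee_fin jump_sin_ge0.
have y_gt0 : 0 < y.
  by rewrite mulr_gt0// sqrtr_gt0 mulr_gt0//; lra.
(* The truncation at 1 is free because the sine power is bounded by 1, and it is what makes the sum
   over large scales converge. *)
have Esin m : 0 < m -> \int[P]_x (sin (m * X x) ^+ (2 * K)) <=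
    (1 + c1) * (Num.min 1 ((m * y) ^+ (2 * K)) + q m).
  move=> m0.
  have my0 : 0 < (m * y) ^+ 2 by rewrite exprn_gt0// mulr_gt0.
  have := limit_sin_moment measL levyZ a0 nu2 lawZ T0 mF F_F J_X (k := k) (C := C)
    (m := m) (theta := (m * y) ^+ 2) (q := q m) k0 C0 HC my0 (Ipsi m).
  rewrite qE lexx => /(_ isT).
  rewrite -/K -exprM; set th := (m * y) ^+ (2 * K); set S := Rintegral _ _ _ => HS.
  have S1 : S <= 1.
    apply: le_bRintegral_cst => [|x]; first exact: bounded_mfun_sin_pow.
    exact: sin_pow_le1.
  have th0 : 0 <= th by rewrite /th exprn_ge0// mulr_ge0// ltW.
  have HS2 : S <= c1 * (th + q m).
    apply: (le_trans HS); rewrite /c1 -!mulrA; do 3 (apply: ler_wpM2l; first by rewrite ?exprn_ge0 ?expR_ge0).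
    have h1 : 0 <= 4 ^+ K * th by rewrite mulr_ge0// exprn_ge0.
    have h2 : 0 <= 3 ^+ K * q m by rewrite mulr_ge0// exprn_ge0.
    by rewrite mulrDl !mulrDr; lra.
  have [th1|th1] := leP th 1.
    apply: (le_trans HS2); apply: ler_pM => //; first exact: addr_ge0.
    by rewrite lerDr.
  apply: (le_trans S1); have := mulr_ge0 c10 (q0 m); have := q0 m.
  by rewrite mulrDl mul1r mulrDr mulr1; lra.
have bdy N : bounded_mfun (fun x => dyadic_sin p K N (X x)).
  apply: bounded_mfun_sum => i; apply: bounded_mfunZ.
  exact: bounded_mfun_sin_pow.
have Edy N : \int[P]_x (dyadic_sin p K N (X x)) <= K0 * w.
  rewrite /dyadic_sin bRintegral_sum; last first.
    by move=> i; apply: bounded_mfunZ; exact: bounded_mfun_sin_pow.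
  apply: (@le_trans _ _ (\sum_(0 <= i < 2 * N) scale N i `^ (- p) *
      ((1 + c1) * (Num.min 1 ((scale N i * y) ^+ (2 * K)) + q (scale N i))))).
    apply: ler_sum => i _; rewrite bRintegralZ; last exact: bounded_mfun_sin_pow.
    by rewrite ler_wpM2l ?powR_ge0// Esin// scale_gt0.
  rewrite (eq_bigr (fun i => (1 + c1) * (scale N i `^ (- p) *
    Num.min 1 ((scale N i * y) ^+ (2 * K)) + scale N i `^ (- p) * q (scale N i)))); last first.
    by move=> i _; rewrite mulrCA mulrDr.
  rewrite -mulr_sumr /K0 -mulrA ler_wpM2l ?addr_ge0// big_split/= mulrDl; apply: lerD.
    have p1 : 1 <= p by lra.
    by apply: (le_trans (dyadic_sum_le N p1 pK y0)); rewrite yp mulrA.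
  rewrite -lee_fin -sumEFin.
  rewrite (eq_bigr (fun i => \int[lebesgue_measure]_(u in D)
     ((scale N i `^ (- p))%:E * (jump_sin nu K (scale N i * F u))%:E)%E)%E); last first.
    move=> i _; rewrite ge0_integralZl//; last 3 first.
    - exact: mchi.
    - by move=> u _; rewrite lee_fin jump_sin_ge0.
    - by rewrite lee_fin powR_ge0.
    by rewrite qE EFinM.
  rewrite -ge0_integral_sum//; last 2 first.
  - by move=> i; apply: measurable_funeM; exact: mchi.
  - by move=> i u _; rewrite mule_ge0// lee_fin ?powR_ge0 ?jump_sin_ge0.
  apply: (@le_trans _ _ (\int[lebesgue_measure]_(u in D) ((6 * mp)%:E * (`|F u| `^ p)%:E))%E).
    apply: ge0_le_integral => //.
    - by move=> u _; apply: sume_ge0 => i _; rewrite mule_ge0// lee_fin ?powR_ge0 ?jump_sin_ge0.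
    - by apply: emeasurable_sum => i; apply: measurable_funeM; exact: mchi.
    - exact: measurable_funeM.
    - move=> u _; under eq_bigr do rewrite -EFinM.
      rewrite sumEFin -EFinM lee_fin mulrAC.
      by apply: (dyadic_jump_sin_le nu2 N (F u) _ pK inup); lra.
  rewrite ge0_integralZl//; last first.
    by rewrite lee_fin mulr_ge0.
  by rewrite [leRHS]EFinM lee_wpmul2l// lee_fin mulr_ge0.
have mXp : measurable_fun setT (fun x => `|X x| `^ p).
  by apply: measurable_norm_powR.
(* By [dyadic_sin_ge] the minimum is eventually equal to its first argument at every point, while
   its mean is bounded through the second. *)
have Hc : (\int[P]_x (c0 * `|X x| `^ p)%:E <= (K0 * w)%:E)%E.
  apply: (@fatou_ae_le _ _ _ P setT
    (fun N x => (Num.min (c0 * `|X x| `^ p) (dyadic_sin p K N (X x)))%:E) _ _ 0%N) => //.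
  - move=> N; apply/measurable_EFinP; apply: measurable_minr.
      by apply: measurable_funM => //.
    by have [] := bdy N.
  - move=> N x _; rewrite lee_fin le_min dyadic_sin_ge0 andbT.
    by rewrite mulr_ge0 ?powR_ge0// ltW.
  - by apply/measurable_EFinP; exact: measurable_funM.
  - by move=> x _; rewrite lee_fin mulr_ge0 ?powR_ge0// ltW.
  - apply: aeW => x _; have [N0 HN0] := dyadic_sin_ge K (X x) p0.
    apply: cvg_near_cst; exists N0 => // N /= N0N.
    by rewrite (min_idPl _)//; exact: HN0.
  - move=> N _; apply: (@le_trans _ _ (\int[P]_x (dyadic_sin p K N (X x))%:E)%E).
      apply: ge0_le_integral => //.
      + move=> x _; rewrite lee_fin le_min dyadic_sin_ge0 andbT.
        by rewrite mulr_ge0 ?powR_ge0// ltW.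
      + apply/measurable_EFinP; apply: measurable_minr.
          by apply: measurable_funM => //.
        by have [] := bdy N.
      + by apply/measurable_EFinP; have [] := bdy N.
      + by move=> x _; rewrite lee_fin ge_min lexx orbT.
    by rewrite -EFin_Rintegral_bounded// lee_fin Edy.
move: Hc; under eq_integral do rewrite EFinM.
rewrite ge0_integralZl//; last 2 first.
- exact/measurable_EFinP.
- by rewrite lee_fin ltW.
rewrite -lee_pdivlMl// -EFinM => /le_trans; apply.
by rewrite lee_fin mulrA [c0^-1 * _]mulrC.
Qed.

(** * Kernel estimates *)

(** The integrand may blow up at both ends, so the fundamental theorem is applied on compact
    subintervals and Fatou exhausts the open one. *)
Lemma itv_FTC_le (R : realType) (f F : R -> R) (x y M : R) :
  x < y -> (forall u, x < u -> u < y -> 0 <= f u) ->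
  measurable_fun `]x, y[ f ->
  {in `]x, y[, continuous f} -> {in `]x, y[, forall u : R, is_derive u 1 F (f u)} ->
  (forall u v, x < u -> u < v -> v < y -> F v - F u <= M) ->
  (\int[lebesgue_measure]_(u in `]x, y[) (f u)%:E <= M%:E)%E.
Proof.
move=> xy f0 mf cf dF FM.
(* At most a third of the length, so that the trimmed interval is never degenerate. *)
pose e n : R := (y - x) / n.+3%:R.
have e0 n : 0 < e n by rewrite divr_gt0// subr_gt0.
have e2 n : x + e n < y - e n.
  have : e n *+ 3 <= y - x.
    rewrite -[e n *+ 3]mulr_natr mulrAC ler_pdivrMr// ler_pM2l ?subr_gt0//.
    by rewrite ler_nat.
  by have := e0 n; lra.
pose I n : set R := `[x + e n, y - e n]%classic.
apply: (@fatou_ae_le _ (measurableTypeR R) R lebesgue_measure `]x, y[%classic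
  (fun n => (EFin \o f) \_ (I n)) (EFin \o f) _ 0%N) => //.
- move=> n; apply/measurable_restrict => //; first exact: measurable_itv.
  by apply/measurable_EFinP; apply: measurable_funS mf => //; exact: subIsetl.
- move=> n u; rewrite /= in_itv/= => /andP[xu uy]; rewrite patchE; case: ifP => // _.
  by rewrite lee_fin f0.
- exact/measurable_EFinP.
- by move=> u; rewrite /= in_itv/= => /andP[xu uy]; rewrite lee_fin f0.
- apply: aeW => u; rewrite /= in_itv/= => /andP[xu uy].
  pose r := Num.min (u - x) (y - u).
  have r0 : 0 < r by rewrite lt_min !subr_gt0 xu.
  apply: cvg_near_cst; near=> n.
  rewrite patchE mem_set//= /I/= in_itv/=.
  have er : e n <= r.
    rewrite /e ler_pdivrMr// -ler_pdivrMl// mulrC.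
    apply: (@le_trans _ _ n%:R); last by rewrite ler_nat -addn3 leq_addr.
    by near: n; exact: nbhs_infty_ger.
  by move: er; rewrite le_min => /andP[h1 h2]; apply/andP; split; lra.
move=> n _.
rewrite -integral_mkcondr (_ : `]x, y[ `&` I n = I n); last first.
  apply/seteqP; split=> [u []//|u Iu]; split => //; move: Iu; rewrite /I/= !in_itv/=.
  by move=> /andP[h1 h2]; have h3 := e0 n; apply/andP; split; lra.
have sub u : u \in `[x + e n, y - e n] -> u \in `]x, y[.
  rewrite !in_itv/=.
  by move=> /andP[h1 h2]; have h3 := e0 n; apply/andP; split; lra.
have cF u : u \in `[x + e n, y - e n] -> {for u, continuous F}.
  move=> /sub uI; apply: differentiable_continuous; apply/derivable1_diffP.
  by have [] := dF u uI.
rewrite /= (@continuous_FTC2 _ f F)//.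
- rewrite -EFinB lee_fin; apply: FM => //; have := e0 n; lra.
- apply: continuous_in_subspaceT => u; rewrite inE => /sub; exact: cf.
- split.
  + by move=> u /subset_itv_oo_cc/sub uI; have [] := dF u uI.
  + apply: cvg_at_right_filter; apply: cF; by rewrite in_itv/= lexx ltW.
  + apply: cvg_at_left_filter; apply: cF; by rewrite in_itv/= lexx ltW.
- move=> u /subset_itv_oo_cc/sub uI; rewrite derive1E.
  by case: (dF u uI).
Unshelve. all: by end_near. Qed.

Lemma is_derive_powR (R : realType) (q u : R) : 0 < u ->
  is_derive u 1 (@powR R ^~ q) (q * u `^ (q - 1)).
Proof.
move=> u0; have uI : u \in `]0, +oo[ by rewrite in_itv/= u0.
split; first exact: derivable_powR.
by rewrite -derive1E powR_derive1.
Qed.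

Lemma is_derive_powR_div (R : realType) (q u : R) : -1 < q -> 0 < u ->
  is_derive u 1 (fun v => v `^ (q + 1) / (q + 1)) (u `^ q).
Proof.
move=> q1 u0; have q0 : q + 1 != 0 by rewrite gt_eqF//; lra.
have := is_derive_powR (q + 1) u0; rewrite addrK => dp.
have -> : (fun v => v `^ (q + 1) / (q + 1)) = (q + 1)^-1 \*: (@powR R ^~ (q + 1)).
  by apply/funext => v /=; rewrite mulrC.
by apply: is_derive_eq; rewrite /GRing.scale/= mulKf.
Qed.

Lemma continuous_powR_pos (R : realType) (q u : R) : 0 < u -> {for u, continuous (@powR R ^~ q)}.
Proof.
move=> u0; apply: differentiable_continuous; apply/derivable1_diffP.
by have [] := is_derive_powR q u0.
Qed.

Lemma integral_powR_le (R : realType) (q t : R) : -1 < q -> 0 < t ->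
  (\int[lebesgue_measure]_(u in `]0%R, t[) (u `^ q)%:E <=
   (t `^ (q + 1) / (q + 1))%:E)%E.
Proof.
move=> q1 t0; have q0 : 0 < q + 1 by lra.
apply: (@itv_FTC_le _ _ (fun v => v `^ (q + 1) / (q + 1))) => //.
- by move=> u _ _; exact: powR_ge0.
- exact: measurable_funTS (measurable_powR q).
- by move=> u; rewrite in_itv/= => /andP[u0 _]; exact: continuous_powR_pos.
- by move=> u; rewrite in_itv/= => /andP[u0 _]; exact: is_derive_powR_div.
- move=> u v u0 uv vt.
  rewrite lerBlDr; apply: ler_wpDr.
    by rewrite divr_ge0 ?powR_ge0// ltW.
  rewrite ler_pM2r ?invr_gt0//; apply: ge0_ler_powR; rewrite ?nnegrE//; try lra.
Qed.

Lemma integral_powR_sub_le (R : realType) (q s t : R) : -1 < q -> s < t ->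
  (\int[lebesgue_measure]_(u in `]s, t[) ((t - u) `^ q)%:E <=
   ((t - s) `^ (q + 1) / (q + 1))%:E)%E.
Proof.
move=> q1 st; have q0 : 0 < q + 1 by lra.
have dsub (u : R) : is_derive u 1 (fun v => t - v) (-1).
  have : is_derive u 1 (cst t - id) (0 - 1) by exact: is_deriveB.
  by rewrite sub0r.
apply: (@itv_FTC_le _ _ (fun v => - ((t - v) `^ (q + 1) / (q + 1)))) => //.
- by move=> u _ _; exact: powR_ge0.
- apply: measurable_funTS; apply: (measurableT_comp (measurable_powR q)).
  exact: measurable_funB.
- move=> u; rewrite in_itv/= => /andP[_ ut].
  apply: (@continuous_comp _ _ _ (fun v => t - v) (@powR R ^~ q)).
    by apply: differentiable_continuous; apply/derivable1_diffP; have [] := dsub u.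
  by apply: continuous_powR_pos; rewrite subr_gt0.
- move=> u; rewrite in_itv/= => /andP[_ ut].
  have tu : 0 < t - u by rewrite subr_gt0.
  have := @is_derive1_comp _ (fun v => v `^ (q + 1) / (q + 1)) (fun v => t - v) u _ _
    (is_derive_powR_div q1 tu) (dsub u).
  move=> dc; have : is_derive u 1 (- ((fun v => v `^ (q + 1) / (q + 1)) \o (fun v => t - v)))
    (- ((t - u) `^ q * -1)) by exact: is_deriveN.
  by rewrite mulrN1 opprK.
- move=> u v su uv vt; rewrite opprK addrC lerBlDr; apply: ler_wpDr.
    by rewrite divr_ge0 ?powR_ge0// ltW.
  rewrite ler_pM2r ?invr_gt0//; apply: ge0_ler_powR; rewrite ?nnegrE//; try lra.
Qed.

Lemma powR_ratio_le (R : realType) (b u t : R) : t / 2 <= u -> 0 < u -> u <= t ->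
  u `^ b <= 2 `^ `|b| * t `^ b.
Proof.
move=> tu u0 ut; have t0 : 0 < t by lra.
have [b0|b0] := leP 0 b.
  apply: (@le_trans _ _ (t `^ b)).
    by apply: ge0_ler_powR; rewrite ?nnegrE//; exact: ltW.
  rewrite ler_peMl ?powR_ge0// -[leLHS](powRr0 (2 : R)).
  by apply: ler_powR => //; rewrite ler1n.
rewrite ltr0_norm// -{1 3}[b]opprK (powRN u) (powRN t).
rewrite -[leLHS]mul1r ler_pdivrMr ?powR_gt0// mulrAC ler_pdivlMr ?powR_gt0// mul1r.
rewrite -powRM ?(ltW u0)//.
by apply: ge0_ler_powR; rewrite ?nnegrE; lra.
Qed.

(** Split at u = t/2. Above it u^b is comparable to t^b, leaving t^(a+b) (t-u)^c. Below it t - u is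
    comparable to t, leaving t^(a+c) u^b, and this zone meets ]s, t[ only if t <= 2 (t - s), so
    powers of t can be exchanged for powers of t - s. The sign of a + b decides whether t^(a+b) is
    bounded by (t-s)^(a+b) or by a constant, whence the two cases of the exponent. *)
Lemma powR_kernel_le (R : realType) (T a b c : R) :
  0 < T -> -1 < b -> -1 < c -> -1 < a + b + c ->
  exists2 K : R, 0 <= K & forall s t, 0 <= s -> s < t -> t <= T ->
  (\int[lebesgue_measure]_(u in `]s, t[) (t `^ a * u `^ b * (t - u) `^ c)%:E <=
   (K * (t - s) `^ ((if (a + b < 0)%R then a + b + c else c) + 1))%:E)%E.
Proof.
move=> T0 b1 c1 abc1.
have b0 : 0 < b + 1 by lra.
have c0 : 0 < c + 1 by lra.
pose M := 2 `^ `|b|; pose N := 2 `^ `|c|.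
have M0 : 0 <= M by exact: powR_ge0.
have N0 : 0 <= N by exact: powR_ge0.
(* The cost of replacing t^(a+b): none if it decreases in t, the value at T if it does not. *)
pose S := if a + b < 0 then 1 else T `^ (a + b).
have S0 : 0 <= S by rewrite /S; case: ifP => // _; exact: powR_ge0.
set k := if a + b < 0 then a + b + c else c.
have powD (x y z : R) : 0 < x -> x `^ (y + z) = x `^ y * x `^ z.
  by move=> x0; rewrite powRD// (gt_eqF x0) implybT.
have bound1 (x t : R) : 0 < x -> x <= t -> t <= T ->
    t `^ (a + b) * x `^ (c + 1) <= S * x `^ (k + 1).
  move=> x0 xt tT; rewrite /S /k; case: ltP => ab.
    have -> : a + b + c + 1 = (a + b) + (c + 1) by ring.
    rewrite mul1r [leRHS]powD// ler_pM2r ?powR_gt0//.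
    rewrite -[a + b]opprK 2!(powRN _ (- (a + b))) lef_pV2 ?posrE ?powR_gt0 ?(lt_le_trans x0)//.
    by apply: ge0_ler_powR; rewrite ?nnegrE//; lra.
  rewrite ler_pM2r ?powR_gt0//.
  by apply: ge0_ler_powR; rewrite ?nnegrE//; lra.
pose Q := 2 `^ (a + b + c + 1).
have Q0 : 0 <= Q by exact: powR_ge0.
have bound2 (x t : R) : 0 < x -> x <= t -> t <= T -> t <= 2 * x ->
    t `^ (a + b + c + 1) <= Q * S * x `^ (k + 1).
  move=> x0 xt tT tx.
  apply: (@le_trans _ _ ((2 * x) `^ (a + b + c + 1))).
    by apply: ge0_ler_powR; rewrite ?nnegrE; lra.
  rewrite powRM ?(ltW x0)// -/Q -mulrA ler_wpM2l//.
  have -> : a + b + c + 1 = (a + b) + (c + 1) by ring.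
  by rewrite powD//; apply: bound1 => //; lra.
exists (M * S / (c + 1) + N * (Q * S) / (b + 1)).
  by apply: addr_ge0; rewrite divr_ge0 ?(ltW b0) ?(ltW c0)// !mulr_ge0.
move=> s t s0 st tT; have t0 : 0 < t by lra.
have ts : 0 < t - s by rewrite subr_gt0.
pose B1 u := (M * t `^ (a + b)) * (t - u) `^ c.
(* Records whether the lower zone can meet ]s, t[ at all; without it the second term would not be
   small when s is close to t. *)
pose ind : R := if t <= 2 * (t - s) then 1 else 0.
pose B2 u := (ind * (N * t `^ (a + c))) * u `^ b.
have ind0 : 0 <= ind by rewrite /ind; case: ifP.
have B10 u : 0 <= B1 u by rewrite !mulr_ge0 ?powR_ge0.
have B20 u : 0 <= B2 u by rewrite !mulr_ge0 ?powR_ge0.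
have mI : measurable (`]s, t[%classic : set (measurableTypeR R)) by exact: measurable_itv.
have mc : measurable_fun setT (fun u : R => (t - u) `^ c).
  apply: (measurableT_comp (measurable_powR c)); exact: measurable_funB.
have mB1 : measurable_fun setT B1 by exact: measurable_funM.
have mB2 : measurable_fun setT B2.
  by apply: measurable_funM => //; exact: measurable_powR.
apply: (@le_trans _ _ (\int[lebesgue_measure]_(u in `]s, t[) ((B1 u)%:E + (B2 u)%:E))%E).
  apply: ge0_le_integral => //.
  - by move=> u _; rewrite lee_fin !mulr_ge0 ?powR_ge0.
  - apply/measurable_EFinP; apply: measurable_funTS; apply: measurable_funM => //.
    by apply: measurable_funM => //; exact: measurable_powR.
  - by apply: emeasurable_funD; apply/measurable_EFinP; exact: measurable_funTS.
  move=> u; rewrite /= in_itv/= => /andP[su ut]; rewrite -EFinD lee_fin.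
  have u0 : 0 < u by lra.
  have [tu|tu] := leP (t / 2) u.
    apply: ler_wpDr => //; rewrite /B1 ler_pM2r ?powR_gt0 ?subr_gt0// powD//.
    by rewrite [leRHS]mulrCA ler_pM2l ?powR_gt0//; apply: powR_ratio_le => //; exact: ltW.
  apply: ler_wpDl => //; rewrite /B2 /ind ifT; last by lra.
  rewrite mul1r [t `^ (a + c)]powD// mulrAC ler_pM2r ?powR_gt0//.
  by rewrite [leRHS]mulrCA ler_pM2l ?powR_gt0//; apply: powR_ratio_le => //; lra.
rewrite ge0_integralD//; last 4 first.
- by move=> u _; rewrite lee_fin.
- by apply/measurable_EFinP; exact: measurable_funTS.
- by move=> u _; rewrite lee_fin.
- by apply/measurable_EFinP; exact: measurable_funTS.
rewrite mulrDl EFinD; apply: leeD.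
  rewrite /B1; under eq_integral do rewrite EFinM.
  rewrite ge0_integralZl//; last 3 first.
  - by apply/measurable_EFinP; exact: measurable_funTS.
  - by move=> u _; rewrite lee_fin powR_ge0.
  - by rewrite lee_fin mulr_ge0 ?powR_ge0.
  apply: (@le_trans _ _ ((M * t `^ (a + b))%:E * ((t - s) `^ (c + 1) / (c + 1))%:E)%E).
    by rewrite lee_wpmul2l ?lee_fin ?mulr_ge0 ?powR_ge0//; exact: integral_powR_sub_le.
  rewrite -EFinM lee_fin.
  rewrite (_ : _ * (_ / _) = M / (c + 1) * (t `^ (a + b) * (t - s) `^ (c + 1))); last by ring.
  rewrite [leRHS](_ : _ = M / (c + 1) * (S * (t - s) `^ (k + 1))); last by ring.
  by rewrite ler_wpM2l// ?divr_ge0 ?(ltW c0)//; apply: bound1 => //; lra.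
apply: (@le_trans _ _ (\int[lebesgue_measure]_(u in `]0%R, t[) (B2 u)%:E)%E).
  apply: ge0_subset_integral => //.
  - by apply/measurable_EFinP; exact: measurable_funTS.
  - by move=> u _; rewrite lee_fin.
  - by apply: subset_itv; rewrite bnd_simp.
rewrite /B2; under eq_integral do rewrite EFinM.
rewrite ge0_integralZl//; last 3 first.
- by apply/measurable_EFinP; apply: measurable_funTS; exact: measurable_powR.
- by move=> u _; rewrite lee_fin powR_ge0.
- by rewrite lee_fin !mulr_ge0 ?powR_ge0.
apply: (@le_trans _ _ ((ind * (N * t `^ (a + c)))%:E * (t `^ (b + 1) / (b + 1))%:E)%E).
  by rewrite lee_wpmul2l ?lee_fin ?mulr_ge0 ?powR_ge0//; exact: integral_powR_le.
rewrite -EFinM lee_fin.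
have -> : ind * (N * t `^ (a + c)) * (t `^ (b + 1) / (b + 1)) =
    N / (b + 1) * (ind * t `^ (a + b + c + 1)).
  rewrite (_ : a + b + c + 1 = (a + c) + (b + 1)); last by ring.
  by rewrite [t `^ (a + c + _)]powD//; ring.
rewrite [leRHS](_ : _ = N / (b + 1) * (Q * S * (t - s) `^ (k + 1))); last by ring.
rewrite ler_wpM2l// ?divr_ge0 ?(ltW b0)//.
rewrite /ind; case: ifP => h; last by rewrite mul0r; apply: mulr_ge0; [exact: mulr_ge0|exact: powR_ge0].
by rewrite mul1r; apply: bound2 => //; lra.
Qed.

(** The integrand of Y_t - Y_s on the common domain ]0, T]. The intervals are open on the right
    because the kernel is controlled only for u < t; this changes it at two points at most. *)
Definition kernel_diff (R : realType) (g : R -> R -> R) (s t : R) : R -> R :=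
  (g t \_ `]0, t[) \- (g s \_ `]0, s[).

Definition measurable_kernel (R : realType) (g : R -> R -> R) (T : R) :=
  measurable_fun [set x : R * R | 0 < x.2 /\ x.2 < x.1 /\ x.1 <= T]
    (fun x : R * R => g x.1 x.2).

Lemma measurable_kernel_diff (R : realType) (T : R) (g : R -> R -> R) (s t : R) :
  measurable_kernel g T -> s <= T -> t <= T ->
  measurable_fun setT (kernel_diff g s t : measurableTypeR R -> measurableTypeR R).
Proof.
move=> hg sT tT.
suff mg r : r <= T -> measurable_fun (`]0, r[ : set R) (g r).
  apply: measurable_funB; apply/(measurable_restrictT _ _).1;
    by [exact: measurable_itv|exact: mg].
move=> rT; pose D := [set x : R * R | 0 < x.2 /\ x.2 < x.1 /\ x.1 <= T].
have mD : measurable D.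
  have -> : D = (fun x : R * R => (0 < x.2) && ((x.2 < x.1) && (x.1 <= T))) @^-1` [set true].
    by apply/seteqP; split=> x /=; [move=> [-> [-> ->]]|move=> /and3P[]].
  rewrite -[X in measurable X]setTI.
  suff : measurable_fun setT (fun x : R * R => (0 < x.2) && ((x.2 < x.1) && (x.1 <= T))).
    by apply.
  apply: measurable_and; first exact: measurable_fun_ltr.
  by apply: measurable_and; [exact: measurable_fun_ltr|exact: measurable_fun_ler].
apply: (@measurable_comp _ _ _ _ _ _ D (fun x : R * R => g x.1 x.2) `]0, r[ (pair r)) => //.
  by move=> _ [u + <-]; rewrite /= in_itv/= => /andP[].
apply: measurable_funTS; exact: pair1_measurable.
Qed.

Definition kernel_bound (R : realType) (g : R -> R -> R) (T alpha beta gamma : R) :=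
  exists C : R, forall t u : R, 0 < u -> u < t -> t <= T ->
    `|g t u| <= C * t `^ alpha * u `^ beta * (t - u) `^ gamma.

Definition kernel_increment_bound (R : realType) (g : R -> R -> R) (T p delta : R) :=
  exists h : R -> R -> R -> R,
    [/\ forall t s : R, 0 < s -> s < t -> t <= T ->
          measurable_fun (`]0, s[ : set R) (h t s),
        forall t s u : R, 0 < u -> u < s -> s < t -> t <= T ->
          `|g t u - g s u| <= `|t - s| `^ delta * h t s u &
        (ereal_sup [set I : \bar R | exists s t : R,
           [/\ (0 < s)%R, (s < t)%R, (t <= T)%R &
             I = \int[lebesgue_measure]_(u in `]0%R, s[)
                   (`|h t s u| `^ p)%:E]] < +oo)%E].

Lemma powR_le_exponent (R : realType) (T x m n : R) : 0 < x -> x <= T -> m <= n ->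
  x `^ n <= T `^ (n - m) * x `^ m.
Proof.
move=> x0 xT mn; have -> : x `^ n = x `^ (n - m) * x `^ m.
  by rewrite -powRD ?subrK// (gt_eqF x0) implybT.
rewrite ler_pM2r ?powR_gt0//; apply: ge0_ler_powR; rewrite ?nnegrE; lra.
Qed.

(** On u < s the increment condition gives the exponent delta p; on s <= u < t only g (t, u) remains
    and [powR_kernel_le] with all exponents multiplied by p gives kappa p + 1. Both are lowered to
    the minimum at the cost of a power of T. *)
Lemma kernel_diff_moment_le (R : realType) (T p alpha beta gamma delta kappa : R)
    (g : R -> R -> R) : 0 < T ->
  measurable_kernel g T ->
  0 < p -> - p^-1 < beta -> - p^-1 < gamma -> - p^-1 < alpha + beta + gamma ->
  kernel_bound g T alpha beta gamma -> kernel_increment_bound g T p delta ->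
  kappa = (if alpha + beta < 0 then alpha + beta + gamma else gamma) ->
  exists2 K : R, 0 < K & forall s t, 0 <= s -> s < t -> t <= T ->
    (\int[lebesgue_measure]_(u in `]0%R, T]) (`|kernel_diff g s t u| `^ p)%:E <=
     (K * (t - s) `^ Num.min (kappa * p + 1) (delta * p))%:E)%E.
Proof.
move=> T0 mg p0 hb hc habc [C B1] [h [mh B2 supfin]] hk.
have pb x : - p^-1 < x -> -1 < x * p.
  by rewrite -ltr_pdivrMr// mulN1r.
have abc1 : -1 < alpha * p + beta * p + gamma * p by rewrite -!mulrDl pb.
have [K K0 HK] := powR_kernel_le T0 (pb _ hb) (pb _ hc) abc1.
pose m := Num.min (kappa * p + 1) (delta * p).
(* Multiplying by p > 0 preserves the case distinction defining [kappa]. *)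
have kE : (if alpha * p + beta * p < 0 then alpha * p + beta * p + gamma * p else gamma * p) + 1
    = kappa * p + 1.
  rewrite hk -!mulrDl pmulr_llt0//; by case: ifP.
set S := ereal_sup _ in supfin.
have HS s t : 0 < s -> s < t -> t <= T -> (\int[lebesgue_measure]_(u in `]0%R, s[)
                    (`|h t s u| `^ p)%:E <= S)%E.
  by move=> s0 st tT; apply: ereal_sup_ubound; exists s, t.
(* The supremum ranges over a nonempty set, as the pair T/2 < T shows; so finiteness from above
   makes it a real number. *)
have S0 : (0 <= S)%E.
  have T20 : 0 < T / 2 by lra.
  have T2T : T / 2 < T by lra.
  apply: le_trans (HS _ _ T20 T2T (lexx T)).
  by apply: integral_ge0 => u _; rewrite lee_fin powR_ge0.
have SE : S = (fine S)%:E by rewrite fineK// ge0_fin_numE.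
pose CC := `|C|; have CC0 : 0 <= CC by exact: normr_ge0.
pose K1 := CC `^ p * K; pose K2 := fine S.
have K10 : 0 <= K1 by rewrite mulr_ge0 ?powR_ge0.
have K20 : 0 <= K2 by exact: fine_ge0.
pose Q1 := K1 * T `^ (kappa * p + 1 - m); pose Q2 := K2 * T `^ (delta * p - m).
have Q10 : 0 <= Q1 by rewrite mulr_ge0 ?powR_ge0.
have Q20 : 0 <= Q2 by rewrite mulr_ge0 ?powR_ge0.
(* The added 1 makes the constant positive: the moment bound is later applied to a strictly positive
   w. *)
exists (Q1 + Q2 + 1) => [|s t s0 st tT]; first by lra.
have ts : 0 < t - s by rewrite subr_gt0.
have mD := measurable_kernel_diff mg (ltW (lt_le_trans st tT)) tT.
pose d := (t - s) `^ (delta * p).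
have d0 : 0 <= d by exact: powR_ge0.
pose hp u := `|h t s u| `^ p.
pose kn u := t `^ (alpha * p) * u `^ (beta * p) * (t - u) `^ (gamma * p).
have kn0 u : 0 <= kn u by rewrite !mulr_ge0 ?powR_ge0.
pose f1 u := (d%:E * (hp u)%:E)%E.
pose f2 u := ((CC `^ p)%:E * (kn u)%:E)%E.
have f10 u : (0 <= f1 u)%E by rewrite /f1 -EFinM lee_fin mulr_ge0 ?powR_ge0.
have f20 u : (0 <= f2 u)%E by rewrite /f2 -EFinM lee_fin mulr_ge0 ?powR_ge0.
pose I := (`]0, T]%classic : set (measurableTypeR R)).
pose I1 := (`]0, s[%classic : set (measurableTypeR R)).
pose I2 := (`[s, t[%classic : set (measurableTypeR R)).
have mI : measurable I by exact: measurable_itv.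
have mI1 : measurable I1 by exact: measurable_itv.
have mI2 : measurable I2 by exact: measurable_itv.
have mhp : measurable_fun I1 hp.
  (* For s = 0 the increment condition says nothing, but ]0, s[ is empty. *)
  apply: measurable_norm_powR; have [s1|s1] := ltP 0 s; first exact: mh.
  by rewrite /I1 set_itv_ge ?bnd_simp -?leNgt//; exact: measurable_fun_set0.
have mf1 : measurable_fun I1 f1 by apply: measurable_funeM; exact/measurable_EFinP.
have mkn : measurable_fun setT kn.
  apply: measurable_funM; first by apply: measurable_funM => //; exact: measurable_powR.
  by apply: (measurableT_comp (measurable_powR _)); exact: measurable_funB.
have mf2 : measurable_fun setT f2 by apply: measurable_funeM; exact/measurable_EFinP.
have II1 : I `&` I1 = I1.
  apply/seteqP; split=> [u []//|u]; rewrite /I /I1/= !in_itv/= => /andP[u0 us].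
  by split; apply/andP; split => //; lra.
have mg1 : measurable_fun I (f1 \_ I1) by apply/measurable_restrict => //; rewrite II1.
have mg2 : measurable_fun I (f2 \_ I2).
  by apply/measurable_restrict => //; exact: measurable_funTS.
apply: (@le_trans _ _ (\int[lebesgue_measure]_(u in I) ((f1 \_ I1) u + (f2 \_ I2) u))%E).
  apply: ge0_le_integral => //.
  - apply/measurable_EFinP; apply: measurable_norm_powR; exact: measurable_funTS.
  - exact: emeasurable_funD.
  move=> u; rewrite /I/= in_itv/= => /andP[u0 uT]; rewrite /kernel_diff/= !patchE.
  have iE (a b : R) : (u \in (`]a, b[%classic : set R)) = (a < u) && (u < b).
    by rewrite mem_setE in_itv.
  have -> : (u \in I2) = (s <= u) && (u < t) by rewrite mem_setE in_itv.
  rewrite !iE u0/=; have [us|us] := ltP u s.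
    have ut : u < t by lra.
    rewrite ut/= adde0 /f1 -EFinM lee_fin /hp /d powRrM -powRM ?powR_ge0//.
    apply: ge0_ler_powR; rewrite ?nnegrE ?mulr_ge0 ?powR_ge0 ?(ltW p0)//.
    apply: (le_trans (B2 t s u u0 us st tT)); rewrite gtr0_norm//.
    by rewrite ler_wpM2l ?powR_ge0// ler_norm.
  rewrite subr0 add0e; have [ut|ut] := ltP u t; last by rewrite normr0 powR0 ?gt_eqF.
  rewrite /f2 -EFinM lee_fin /kn !powRrM.
  rewrite -!powRM ?mulr_ge0 ?powR_ge0//.
  apply: ge0_ler_powR; rewrite ?nnegrE ?mulr_ge0 ?powR_ge0 ?(ltW p0)//.
  apply: (le_trans (B1 t u u0 ut tT)); rewrite !mulrA.
  by rewrite !ler_wpM2r ?powR_ge0// ler_norm.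
rewrite ge0_integralD//; last 2 first.
- by move=> u _; rewrite patchE; case: ifP.
- by move=> u _; rewrite patchE; case: ifP.
rewrite -!integral_mkcondr II1.
apply: (@le_trans _ _ (((Q2 + Q1) * (t - s) `^ m)%:E)); last first.
  by rewrite lee_fin ler_pM2r ?powR_gt0//; lra.
rewrite mulrDl EFinD; apply: leeD.
  rewrite /f1 ge0_integralZl//; last 2 first.
  - exact/measurable_EFinP.
  - by move=> u _; rewrite lee_fin powR_ge0.
  have le1 : (\int[lebesgue_measure]_(u in I1) (hp u)%:E <= K2%:E)%E.
    have [s1|s1] := ltP 0 s; first by rewrite /K2 -SE; exact: HS.
    by rewrite /I1 set_itv_ge ?bnd_simp -?leNgt// integral_set0 lee_fin.
  apply: (@le_trans _ _ (d%:E * K2%:E)%E); first by rewrite lee_wpmul2l.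
  rewrite -EFinM lee_fin mulrC /Q2 -mulrA ler_wpM2l//.
  by apply: powR_le_exponent; rewrite ?ge_min ?lexx ?orbT//; lra.
apply: (@le_trans _ _ (\int[lebesgue_measure]_(u in I2) f2 u)%E).
  apply: ge0_subset_integral => //; [exact: measurableI|exact: measurable_funTS].
rewrite /I2 -integral_itv_obnd_cbnd; last exact: measurable_funTS.
rewrite ge0_integralZl//; last 3 first.
- by apply/measurable_EFinP; exact: measurable_funTS.
- by move=> u _; rewrite lee_fin.
- by rewrite lee_fin powR_ge0.
have := HK s t s0 st tT; rewrite kE => HKst.
apply: (@le_trans _ _ ((CC `^ p)%:E * (K * (t - s) `^ (kappa * p + 1))%:E)%E).
  by rewrite lee_wpmul2l// lee_fin powR_ge0.
rewrite -EFinM lee_fin mulrA -/K1 [leRHS](_ : _ = K1 * (T `^ (kappa * p + 1 - m) * (t - s) `^ m)).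
  apply: ler_wpM2l => //.
  by apply: powR_le_exponent; rewrite ?ge_min ?lexx ?orbT//; lra.
by rewrite /Q1 mulrA.
Qed.

(** * Increments of the process as single stochastic integrals *)

Section increments.
Context d (Omega : measurableType d) (R : realType) (P : probability Omega R).

Lemma cvg_in_probabilityB (X X' W : nat -> Omega -> R) (Y Y' : Omega -> R) :
  (forall n, measurable_fun setT (X n)) -> (forall n, measurable_fun setT (X' n)) ->
  (forall n, measurable_fun setT (W n)) -> measurable_fun setT Y -> measurable_fun setT Y' ->
  (forall n, {ae P, forall w, W n w = X n w - X' n w}) ->
  cvg_in_probability P X Y -> cvg_in_probability P X' Y' ->
  cvg_in_probability P W (fun w => Y w - Y' w).
Proof.
move=> mX mX' mW mY mY' HW cX cX' e e0.
have e20 : 0 < e / 2 by rewrite divr_gt0.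
have mev (U V : Omega -> R) (r : R) : measurable_fun setT U -> measurable_fun setT V ->
    measurable [set w | r <= `|U w - V w|].
  move=> mU mV; rewrite -[X in measurable X]setTI.
  have -> : [set w | r <= `|U w - V w|] = (fun w => `|U w - V w|) @^-1` `[r, +oo[.
    by apply/seteqP; split=> w /=; rewrite in_itv/= andbT.
  by apply: measurableT_comp => //; exact: measurable_funB.
pose E1 n := [set w | e / 2 <= `|X n w - Y w|].
pose E2 n := [set w | e / 2 <= `|X' n w - Y' w|].
apply: (@squeeze_cvge _ _ _ _ (fun=> 0%E) _ (fun n => P (E1 n) + P (E2 n))%E).
- apply: nearW => n; rewrite measure_ge0/=.
  have [N [mN N0 subN]] := HW n.
  have mE1 : measurable (E1 n) by exact: mev.
  have mE2 : measurable (E2 n) by exact: mev.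
  apply: (@le_trans _ _ (P (N `|` (E1 n `|` E2 n)))).
    apply: le_measure; rewrite ?inE.
    + by apply: mev => //; exact: measurable_funB.
    + by do 2 (apply: measurableU => //).
    move=> w /= ew; have [Nw|Nw] := pselect (N w); [by left|right].
    have WE : W n w = X n w - X' n w by apply: contrapT => H; apply: Nw; exact: subN.
    move: ew; rewrite WE; have [|h1] := leP (e / 2) `|X n w - Y w|; first by left.
    have [|h2] := leP (e / 2) `|X' n w - Y' w|; first by right.
    have -> : X n w - X' n w - (Y w - Y' w) = (X n w - Y w) - (X' n w - Y' w) by ring.
    by have := ler_normB (X n w - Y w) (X' n w - Y' w); lra.
  apply: (le_trans (measureU2 _ _ _)) => //; first exact: measurableU.
  by rewrite -[leRHS]add0e; apply: leeD; [rewrite -N0|exact: measureU2].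
- exact: cvg_cst.
- rewrite -[0%E]adde0; apply: cvgeD => //; [exact: cX|exact: cX'].
Qed.

Lemma sfun_restrict (f : {sfun measurableTypeR R >-> R}) (A : set (measurableTypeR R)) :
  measurable A -> exists f' : {sfun measurableTypeR R >-> R}, forall u, f' u = f u * \1_A u.
Proof. by move=> mA; exists (f * indic_sfun A mA). Qed.

(** The two integrals come with unrelated random measures and simple functions. Each sequence is cut
    off by an indicator so that both live on ]0, T], and [lrm_unique] lets one random measure serve
    for both. *)
Lemma levy_integral_kernel_diff (Z : R -> {RV P >-> R}) (s t T : R)
    (g : R -> R -> R) (X X' : {RV P >-> R}) :
  0 <= s -> s <= T -> 0 <= t -> t <= T ->
  levy_integral Z s (g s) X -> levy_integral Z t (g t) X' ->
  exists L (F_ : nat -> {sfun measurableTypeR R >-> R}),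
  [/\ levy_random_measure Z L,
      {ae lebesgue_measure, forall u : R, `]0, T]%classic u ->
           F_ n u @[n --> \oo] --> kernel_diff g s t u} &
      cvg_in_probability P (fun n => simple_integral L (F_ n) `]0, T])
        (fun w => X' w - X w)].
Proof.
move=> s0 sT t0 tT [L [mL [f [fcv _ fX]]]] [L' [mL' [f' [f'cv _ f'X]]]].
pose A r := (`]0, r]%classic : set (measurableTypeR R)).
have mA r : measurable (A r) by exact: measurable_itv.
have bA r : bounded_borel (A r) by split; [exact: mA|exists r].
have AT r : r <= T -> A T `&` A r = A r.
  move=> rT; apply/seteqP; split=> [u []//|u]; rewrite /A/= !in_itv/= => /andP[u0 ur].
  by split; apply/andP; split => //; exact: le_trans rT.
have [fs fsE] := choice (fun n => sfun_restrict (f n) (mA s)).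
have [ft ftE] := choice (fun n => sfun_restrict (f' n) (mA t)).
exists L, (fun n => ft n - fs n); split => //.
  (* The cut-offs use ]0, r] and [kernel_diff] uses ]0, r[; the points s and t have to be
     discarded. *)
  have nullset (r : R) : {ae lebesgue_measure, forall u : R, u <> r}.
    exists [set r]; split; [exact: measurable_set1|exact: lebesgue_measure_set1|].
    by move=> u /= /contrapT.
  have FF : Filter (almost_everywhere (@lebesgue_measure R)) by exact: ae_filter_ringOfSetsType.
  apply: (@filterS3 _ _ FF _ _ _ _ _ (@filterI _ _ FF _ _ (nullset s) (nullset t)) fcv f'cv).
  move=> u [us ut] Hs Ht.
  rewrite /= in_itv/= => /andP[u0 uT]; rewrite /kernel_diff/=.
  have cvr (r : R) (k : nat -> {sfun measurableTypeR R >-> R})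
      (h : nat -> {sfun measurableTypeR R >-> R}) :
      u <> r -> (forall n u, h n u = k n u * \1_(A r) u) ->
      (`]0, r]%classic u -> k n u @[n --> \oo] --> g r u) ->
      h n u @[n --> \oo] --> (g r \_ `]0, r[) u.
    move=> ur hE kcv; rewrite patchE mem_setE in_itv/= u0/=.
    case: ltgtP => [ltur|ltru|//].
    - under eq_fun do rewrite hE indicE mem_setE in_itv/= u0/= (ltW ltur) mulr1.
      by apply: kcv; rewrite /= in_itv/= u0 ltW.
    - under eq_fun do rewrite hE indicE mem_setE in_itv/= u0/= leNgt ltru mulr0.
      exact: cvg_cst.
  by apply: cvgB; [exact: cvr Ht|exact: cvr Hs].
apply: (@cvg_in_probabilityB (fun n => simple_integral L' (f' n) (A t))
   (fun n => simple_integral L (f n) (A s))) => //.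
- by move=> n; exact: (simple_integral_measurable mL' (f' n) (bA t)).
- by move=> n; exact: (simple_integral_measurable mL (f n) (bA s)).
- by move=> n; exact: (simple_integral_measurable mL _ (bA T)).
move=> n.
have H1 : {ae P, forall w, simple_integral L (ft n - fs n) (A T) w =
     simple_integral L (ft n) (A T) w - simple_integral L (fs n) (A T) w}.
  by apply: (simple_integralB mL (bA T)).
have H2 := @simple_integral_setI _ _ _ _ _ _ mL (f' n) (ft n) (A T) (A t) (bA T) (mA t).
have H3 := @simple_integral_setI _ _ _ _ _ _ mL (f n) (fs n) (A T) (A s) (bA T) (mA s).
(* The two random measures agree only almost surely for each set, which suffices for the finitely
   many fibres in question. *)
have H4 : {ae P, forall w, forall x, x \in fset_set (range (f' n)) ->
    L (A t `&` f' n @^-1` [set x]) w = L' (A t `&` f' n @^-1` [set x]) w}.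
  apply: ae_seq => x; apply: (lrm_unique mL mL').
  apply: (bounded_borelS _ _ (bA t)); last exact: subIsetl.
  by apply: measurableI; [exact: mA|exact: measurable_fiber].
rewrite (AT _ tT) in H2; rewrite (AT _ sT) in H3.
have {}H2 : {ae P, forall w, simple_integral L (ft n) (A T) w = simple_integral L (f' n) (A t) w}.
  apply: H2 => u _ Au; rewrite ftE indicE; first by rewrite mem_set// mulr1.
  by rewrite memNset// mulr0.
have {}H3 : {ae P, forall w, simple_integral L (fs n) (A T) w = simple_integral L (f n) (A s) w}.
  apply: H3 => u _ Au; rewrite fsE indicE; first by rewrite mem_set// mulr1.
  by rewrite memNset// mulr0.
apply: filterS3 (filterI H1 H2) H3 H4 => w [-> ->] -> HL; congr (_ - _).
rewrite !simple_integralE big_seq [RHS]big_seq; apply: eq_bigr => x xr.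
by rewrite HL.
Qed.

End increments.

(** * The continuity criterion *)

Definition dyadic_point (R : realType) (T : R) (n k : nat) : R := T * k%:R / 2 ^+ n.

(** For t >= 0 this indexes the last grid point of level n not exceeding t. *)
Definition dyadic_index (R : realType) (T : R) (n : nat) (t : R) : nat :=
  Num.truncn (2 ^+ n * (t / T)).

Lemma dyadic_pointS (R : realType) (T : R) (n k : nat) :
  dyadic_point T n.+1 k.*2 = dyadic_point T n k.
Proof.
rewrite /dyadic_point exprS -muln2 natrM; have : (2 ^+ n : R) != 0 by rewrite expf_neq0.
by move=> ?; field.
Qed.

Lemma dyadic_index_itv (R : realType) (T t : R) (n : nat) : 0 < T -> 0 <= t ->
  (dyadic_index T n t)%:R <= 2 ^+ n * (t / T) < (dyadic_index T n t).+1%:R.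
Proof.
by move=> T0 t0; apply: truncn_itv; rewrite mulr_ge0 ?exprn_ge0// divr_ge0// ltW.
Qed.

Lemma dyadic_index_le (R : realType) (T t : R) (n : nat) : 0 < T -> 0 <= t -> t <= T ->
  (dyadic_index T n t <= 2 ^ n)%N.
Proof.
move=> T0 t0 tT; have /andP[h _] := dyadic_index_itv n T0 t0.
rewrite -(ler_nat R) natrX (le_trans h)// ler_piMr ?exprn_ge0//.
by rewrite ler_pdivrMr// mul1r.
Qed.

(** Refining the grid leaves the approximating point in place or moves it by one fine step, so
    consecutive approximations differ by at most one grid increment. *)
Lemma dyadic_indexS (R : realType) (T t : R) (n : nat) : 0 < T -> 0 <= t ->
  dyadic_index T n.+1 t = (dyadic_index T n t).*2 \/
  dyadic_index T n.+1 t = (dyadic_index T n t).*2.+1.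
Proof.
move=> T0 t0; have /andP[h1 h2] := dyadic_index_itv n T0 t0.
have /andP[h3 h4] := dyadic_index_itv n.+1 T0 t0.
rewrite exprS -mulrA in h3 h4; set x := 2 ^+ n * (t / T) in h1 h2 h3 h4.
set k := dyadic_index T n t in h1 h2 *; set l := dyadic_index T n.+1 t in h3 h4 *.
have : (k.*2 < l.+1)%N.
  by rewrite -(ltr_nat R) (le_lt_trans _ h4)// -muln2 natrM; lra.
have : (l < k.*2.+2)%N.
  rewrite -(ltr_nat R) (le_lt_trans h3)// -doubleS -muln2 natrM; lra.
by rewrite !ltnS leq_eqVlt => /predU1P[->|]; [right|move=> ? ?; left; apply/eqP; rewrite eqn_leq; apply/andP].
Qed.

Lemma dyadic_index_near (R : realType) (T s t : R) (n : nat) : 0 < T -> 0 <= s -> s <= t ->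
  t - s <= T / 2 ^+ n ->
  dyadic_index T n t = dyadic_index T n s \/ dyadic_index T n t = (dyadic_index T n s).+1.
Proof.
move=> T0 s0 st ts; have t0 : 0 <= t by exact: le_trans st.
have /andP[h1 h2] := dyadic_index_itv n T0 s0.
have /andP[h3 h4] := dyadic_index_itv n T0 t0.
have c0 : 0 < 2 ^+ n / T :> R by rewrite divr_gt0 ?exprn_gt0.
have E x : 2 ^+ n * (x / T) = x * (2 ^+ n / T) by rewrite mulrCA.
rewrite !E in h1 h2 h3 h4.
have h5 : s * (2 ^+ n / T) <= t * (2 ^+ n / T) by rewrite ler_pM2r.
have h6 : t * (2 ^+ n / T) <= s * (2 ^+ n / T) + 1.
  rewrite -lerBlDl -mulrBl; apply: (@le_trans _ _ (T / 2 ^+ n * (2 ^+ n / T))).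
    by rewrite ler_pM2r.
  have : (2 ^+ n : R) != 0 by rewrite expf_neq0.
  by move=> ?; rewrite mulrA divfK// divff// gt_eqF.
set k := dyadic_index T n s in h1 h2 *; set l := dyadic_index T n t in h3 h4 *.
have : (k < l.+1)%N by rewrite -(ltr_nat R); lra.
have : (l < k.+2)%N by rewrite -(ltr_nat R) -(natr1 k.+1); lra.
by rewrite !ltnS leq_eqVlt => /predU1P[->|]; [right|move=> ? ?; left; apply/eqP; rewrite eqn_leq; apply/andP].
Qed.

Lemma cvg_geometric_increments (R : realType) (u : nat -> R) (M q : R) :
  0 <= M -> 0 < q -> q < 1 ->
  (forall n, `|u n.+1 - u n| <= M * q ^+ n.+1) ->
  cvgn u /\ forall n, `|limn u - u n| <= M * q / (1 - q) * q ^+ n.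
Proof.
(* c q^n is the geometric tail of the increments beyond n, so both u_n - c q^n and - u_n - c q^n are
   nondecreasing; this gives convergence and the rate at once. *)
move=> M0 q0 q1 uM; pose c := M * q / (1 - q).
have c0 : 0 <= c by rewrite divr_ge0 ?mulr_ge0 ?subr_ge0// ltW.
have cE n : c * q ^+ n - c * q ^+ n.+1 = M * q ^+ n.+1.
  have : 1 - q != 0 by rewrite gt_eqF// subr_gt0.
  by move=> ?; rewrite /c !exprS; field.
have ndl : {homo (fun n => u n - c * q ^+ n) : n m / (n <= m)%N >-> n <= m}.
  apply/nondecreasing_seqP => n; have := uM n; rewrite -cE ler_norml => /andP[]; lra.
have ndr : {homo (fun n => - u n - c * q ^+ n) : n m / (n <= m)%N >-> n <= m}.
  apply/nondecreasing_seqP => n; have := uM n; rewrite -cE ler_norml => /andP[]; lra.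
have cq0 n : 0 <= c * q ^+ n by rewrite mulr_ge0// exprn_ge0// ltW.
have cvu : cvgn u.
  have -> : u = (fun n => u n - c * q ^+ n) \+ geometric c q.
    by apply/funext => n /=; rewrite subrK.
  apply: is_cvgD; last by apply: cvgP; apply: cvg_geometric; rewrite gtr0_norm.
  apply: nondecreasing_is_cvgn => //.
  exists (u 0%N + c) => _ [n _ <-]; have := ndr _ _ (leq0n n); have := cq0 n.
  by rewrite expr0; lra.
split => // n; rewrite ler_norml -/c; apply/andP; split.
  rewrite lerBrDl; apply: limr_ge => //; near=> m.
  have nm : (n <= m)%N by near: m; exact: nbhs_infty_ge.
  by have := ndl _ _ nm; have := cq0 m; lra.
rewrite lerBlDl; apply: limr_le => //; near=> m.
have nm : (n <= m)%N by near: m; exact: nbhs_infty_ge.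
by have := ndr _ _ nm; have := cq0 m; lra.
Unshelve. all: by end_near. Qed.

Lemma powR2N_expr (R : realType) (b : R) (n : nat) : (2 `^ (- b)) ^+ n = (2 ^- n) `^ b.
Proof.
have half : (2^-1 : R) `^ b = 2 `^ (- b) by rewrite -(@powR_inv1 R 2)// -powRrM mulN1r.
elim: n => [|n IH]; first by rewrite !expr0 invr1 powR1.
by rewrite !exprS invfM powRM ?invr_ge0 ?exprn_ge0// half IH.
Qed.

Lemma powR2N_lt1 (R : realType) (x : R) : 0 < x -> 2 `^ (- x) < 1.
Proof.
move=> x0; rewrite powRN invf_lt1 ?powR_gt0// /powR pnatr_eq0/= expR_gt1.
by rewrite mulr_gt0// ln_gt0// ltr1n.
Qed.

(** Regularity of f is assumed on neighbouring grid points only, and the conclusion concerns the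
    limit along the grid, which need not agree with f. *)
Lemma dyadic_chaining (R : realType) (f : R -> R) (T rho M : R) :
  0 < T -> 0 < rho -> 0 <= M ->
  (forall n k, (k < 2 ^ n)%N ->
     `|f (dyadic_point T n k.+1) - f (dyadic_point T n k)| <= M * (2 `^ (- rho)) ^+ n) ->
  (forall t, 0 <= t -> t <= T ->
     cvgn (fun n => f (dyadic_point T n (dyadic_index T n t)))) /\
  hoelder_on `[0, T]%classic rho
    (fun t => limn (fun n => f (dyadic_point T n (dyadic_index T n t)))).
Proof.
move=> T0 rho0 M0 Hf; set q := 2 `^ (- rho) in Hf.
have q0 : 0 < q by rewrite powR_gt0.
have q1 : q < 1 by exact: powR2N_lt1.
pose u t n := f (dyadic_point T n (dyadic_index T n t)).
have uM t : 0 <= t -> t <= T -> forall n, `|u t n.+1 - u t n| <= M * q ^+ n.+1.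
  move=> t0 tT n; have := dyadic_index_le n.+1 T0 t0 tT; rewrite /u.
  have [->|->] := dyadic_indexS n T0 t0.
    by rewrite dyadic_pointS subrr normr0 mulr_ge0// exprn_ge0// ltW.
  by rewrite -(dyadic_pointS T n) => lek; exact: Hf.
have H t (t0 : 0 <= t) (tT : t <= T) := cvg_geometric_increments M0 q0 q1 (uM t t0 tT).
split=> [t t0 tT|]; first by have [] := H t t0 tT.
pose c := M * q / (1 - q).
have c0 : 0 <= c by rewrite divr_ge0 ?mulr_ge0 ?subr_ge0// ltW.
(* Twice c for passing from the limits to the level-n values, M for one grid step, and the power of
   2 / T for expressing 2^-n through t - s. *)
pose K := (c + M + c) * (2 / T) `^ rho.
have main s t : 0 <= s -> s < t -> t <= T ->
    `|limn (u t) - limn (u s)| <= K * (t - s) `^ rho.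
  move=> s0 st tT; have ts : 0 < t - s by rewrite subr_gt0.
  (* The level whose mesh is comparable to t - s: [n1] makes the grid indices of s and t equal or
     adjacent, [n2] converts the rate back. *)
  have [n n1 n2] : exists2 n, t - s <= T / 2 ^+ n & T / 2 ^+ n.+1 < t - s.
    have [N HN] : exists N, T / 2 ^+ N < t - s.
      exists (Num.bound (T / (t - s))); rewrite ltr_pdivrMr ?exprn_gt0//.
      rewrite -ltr_pdivrMl// mulrC.
      apply: (@lt_trans _ _ (Num.bound (T / (t - s)))%:R).
        by apply: archi_boundP; rewrite divr_ge0// ltW.
      by rewrite -natrX ltr_nat ltn_expl.
    elim: N HN => [|N IH]; first by rewrite expr0 divr1; lra.
    by move=> HN; have [h|h] := leP (t - s) (T / 2 ^+ N); [exists N|exact: IH].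
  have h1 := (H t (le_trans s0 (ltW st)) tT).2 n.
  have h2 := (H s s0 (le_trans (ltW st) tT)).2 n.
  have h3 : `|u t n - u s n| <= M * q ^+ n.
    have := dyadic_index_le n T0 (le_trans s0 (ltW st)) tT; rewrite /u.
    have [->|->] := dyadic_index_near T0 s0 (ltW st) n1.
      by rewrite subrr normr0 mulr_ge0// exprn_ge0// ltW.
    exact: Hf.
  have qn : q ^+ n <= (2 / T) `^ rho * (t - s) `^ rho.
    rewrite -powRM ?divr_ge0 ?(ltW ts) ?(ltW T0)//.
    rewrite /q powR2N_expr.
    apply: ge0_ler_powR; rewrite ?nnegrE ?invr_ge0 ?exprn_ge0 ?mulr_ge0 ?invr_ge0 ?(ltW ts) ?(ltW T0) ?(ltW rho0)//.
    rewrite mulrAC ler_pdivlMr//.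
    move: n2; rewrite exprS => /ltW; rewrite invfM; lra.
  apply: (@le_trans _ _ ((c + M + c) * q ^+ n)); last first.
    by rewrite /K -mulrA ler_wpM2l// !addr_ge0.
  have -> : limn (u t) - limn (u s) = (limn (u t) - u t n) + (u t n - u s n) - (limn (u s) - u s n) by ring.
  apply: (le_trans (ler_normB _ _)); rewrite mulrDl; apply: lerD => //.
  by apply: (le_trans (ler_normD _ _)); rewrite mulrDl; exact: lerD.
exists K => s t; rewrite /= !in_itv/= => /andP[s0 sT] /andP[t0 tT].
have [st|ts|->] := ltgtP s t.
- by rewrite (@gtr0_norm _ (t - s)) ?subr_gt0//; exact: main.
- by rewrite distrC (distrC t s) (@gtr0_norm _ (s - t)) ?subr_gt0//; exact: main.
- by rewrite !subrr !normr0 powR0 ?gt_eqF// mulr0.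
Qed.

Section kolmogorov.
Context d (Omega : measurableType d) (R : realType) (P : probability Omega R).

(** The sum of the series has finite mean, hence is finite almost surely, and it dominates every
    term. This takes the place of a Borel-Cantelli argument. *)
Lemma ae_bounded_geometric (f : nat -> Omega -> R) (c q : R) :
  (forall n, measurable_fun setT (f n)) -> (forall n w, 0 <= f n w) ->
  0 <= c -> 0 <= q -> q < 1 ->
  (forall n, (\int[P]_w (f n w)%:E <= (c * q ^+ n)%:E)%E) ->
  {ae P, forall w, exists M, forall n, f n w <= M}.
Proof.
move=> mf f0 c0 q0 q1 fle.
pose S w := (\sum_(0 <= n <oo) (f n w)%:E)%E.
have mE n : measurable_fun setT (fun w => (f n w)%:E) by exact/measurable_EFinP.
have fE0 n w : (0 <= (f n w)%:E)%E by rewrite lee_fin.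
have S0 w : (0 <= S w)%E by apply: nneseries_ge0 => n _ _; rewrite lee_fin.
have mS : measurable_fun setT S by apply: ge0_emeasurable_sum.
have iS : P.-integrable setT S.
  apply/integrableP; split=> //.
  under eq_integral do rewrite gee0_abs//.
  rewrite /S integral_nneseries//.
  apply: (@le_lt_trans _ _ (\sum_(0 <= n <oo) (c * q ^+ n)%:E)%E).
    by apply: lee_nneseries => // n _ _; exact: integral_ge0.
  have : (fun n => \sum_(0 <= k < n) (c * q ^+ k)%:E)%E @ \oo --> (c * (1 - q)^-1)%:E.
    have -> : (fun n => \sum_(0 <= k < n) (c * q ^+ k)%:E)%E = EFin \o series (geometric c q).
      by apply/funext => n; rewrite /= sumEFin.
    apply: cvg_EFin; first exact: nearW.
    by apply: cvg_geometric_series; rewrite ger0_norm.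
  by move=> /cvg_lim -> //; exact: ltry.
apply: filterS (integrable_ae measurableT iS) => w /(_ I) Sfin.
exists (fine (S w)) => n; rewrite -lee_fin fineK//.
apply: (@le_trans _ _ (\sum_(0 <= k < n.+1) (f k w)%:E)%E); last exact: nneseries_lim_ge.
rewrite big_nat_recr//= leeDr//.
by apply: sume_ge0 => k _.
Qed.

Lemma ae_cvg_geometric_moment (X_ : nat -> {RV P >-> R}) (X : {RV P >-> R}) (p c q : R) :
  0 < p -> 0 <= c -> 0 <= q -> q < 1 ->
  (forall n, (\int[P]_w (`|X w - X_ n w| `^ p)%:E <= (c * q ^+ n)%:E)%E) ->
  {ae P, forall w, X_ n w @[n --> \oo] --> X w}.
Proof.
move=> p0 c0 q0 q1 HX.
(* An intermediate rate between q and 1: after division by r^n the moments still decay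
   geometrically, and the pointwise bound then decays like r^n. *)
pose r := (q + 1) / 2; have r0 : 0 < r by rewrite /r; lra.
have r1 : r < 1 by rewrite /r; lra.
have qr : q / r < 1 by rewrite ltr_pdivrMr// mul1r /r; lra.
have mX n : measurable_fun setT (fun w => `|X w - X_ n w| `^ p).
  by apply: measurable_norm_powR; exact: measurable_funB.
have : {ae P, forall w, exists M, forall n, r ^- n * (`|X w - X_ n w| `^ p) <= M}.
  apply: (@ae_bounded_geometric _ c (q / r)) => //.
  - by move=> n; exact: measurable_funM.
  - by move=> n w; rewrite mulr_ge0 ?powR_ge0// invr_ge0 exprn_ge0// ltW.
  - by rewrite divr_ge0// ltW.
  move=> n; under eq_integral do rewrite EFinM.
  rewrite ge0_integralZl//; last 2 first.
  - exact/measurable_EFinP.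
  - by rewrite lee_fin invr_ge0 exprn_ge0// ltW.
  apply: (@le_trans _ _ ((r ^- n)%:E * (c * q ^+ n)%:E)%E).
    by rewrite lee_wpmul2l// lee_fin invr_ge0 exprn_ge0// ltW.
  by rewrite -EFinM lee_fin [(q / r) ^+ n]expr_div_n mulrCA [_^-1 * _]mulrC.
apply: filterS => w [M HM].
have M0 : 0 <= M.
  by apply: le_trans (HM 0%N); rewrite expr0 invr1 mul1r powR_ge0.
apply/cvgrPdist_le => e e0.
have ep : 0 < e `^ p by rewrite powR_gt0.
have /cvgrPdist_le/(_ _ ep) : geometric M r n @[n --> \oo] --> 0.
  by apply: cvg_geometric; rewrite gtr0_norm.
apply: filterS => n; rewrite sub0r normrN /geometric/= => Hn.
have h : `|X w - X_ n w| `^ p <= e `^ p.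
  apply: le_trans Hn; apply: le_trans (ler_norm _).
  by rewrite -ler_pdivrMr ?exprn_gt0// mulrC.
rewrite leNgt; apply/negP => eX; move: h; rewrite leNgt => /negP; apply.
by apply: gt0_ltr_powR; rewrite ?nnegrE// ltW.
Qed.

(** The modification is the limit of Y along dyadic times below t. It agrees with Y almost surely at
    each t by the moment bound, and its paths are Hoelder by chaining over grid increments. *)
Lemma kolmogorov_chentsov (Y : R -> {RV P >-> R}) (T C p r : R) :
  0 < T -> 0 <= C -> 1 <= p -> 0 < r ->
  (forall s t, 0 <= s -> s < t -> t <= T ->
     (\int[P]_w (`|Y t w - Y s w| `^ p)%:E <= (C * (t - s) `^ (1 + p * r))%:E)%E) ->
  exists Y' : R -> {RV P >-> R},
    modification_on `[0, T]%classic Y' Y /\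
    {ae P, forall w, hoelder_up_to `[0, T]%classic r (fun t => Y' t w)}.
Proof.
move=> T0 C0 p1 r0 HY; have p0 : 0 < p by lra.
pose D n t := dyadic_point T n (dyadic_index T n t).
(* A limit superior, made real by [fine], is measurable on all of the sample space, including the
   points where the dyadic limit fails to exist. *)
pose E t w := fine (limn_esup (fun n => (Y (D n t) w)%:E)).
have mE t : measurable_fun setT (E t).
  apply: (measurableT_comp (@fine_measurable R setT measurableT)).
  by apply: measurable_fun_limn_esup => n; exact/measurable_EFinP.
pose Y' t : {RV P >-> R} := mfun_Sub (mem_set (mE t)).
have EE t w (l : R) : Y (D n t) w @[n --> \oo] --> l -> E t w = l.
  move=> cl; rewrite /E is_cvg_limn_esupE; last first.
    by apply: cvgP; apply: cvg_EFin; [exact: nearW|exact: cl].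
  by rewrite (@cvg_lim _ _ _ _ _ _ (l%:E))//; apply: cvg_EFin => //; exact: nearW.
have Dle n t : 0 <= t -> D n t <= t.
  move=> t0; have /andP[h _] := dyadic_index_itv n T0 t0.
  rewrite /D /dyadic_point ler_pdivrMr ?exprn_gt0// mulrC -ler_pdivlMr//.
  by apply: (le_trans h); rewrite mulrCA mulrA.
have Dge n t : 0 <= t -> t - D n t <= T / 2 ^+ n.
  move=> t0; have /andP[_ h] := dyadic_index_itv n T0 t0.
  rewrite /D /dyadic_point lerBlDl -mulrDl ler_pdivlMr ?exprn_gt0//.
  rewrite -[X in _ + X]mulr1 -mulrDr natr1 -ler_pdivrMl// mulrC mulrAC mulrC.
  by rewrite ltW// mulrAC mulrC.
have D0 n t : 0 <= D n t.
  by rewrite /D /dyadic_point divr_ge0 ?exprn_ge0// mulr_ge0// ltW.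
pose b := 1 + p * r; have b0 : 0 < b by rewrite /b; have := mulr_gt0 p0 r0; lra.
pose q x : R := 2 `^ (- x).
have q0 x : 0 < q x by rewrite powR_gt0.
have q1 x : 0 < x -> q x < 1 by exact: powR2N_lt1.
have qD x y : q (x + y) = q x * q y.
  by rewrite /q opprD powRD// pnatr_eq0 implybT.
have q1E : q 1 = 2^-1 by rewrite /q powR_inv1.
have Tq n : (T / 2 ^+ n) `^ b = T `^ b * (q b) ^+ n.
  rewrite powRM ?invr_ge0 ?exprn_ge0 ?(ltW T0)//; congr (_ * _).
  by rewrite /q powR2N_expr.
exists Y'; split.
  move=> t; rewrite /= in_itv/= => /andP[t0 tT].
  have : {ae P, forall w, Y (D n t) w @[n --> \oo] --> Y t w}.
    apply: (@ae_cvg_geometric_moment _ _ p (C * T `^ b) (q b)) => //.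
    - by rewrite mulr_ge0 ?powR_ge0.
    - exact: ltW.
    - exact: q1.
    move=> n; have [Dt|Dt] := ltP (D n t) t.
      apply: (le_trans (HY _ _ (D0 n t) Dt tT)); rewrite lee_fin -mulrA -Tq.
      rewrite ler_wpM2l//; apply: ge0_ler_powR; rewrite ?nnegrE ?(ltW b0)//.
      + by rewrite subr_ge0 ltW.
      + by rewrite divr_ge0 ?exprn_ge0// ltW.
      + exact: Dge.
    have -> : D n t = t by apply/eqP; rewrite eq_le Dle.
    under eq_integral do rewrite subrr normr0 powR0 ?gt_eqF//.
    rewrite integral0 lee_fin !mulr_ge0 ?powR_ge0// exprn_ge0// ltW//.
  by apply: filterS => w; exact: EE.
(* Countably many exponents increasing to r, so that one event of full measure serves all orders
   below r; [j.+2] keeps them positive. *)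
pose rho j : R := r - r / j.+2%:R.
have rr j : 0 < r / j.+2%:R by rewrite divr_gt0.
have rho0 j : 0 < rho j.
  rewrite /rho subr_gt0 ltr_pdivrMr// ltr_pMr// ltr1n//.
have rhor j : rho j < r by rewrite /rho ltrBlDr ltrDl.
pose inc n k w := `|Y (dyadic_point T n k.+1) w - Y (dyadic_point T n k) w|.
(* The 2^n increments of level n have total moment of order 2^n 2^(-n (1 + p r)) = 2^(-n p r);
   division by 2^(-n p rho_j) leaves geometric decay at rate p (r - rho_j). *)
have key j : {ae P, forall w, exists M, forall n,
    (q (p * rho j)) ^- n * \sum_(k < 2 ^ n) inc n k w `^ p <= M}.
  have minc n k : measurable_fun setT (fun w => inc n k w `^ p).
    by apply: measurable_norm_powR; exact: measurable_funB.
  have msum n : measurable_fun setT (fun w => \sum_(k < 2 ^ n) inc n k w `^ p).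
    by apply: measurable_sum => k.
  have pr0 : 0 < p * (r - rho j) by rewrite mulr_gt0// subr_gt0.
  apply: (@ae_bounded_geometric _ (C * T `^ b) (q (p * (r - rho j)))).
  - by move=> n; exact: measurable_funM.
  - move=> n w; rewrite mulr_ge0 ?invr_ge0 ?exprn_ge0 ?(ltW (q0 _))//.
    by apply: sumr_ge0 => k _; exact: powR_ge0.
  - by rewrite mulr_ge0 ?powR_ge0.
  - exact: ltW.
  - exact: q1.
  move=> n; under eq_integral do rewrite EFinM.
  rewrite ge0_integralZl//; last 3 first.
  - exact/measurable_EFinP.
  - by move=> w _; rewrite lee_fin sumr_ge0// => k _; exact: powR_ge0.
  - by rewrite lee_fin invr_ge0 exprn_ge0// ltW.
  under eq_integral do rewrite -sumEFin.
  rewrite ge0_integral_sum//; last 2 first.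
  - by move=> k; exact/measurable_EFinP.
  - by move=> k w _; rewrite lee_fin powR_ge0.
  apply: (@le_trans _ _ (((q (p * rho j)) ^- n)%:E *
      \sum_(k < 2 ^ n) (C * (T `^ b * q b ^+ n))%:E)%E).
    rewrite lee_wpmul2l ?lee_fin ?invr_ge0 ?exprn_ge0 ?(ltW (q0 _))//.
    apply: lee_sum => k _; rewrite -Tq.
    have kE : dyadic_point T n k.+1 - dyadic_point T n k = T / 2 ^+ n.
      by rewrite /dyadic_point -mulrBl -mulrBr -natr1 addrAC subrr add0r mulr1.
    rewrite -kE; apply: HY.
    - by rewrite /dyadic_point divr_ge0 ?exprn_ge0// mulr_ge0// ltW.
    - by rewrite -subr_gt0 kE divr_gt0 ?exprn_gt0.
    - rewrite /dyadic_point ler_pdivrMr ?exprn_gt0// ler_pM2l//.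
      by rewrite -natrX ler_nat.
  rewrite sumEFin -EFinM lee_fin sumr_const card_ord -mulr_natr natrX.
  have qb : q b ^+ n * 2 ^+ n = q (p * r) ^+ n.
    by rewrite -exprMn /b qD q1E mulrAC mulVf ?mul1r// pnatr_eq0.
  have qr : q (p * r) ^+ n = q (p * rho j) ^+ n * q (p * (r - rho j)) ^+ n.
    by rewrite -exprMn -qD -mulrDr addrC subrK.
  have -> : C * (T `^ b * q b ^+ n) * 2 ^+ n = C * T `^ b * (q b ^+ n * 2 ^+ n) by ring.
  rewrite qb qr mulrCA [X in _ * X]mulrA mulVf ?mul1r// gt_eqF// exprn_gt0//.
apply: filterS (ae_foralln key) => w Hw rh rh0 rhr.
have [j rhj] : exists j, rh <= rho j.
  exists (Num.bound (r / (r - rh))); rewrite /rho lerBrDl -lerBrDr.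
  rewrite ler_pdivrMr// mulrC -ler_pdivrMr ?subr_gt0//.
  apply: (@le_trans _ _ (Num.bound (r / (r - rh)))%:R); last by rewrite ler_nat -addn2 leq_addr.
  by apply: ltW; apply: archi_boundP; rewrite divr_ge0// ?subr_ge0 ltW.
have [M HM] := Hw j.
(* A single increment is bounded by the whole sum of p-th powers; taking the p-th root turns the
   rate p rho_j into rho_j. *)
pose M1 := (Num.max M 0) `^ p^-1.
have [cY [K HK]] : (forall t, 0 <= t -> t <= T -> cvgn (fun n => Y (D n t) w)) /\
  hoelder_on `[0, T]%classic (rho j) (fun t => limn (fun n => Y (D n t) w)).
  apply: (@dyadic_chaining _ (fun t => Y t w) T (rho j) M1) => //; first exact: powR_ge0.
  move=> n k kn; rewrite -/(inc n k w) -/(q (rho j)).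
  have qn0 : 0 < q (p * rho j) ^+ n by rewrite exprn_gt0.
  have h : inc n k w `^ p <= Num.max M 0 * q (p * rho j) ^+ n.
    rewrite -ler_pdivrMr// mulrC; apply: le_trans; last by rewrite le_max; apply/orP; left; exact: (HM n).
    rewrite ler_wpM2l ?invr_ge0 ?(ltW qn0)//.
    rewrite (bigD1 (Ordinal kn))//= lerDl.
    by apply: sumr_ge0 => i _; exact: powR_ge0.
  have -> : inc n k w = (inc n k w `^ p) `^ p^-1.
    by rewrite -powRrM divff ?gt_eqF// powRr1// /inc.
  have -> : M1 * q (rho j) ^+ n = (Num.max M 0 * q (p * rho j) ^+ n) `^ p^-1.
    rewrite powRM ?le_max ?lexx ?orbT ?(ltW qn0)//; congr (_ * _).
    rewrite /q !powR2N_expr -powRrM; congr (_ `^ _).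
    by rewrite mulrAC divff ?mul1r// gt_eqF.
  apply: ge0_ler_powR; rewrite ?nnegrE ?powR_ge0 ?invr_ge0 ?(ltW p0)//.
  by rewrite mulr_ge0 ?(ltW qn0)// le_max lexx orbT.
have YE t : 0 <= t -> t <= T -> E t w = limn (fun n => Y (D n t) w).
  by move=> t0 tT; apply: EE; exact: cY.
(* On an interval of length T, Hoelder order rho_j implies the smaller order at the cost of this
   power of T. *)
exists (Num.max K 0 * T `^ (rho j - rh)) => s t; rewrite /= !in_itv/= => sI tI.
have /andP[s0 sT] := sI; have /andP[t0 tT] := tI.
rewrite !YE//; apply: (le_trans (HK s t _ _)); rewrite ?in_itv//=.
have [->|ts] := eqVneq (t - s) 0.
  by rewrite normr0 !powR0 ?gt_eqF// !mulr0.
have ts0 : 0 < `|t - s| by rewrite normr_gt0.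
apply: (@le_trans _ _ (Num.max K 0 * `|t - s| `^ rho j)).
  by rewrite ler_wpM2r ?powR_ge0// le_max lexx.
rewrite -mulrA ler_wpM2l ?le_max ?lexx ?orbT//.
apply: powR_le_exponent => //; rewrite ler_norml; lra.
Qed.

End kolmogorov.

(** * Moments of increments and path regularity *)

(** Pointwise x^2 <= min (x^2, 1) + |x|^p, since p >= 2 handles |x| > 1. *)
Lemma integral_sqr_lty (R : realType) (nu : {measure set (measurableTypeR R) -> \bar R})
    (p : R) : levy_measure nu -> 2 <= p -> (\int[nu]_x (`|x| `^ p)%:E < +oo)%E ->
  (\int[nu]_x (x ^+ 2)%:E < +oo)%E.
Proof.
move=> [_ nu1] p2 nup.
have mp : measurable_fun setT (fun x : measurableTypeR R => (`|x| `^ p)%:E).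
  by apply/measurable_EFinP; apply: measurable_norm_powR; exact: measurable_id.
have mm : measurable_fun setT (fun x : measurableTypeR R => (Num.min (x ^+ 2) 1)%:E).
  by apply/measurable_EFinP; apply: measurable_minr => //; exact: measurable_funX.
have m0 (x : R) : (0 <= (Num.min (x ^+ 2) 1)%:E)%E.
  by rewrite lee_fin le_min sqr_ge0 ler01.
apply: (@le_lt_trans _ _ (\int[nu]_x ((Num.min (x ^+ 2) 1)%:E + (`|x| `^ p)%:E))%E).
  apply: ge0_le_integral => //.
  - by move=> x _; rewrite lee_fin sqr_ge0.
  - by apply/measurable_EFinP; exact: measurable_funX.
  - exact: emeasurable_funD.
  move=> x _; rewrite -EFinD lee_fin.
  have [x1|x1] := leP (x ^+ 2) 1; first by rewrite lerDl powR_ge0.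
  apply: ler_wpDl => //; rewrite -real_normK ?num_real// -powR_mulrn//.
  apply: ler_powR => //; rewrite -real_normK ?num_real// in x1.
  by rewrite leNgt; apply/negP => h; move: x1; rewrite ltNge exprn_ile1// ltW.
by rewrite ge0_integralD//; exact: lte_add_pinfty.
Qed.

Lemma increment_moment (R : realType) (d : measure_display) (Omega : measurableType d)
  (P : probability Omega R) (T : R) (Z : R -> {RV P >-> R}) (a : R)
  (nu : {measure set (measurableTypeR R) -> \bar R})
  (g : R -> R -> R) (Y : R -> {RV P >-> R}) (p alpha beta gamma delta kappa : R) :
  0 < T -> 0 <= a -> levy_measure nu -> symmetric_measure nu ->
  levy_process_triplet Z a 0 nu ->
  measurable_kernel g T ->
  (forall t : R, 0 <= t -> t <= T -> levy_integral Z t (g t) (Y t)) ->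
  2 <= p -> (\int[nu]_x (`|x| `^ p)%:E < +oo)%E ->
  - p^-1 < beta -> - p^-1 < gamma -> - p^-1 < alpha + beta + gamma ->
  kernel_bound g T alpha beta gamma -> kernel_increment_bound g T p delta ->
  kappa = (if alpha + beta < 0 then alpha + beta + gamma else gamma) ->
  exists2 C : R, 0 <= C & forall s t, 0 <= s -> s < t -> t <= T ->
    (\int[P]_w (`|Y t w - Y s w| `^ p)%:E <=
     (C * (t - s) `^ Num.min (kappa * p + 1) (delta * p))%:E)%E.
Proof.
move=> T0 a0 hnu sym hZ mg hY p2 nup hb hc habc B1 B2 hk.
have p0 : 0 < p by lra.
have nu2 := integral_sqr_lty hnu p2 nup.
have lawZ := levy_sym_law sym nu2 hZ.
have [K K0 HK] := integral_moment_bound hZ.1 a0 nu2 nup lawZ T0 p2.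
have [D D0 HD] := kernel_diff_moment_le T0 mg p0 hb hc habc B1 B2 hk.
exists (K * D) => [|s t s0 st tT]; first by rewrite mulr_ge0// ltW.
have sT : s <= T by lra.
have t0 : 0 <= t by lra.
have [L [F_ [measL F_cvg J_cvg]]] :=
  levy_integral_kernel_diff s0 sT t0 tT (hY s s0 sT) (hY t t0 tT).
have w0 : 0 < D * (t - s) `^ Num.min (kappa * p + 1) (delta * p).
  by rewrite mulr_gt0// powR_gt0// subr_gt0.
rewrite -mulrA.
exact: (HK L F_ (kernel_diff g s t) (Y t - Y s : {RV P >-> R}) _ measL
  (measurable_kernel_diff mg sT tT) F_cvg J_cvg w0 (HD s t s0 st tT)).
Qed.

Theorem lemma6 (R : realType) (d : measure_display) (Omega : measurableType d)
  (P : probability Omega R) (T : R) (hT : 0 < T)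
  (Z : R -> {RV P >-> R}) (a : R)
  (pi_Z : {measure set (measurableTypeR R) -> \bar R})
  (ha : 0 <= a) (hpi : levy_measure pi_Z) (hsym : symmetric_measure pi_Z)
  (hZ : levy_process_triplet Z a 0 pi_Z)
  (g : R -> R -> R)
  (hg : measurable_fun [set x : R * R | 0 < x.2 /\ x.2 < x.1 /\ x.1 <= T]
          (fun x : R * R => g x.1 x.2))
  (Y : R -> {RV P >-> R})
  (hY : forall t : R, 0 <= t -> t <= T -> levy_integral Z t (g t) (Y t))
  (p : R) (hp : 2 <= p)
  (hmom : (\int[pi_Z]_(x in setT) (`|x| `^ p)%:E < +oo)%E)
  (alpha beta gamma delta : R)
  (hbeta : - p^-1 < beta) (hgamma : - p^-1 < gamma)
  (habg : - p^-1 < alpha + beta + gamma) (hdelta : 0 < delta)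
  (B1 : exists C : R, forall t u : R, 0 < u -> u < t -> t <= T ->
          `|g t u| <= C * t `^ alpha * u `^ beta * (t - u) `^ gamma)
  (B2 : exists h : R -> R -> R -> R,
     [/\ forall t s : R, 0 < s -> s < t -> t <= T ->
           measurable_fun (`]0, s[ : set R) (h t s),
         forall t s u : R, 0 < u -> u < s -> s < t -> t <= T ->
           `|g t u - g s u| <= `|t - s| `^ delta * h t s u &
         (ereal_sup [set I : \bar R | exists s t : R,
            [/\ (0 < s)%R, (s < t)%R, (t <= T)%R &
              I = \int[lebesgue_measure]_(u in `]0%R, s[)
                    (`|h t s u| `^ p)%:E]] < +oo)%E])
  (kappa : R)
  (hkappa : kappa = if alpha + beta < 0 then alpha + beta + gamma else gamma) :
  (exists C : R, forall s t : R, 0 <= s -> s < t -> t <= T ->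
     ('E_P[(fun w => `|Y t w - Y s w| `^ p)%R] <=
      (C * (t - s) `^ Num.min (kappa * p + 1) (delta * p))%:E)%E) /\
  (0 < kappa -> p^-1 < delta ->
     exists Y' : R -> {RV P >-> R},
       modification_on `[0, T]%classic Y' Y /\
       {ae P, forall w,
          hoelder_up_to `[0, T]%classic (Num.min kappa (delta - p^-1))
            (fun t => Y' t w)}).
Proof.
have [C C0 HC] := increment_moment hT ha hpi hsym hZ hg hY hp hmom hbeta hgamma habg B1 B2 hkappa.
split=> [|kappa0 deltap].
  by exists C => s t s0 st tT; rewrite unlock; exact: HC.
have p0 : 0 < p by lra.
have r0 : 0 < Num.min kappa (delta - p^-1) by rewrite lt_min kappa0 subr_gt0.
have p1 : 1 <= p by lra.
apply: (@kolmogorov_chentsov _ _ _ _ Y T C p (Num.min kappa (delta - p^-1)) hT C0 p1 r0).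
move=> s t s0 st tT; apply: (le_trans (HC s t s0 st tT)).
(* The moment exponent is exactly 1 + p r with r the claimed order; kappa > 0 and delta > 1/p say
   that r is positive. *)
rewrite lee_fin; suff -> : Num.min (kappa * p + 1) (delta * p) =
  1 + p * Num.min kappa (delta - p^-1) by [].
rewrite minr_pMr ?(ltW p0)// addr_minr mulrBr divff ?gt_eqF//.
by rewrite addrCA subrr addr0 [1 + _]addrC ![p * _]mulrC.
Qed.
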